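(* Let $M$ be a compact quotient of $H_3\times H_5$ by a lattice of maximal rank. Then there exists a complex structure on $M$ which admits neither SKT nor balanced Hermitian structures, but which has invariant $k$-th Gauduchon metrics for $k=1$ and $2$.
   Context: $H_{2n+1}$ denotes the generalized real Heisenberg group of dimension $2n+1$. A metric on $M=\Gamma\backslash G$ is invariant if it is induced by a left-invariant metric on $G$. On a complex manifold $(M,J)$ of complex dimension $n$ (here $n=4$), a $J$-Hermitian metric $g$ with fundamental form $\Omega(\cdot,\cdot)=g(J\cdot,\cdot)$ is: SKT if $\partial\overline{\partial}\Omega=0$; balanced if $d(\Omega^{n-1})=0$; $k$-th Gauduchon ($1\le k\le n-1$) if $\partial\overline{\partial}\Omega^k\wedge\Omega^{n-k-1}=0$. *)

(* Defs.v *)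
From HB Require Import structures.
From mathcomp Require Import all_boot all_order all_algebra all_fingroup.
From mathcomp Require Import complex generic_quotient ring.
From mathcomp Require Import all_classical all_reals all_analysis.
Import Order.TTheory GRing.Theory Num.Theory.
Import numFieldNormedType.Exports.

Set Implicit Arguments.
Unset Strict Implicit.
Unset Printing Implicit Defensive.

Local Open Scope classical_set_scope.
Local Open Scope ring_scope.

(** ** Heisenberg groups

    [((x, y), z) : heis R n] stands for the upper unitriangular matrix
<<
      1   x   z
      0  I_n y^T
      0   0   1
>>
    of size [n + 2], and the group law is matrix multiplication.  The entries
    are global coordinates of the Lie group [H_{2n+1}], so its tangent space at
    each point is identified with the vector space [heis R n] itself. *)

Definition heis (R : realType) (n : nat) : Type :=
  ('rV[R]_n * 'rV[R]_n * R)%type.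

Section HeisGroup.
Variables (R : realType) (n : nat).
Implicit Types a b : heis R n.

HB.instance Definition _ :=
  NormedModule.copy (heis R n) ('rV[R]_n * 'rV[R]_n * R^o)%type.

Definition heis_one : heis R n := (0, 0, 0).

Definition heis_mul a b : heis R n :=
  (a.1.1 + b.1.1, a.1.2 + b.1.2, a.2 + b.2 + (a.1.1 *m b.1.2^T) 0 0).

Definition heis_inv a : heis R n :=
  (- a.1.1, - a.1.2, - a.2 + (a.1.1 *m a.1.2^T) 0 0).

Lemma heis_mulA : associative heis_mul.
Proof.
move=> [[x y] z] [[x' y'] z'] [[x'' y''] z'']; rewrite /heis_mul /=.
rewrite linearD /= mulmxDr mulmxDl; congr (_, _, _); rewrite ?addrA //.
by rewrite ![fun_of_matrix (_ + _) _ _]mxE; ring.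
Qed.

Lemma heis_mul1 : left_id heis_one heis_mul.
Proof.
by move=> [[x y] z]; rewrite /heis_mul /= !add0r mul0mx mxE addr0.
Qed.

Lemma heis_mulr1 : right_id heis_one heis_mul.
Proof.
by move=> [[x y] z]; rewrite /heis_mul /= !addr0 trmx0 mulmx0 mxE addr0.
Qed.

Lemma heis_mulV : left_inverse heis_one heis_inv heis_mul.
Proof.
move=> [[x y] z]; rewrite /heis_mul /heis_inv /heis_one /= !addNr mulNmx.
by congr (_, _, _); rewrite /= ?[fun_of_matrix (- _) _ _]mxE; ring.
Qed.

Lemma heis_mulrV : right_inverse heis_one heis_inv heis_mul.
Proof.
move=> [[x y] z]; rewrite /heis_mul /heis_inv /heis_one /= !addrN.
by congr (_, _, _); rewrite linearN /= mulmxN ?[fun_of_matrix (- _) _ _]mxE; ring.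
Qed.

HB.instance Definition _ := isGroup.Build (heis R n)
  heis_mulA heis_mul1 heis_mulr1 heis_mulV heis_mulrV.

End HeisGroup.

Notation "'H3xH5' R" := (heis R 1 * heis R 2)%type (at level 10, R at level 9).

(** ** Lattices and quotients *)

Record subgroup (G : groupType) := Subgroup {
  subgroup_set :> set G;
  subgroup1 : subgroup_set 1%g;
  subgroupM : forall a b,
    subgroup_set a -> subgroup_set b -> subgroup_set (a * b)%g;
  subgroupV : forall a, subgroup_set a -> subgroup_set (a^-1)%g }.

Section LeftQuotient.
Variables (G : groupType) (Gam : subgroup G).

Definition same_orbit : rel G := fun x y =>
  `[< exists2 a, subgroup_set Gam a & y = (a * x)%g >].

Lemma same_orbit_equiv : equiv_class_of same_orbit.
Proof.
split=> [x | x y | y x z].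
- by apply/asboolP; exists 1%g; [exact: subgroup1 | rewrite mul1g].
- by apply: asbool_equiv_eq; split=> -[a Ga ->]; exists a^-1%g;
    rewrite ?mulKg //; exact: subgroupV.
- move=> /asboolP[a Ga ->] /asboolP[b Gb ->]; apply/asboolP.
  by exists (b * a)%g; [exact: subgroupM | rewrite mulgA].
Qed.

Canonical same_orbit_equivRel := EquivRelPack same_orbit_equiv.

Definition left_quotient := {eq_quot same_orbit_equivRel}%qT.

End LeftQuotient.

Section Lattice.
Variables (R : realType).
Local Notation G := (H3xH5 R).

Definition is_lattice (Gam : subgroup G) : Prop :=
  (\forall x \near (1%g : G), subgroup_set Gam x -> x = 1%g) /\
  compact [set: quotient_topology (left_quotient Gam)].
End Lattice.

(** ** Complex-valued differential forms on a vector space [V]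

    A [k]-form is given by its values on [k] tangent vectors.  All the forms
    considered below are alternating and multilinear, since they are obtained
    from the fundamental form of a Hermitian metric by the operations of this
    section. *)

Section Forms.
Variables (R : realType) (V : normedModType R).
Implicit Types (J : V -> V -> V) (g : V -> V -> V -> R).

Definition smooth_on (W : normedModType R) (U : set V) (f : V -> W) : Prop :=
  forall (vs : seq V) (x : V), U x ->
    differentiable (foldr (fun v h => 'D_v h) f vs) x.

Definition cderive (v : V) (f : V -> R[i]) (x : V) : R[i] :=
  Complex ('D_v (fun y => complex.Re (f y) : R^o) x)
          ('D_v (fun y => complex.Im (f y) : R^o) x).

Definition dform (k : nat) : Type := V -> ('I_k -> V) -> R[i].

Definition ext_d k (w : dform k) : dform k.+1 := fun x v =>
  \sum_(i < k.+1) (-1) ^+ i *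
    cderive (v i) (fun y => w y (fun j => v (lift i j))) x.

Definition wedge k l (w : dform k) (u : dform l) : dform (k + l) := fun x v =>
  (k`! * l`!)%:R^-1 * \sum_(s : 'S_(k + l)) (-1) ^+ s *
    w x (fun i => v (s (lshift l i))) * u x (fun i => v (s (rshift k i))).

Fixpoint form_exp (w : dform 2) (k : nat) : dform k.*2 :=
  if k is k'.+1 then wedge w (@form_exp w k') else fun _ _ => 1.
Arguments form_exp w k : clear implicits.

(** The component of bidegree [(p, k - p)] of a [k]-form [w]: the sum over all
    [S] with [p] elements of the values of the complex multilinear extension of
    [w] at the vectors [(v j - 'i J v j) / 2] for [j] in [S] and
    [(v j + 'i J v j) / 2] for [j] not in [S], expanded by multilinearity ([T]
    is the set of positions where the second summand is taken). *)
Definition bidegree J (p k : nat) (w : dform k) : dform k := fun x v =>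
  (2 ^ k)%:R^-1 * \sum_(S : {set 'I_k} | #|S| == p) \sum_(T : {set 'I_k})
    (\prod_(j in T) (if j \in S then - 'i%C else 'i%C)) *
    w x (fun j => if j \in T then J x (v j) else v j).

Definition del J k (w : dform k) : dform k.+1 := fun x v =>
  \sum_(p < k.+1) bidegree J p.+1 (ext_d (bidegree J p w)) x v.

Definition delbar J k (w : dform k) : dform k.+1 := fun x v =>
  \sum_(p < k.+1) bidegree J p (ext_d (bidegree J p w)) x v.

Definition form_zero k (w : dform k) : Prop := forall x v, w x v = 0.

Definition fundamental_form J g : dform 2 := fun x v =>
  (g x (J x (v ord0)) (v ord_max))%:C%C.

Definition SKT J g : Prop :=
  form_zero (del J (delbar J (fundamental_form J g))).

Definition balanced (n : nat) J g : Prop :=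
  form_zero (ext_d (form_exp (fundamental_form J g) n.-1)).

Definition gauduchon (n k : nat) J g : Prop :=
  let Om := fundamental_form J g in
  form_zero (wedge (del J (delbar J (form_exp Om k)))
                   (form_exp Om (n - k - 1))).

End Forms.

Arguments form_exp {R V} w k.

(** ** Tensors on [Gam \ G]

    Tensor fields on [Gam \ G] are identified with the tensor fields on [G]
    which are invariant under left translations by elements of [Gam]. *)

Section Structures.
Variables (R : realType).
Local Notation G := (H3xH5 R).
Implicit Types (A : set G) (J : G -> G -> G) (g : G -> G -> G -> R).

Definition dtrans (a x v : G) : G := 'D_v (fun y : G => (a * y)%g : G) x.

Definition endo_invariant A J : Prop := forall a x v, A a ->
  J (a * x)%g (dtrans a x v) = dtrans a x (J x v).

Definition metric_invariant A g : Prop := forall a x v w, A a ->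
  g (a * x)%g (dtrans a x v) (dtrans a x w) = g x v w.

(** Complex structures on [Gam \ G], of complex dimension [4]: almost complex
    structures [J] which come from local holomorphic coordinates [z], that is,
    from complex-valued local coordinates whose differentials are complex linear
    with respect to [J]. *)
Definition holomorphic_chart J (U : set G) (z : 'I_4 -> G -> R[i]) : Prop :=
  [/\ forall j, smooth_on U (fun y => complex.Re (z j y) : R^o) /\
                smooth_on U (fun y => complex.Im (z j y) : R^o),
      forall x v j, U x -> cderive (J x v) (z j) x = 'i%C * cderive v (z j) x &
      forall x v, U x -> (forall j, cderive v (z j) x = 0) -> v = 0].

Definition complex_structure (Gam : set G) J : Prop :=
  [/\ forall x, linear (J x),
      forall v, smooth_on setT (fun x => J x v : G),
      forall x v, J x (J x v) = - v,
      endo_invariant Gam J &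
      forall x, exists2 U : set G, open_nbhs x U &
        exists z, holomorphic_chart J U z].

Definition hermitian_metric (Gam : set G) J g : Prop :=
  [/\ (forall x v, scalar (g x v)) /\ (forall x v w, g x v w = g x w v),
      forall x v, v != 0 -> 0 < g x v v,
      forall v w, smooth_on setT (fun x => g x v w : R^o),
      metric_invariant Gam g &
      forall x v w, g x (J x v) (J x w) = g x v w].

Definition left_invariant g : Prop := metric_invariant setT g.

End Structures.

(* Main.v *)
Require Import Defs.
From HB Require Import structures.
From mathcomp Require Import all_boot all_order all_algebra all_fingroup.
From mathcomp Require Import complex generic_quotient ring lra zify.
From mathcomp Require Import all_classical all_reals all_analysis.
Import Order.TTheory GRing.Theory Num.Theory.
Import numFieldNormedType.Exports.
Set Implicit Arguments.
Unset Strict Implicit.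
Unset Printing Implicit Defensive.
Local Open Scope classical_set_scope.
Local Open Scope ring_scope.

(** Let [X_j, Y_j] ([j = 0, 1, 2]), [Z_0], [Z_1] be the left-invariant frame with
    [[X_0, Y_0] = Z_0] and [[X_1, Y_1] = [X_2, Y_2] = Z_1], so that the group is
    the product of [H_3] and [H_5].  The complex structure is the left-invariant
    one with [J X_j = Y_j] and [J Z_1 = Z_0 + Z_1].  Its (1,0)-forms are generated
    by [zeta_j = dx_j + i dy_j] and [om = z_1^* + (i - 1) z_0^*], and with
    [sigma_j = dx_j /\ dy_j] the structure equation reads
    [- d om = tau := (i - 1) sigma_0 + sigma_1 + sigma_2].  As the [sigma_j] have type
    (1,1), [J] is integrable: correcting a primitive of [om] by the functions
    [chart_potential] gives global holomorphic coordinates.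

    The metric.  Take [Omega = s + (i / 2) om /\ om^-] with
    [s = 2 sigma_0 + sigma_1 + sigma_2].  The forms [s] and [tau] are closed, so only
    the second summand contributes to [del delbar Omega], which is a multiple of
    [tau /\ tau^-], and [del delbar Omega^2] is a multiple of [tau /\ tau^- /\ s].
    A product of three combinations of the [sigma_j] is the permanent of the
    matrix of coefficients times [sigma_0 /\ sigma_1 /\ sigma_2]
    ([diag_permanent]), and the permanent of the rows [(i - 1, 1, 1)],
    [(- i - 1, 1, 1)], [(2, 1, 1)] vanishes; the weight 2 is chosen for that.
    Hence [metric_gauduchon1] and [metric_gauduchon2].

    The obstructions.  They concern every metric that is invariant under the
    lattice only.  The left-invariant frame preserves volume, so the divergence
    [\sum_n E_n f_n] of a field with lattice-invariant components cannot be
    positive everywhere ([frame_divergence]).  This is proved by adding up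
    increments over a large box, whose boundary is of lower order than its volume
    ([mean_divergence]).  In the frame, the exterior derivative is such a
    divergence up to bracket terms ([ext_d_frame]), and the bracket terms are what
    remains:
    - if [g] is SKT, evaluating [del delbar Omega = 0] on [X_1, Y_1, X_2, Y_2], where
      only [[X_1, Y_1]] and [[X_2, Y_2]] intervene, writes [g (J Z_1, J Z_1)] as a
      divergence ([no_SKT]);
    - if [g] is balanced, evaluating [d (Omega^3) = 0] on
      [X_0, Y_0, X_1, Y_1, X_2, Y_2, Z_1] writes
      [Omega^3 (Z_0, X_1, Y_1, X_2, Y_2, Z_1)] as a divergence.  As
      [Z_0 = J Z_1 - Z_1], this is, up to sign, 6 times the Hermitian Gram determinant
      of [X_1, X_2, Z_1], and it has constant sign ([no_balanced]). *)

(** * Alternating sums *)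

Section LiftCombinatorics.

Lemma lift_perm_surj n (s : 'S_n.+1) (i : 'I_n.+1) :
  exists t : 'S_n, s = lift_perm i (s i) t.
Proof.
have /= ui (k : 'I_n) : {j | s (lift i k) = lift (s i) j}.
  have : s i != s (lift i k) by rewrite (inj_eq perm_inj) neq_lift.
  by move=> /unlift_some[j -> _]; exists j.
have finj : injective (fun k => sval (ui k)).
  move=> k l /= e; apply: (@lift_inj _ i); apply: (@perm_inj _ s).
  by case: (ui k) (ui l) e => a ea [b eb] /= ab; rewrite ea eb ab.
exists (perm finj); apply/permP => k.
case: (unliftP i k) => [k'|] ->; last by rewrite lift_perm_id.
by rewrite lift_perm_lift permE; case: (ui k').
Qed.

(** Sorting the permutations by the image of one point is how a slot is split
    off in the wedge products below, as in the Laplace expansion. *)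
Lemma big_lift_perm (A : nmodType) n (i : 'I_n.+1) (F : 'S_n.+1 -> A) :
  \sum_(s : 'S_n.+1) F s = \sum_(j < n.+1) \sum_(t : 'S_n) F (lift_perm i j t).
Proof.
rewrite pair_big /= (reindex (fun p : 'I_n.+1 * 'S_n => lift_perm i p.1 p.2)) //=.
apply: onW_bij; apply: inj_card_bij => [[j t] [j' t'] /= e|]; last first.
  by rewrite card_prod !card_Sn card_ord -factS.
have ej : j = j' by rewrite -(lift_perm_id i j t) e lift_perm_id.
rewrite -{}ej in e *; congr (_, _); apply/permP => k.
by apply: (@lift_inj _ j); rewrite -2!(lift_perm_lift i) e.
Qed.

Lemma sign_lift_perm (A : pzRingType) n (i j : 'I_n.+1) (t : 'S_n) :
  (-1) ^+ lift_perm i j t = (-1) ^+ i * (-1) ^+ j * (-1) ^+ t :> A.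
Proof. by rewrite odd_lift_perm !signr_addb !signr_odd. Qed.

(** A pair [(i, j)] stands for the removal of position [i], then of position [j]
    among the remaining ones; [swap_lift] removes the same two positions in the
    other order. *)
Definition swap_lift n (p : 'I_n.+2 * 'I_n.+1) : 'I_n.+2 * 'I_n.+1 :=
  (lift p.1 p.2, inord (if (p.2 < p.1)%N then p.1.-1 else p.1)).

Lemma swap_lift_val n (p : 'I_n.+2 * 'I_n.+1) :
  (swap_lift p).2 = (if (p.2 < p.1)%N then p.1.-1 else p.1) :> nat.
Proof.
case: p => i j /=; rewrite inordK //.
by case: ifP => ji; move: (ltn_ord i) (ltn_ord j) ji; lia.
Qed.

Lemma swap_liftK n : involutive (@swap_lift n).
Proof.
move=> p; rewrite [LHS]surjective_pairing [RHS]surjective_pairing.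
have e := swap_lift_val p; have e' := swap_lift_val (swap_lift p).
congr (_, _); apply: ord_inj; last rewrite e'; move: e;
  case: p {e'} => i j /=; rewrite /bump => ->.
  by case: ifP => ji; move: (ltn_ord i) (ltn_ord j) ji; lia.
by case: ifP => ji; move: (ltn_ord i) (ltn_ord j) ji; rewrite /bump; case: ifP; lia.
Qed.

Lemma lift_swap_lift n (p : 'I_n.+2 * 'I_n.+1) :
  [/\ lift (swap_lift p).1 (swap_lift p).2 = p.1,
      forall k : 'I_n, lift (swap_lift p).1 (lift (swap_lift p).2 k) =
                       lift p.1 (lift p.2 k) &
      odd ((swap_lift p).1 + (swap_lift p).2) = ~~ odd (p.1 + p.2)].
Proof.
have e := swap_lift_val p.
split=> [|k|]; first by rewrite -[in RHS](swap_liftK p).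
  apply: ord_inj; move: e; case: p => i j /=; rewrite /bump => ->.
  by case: ifP => ji; move: (ltn_ord i) (ltn_ord j) (ltn_ord k) ji; lia.
rewrite e; case: p {e} => i j /=; rewrite /bump.
by case: ifP => ji; move: (ltn_ord i) (ltn_ord j) ji; lia.
Qed.

End LiftCombinatorics.

Section AltSum.
Variables (V : Type) (C : comPzRingType).

(** The common shape of [e /\ u] for a one-form [e], with [F h = e h * u], and of
    [d u], with [F h] the derivative of [u] along [h]. *)
Definition alt_sum k (F : V -> ('I_k -> V) -> C) (v : 'I_k.+1 -> V) : C :=
  \sum_(i < k.+1) (-1) ^+ i * F (v i) (fun j => v (lift i j)).

Definition alternates k (f : ('I_k -> V) -> C) : Prop :=
  forall v (s : 'S_k), f (fun j => v (s j)) = (-1) ^+ s * f v.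

Lemma alt_sum_alternating k (F : V -> ('I_k -> V) -> C) :
  (forall h, alternates (F h)) -> alternates (alt_sum F).
Proof.
move=> altF v s; rewrite /alt_sum mulr_sumr.
rewrite [RHS](reindex_inj (@perm_inj _ s)) /=; apply: eq_bigr => i _.
have [t st] := lift_perm_surj s i.
have -> : (fun j => v (s (lift i j))) = (fun j => v (lift (s i) (t j))).
  by apply/funext => j; rewrite {1}st lift_perm_lift.
rewrite (altF (v (s i)) (fun j => v (lift (s i) j)) t) !mulrA; congr (_ * _).
have -> : (-1) ^+ s = (-1) ^+ i * (-1) ^+ s i * (-1) ^+ t :> C.
  by rewrite {1}st sign_lift_perm.
by rewrite -[RHS]mulrA mulrACA -expr2 sqrr_sign mulr1.
Qed.

(** [swap_lift] pairs off the two orders of removal with opposite signs: the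
    source of [e /\ f = - f /\ e] and of the sign in the Leibniz rule. *)
Lemma alt_sum_swap k (F : V -> V -> ('I_k -> V) -> C) v :
  alt_sum (fun h => alt_sum (F h)) v =
  - alt_sum (fun h => alt_sum (fun h' => F h' h)) v.
Proof.
rewrite /alt_sum -sumrN.
under eq_bigr do rewrite mulr_sumr.
under [RHS]eq_bigr do rewrite mulr_sumr -sumrN.
rewrite !pair_big /= (reindex_inj (inv_inj (@swap_liftK k))) /=.
apply: eq_bigr => p _; have [e1 e2 e3] := lift_swap_lift p.
rewrite e1; under [X in F _ _ X]funext do rewrite e2.
rewrite !mulrA -!exprD -mulNr; congr (_ * _).
rewrite -signr_odd e3 -[in RHS]signr_odd.
by case: (odd _); rewrite ?expr0 ?expr1 ?opprK.
Qed.

End AltSum.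

(** * Smooth functions *)

Section Smooth.
Variables (R : realType) (V : normedModType R).

Notation smooth := (@smooth_on R V _ setT).

Section General.
Variable W : normedModType R.
Implicit Types f g : V -> W.

(** Smoothness is the largest class of differentiable functions that is stable
    under directional derivatives. *)
Lemma smooth_coind (P : (V -> W) -> Prop) f :
  (forall h x, P h -> differentiable h x) ->
  (forall h v, P h -> P ('D_v h)) -> P f -> smooth f.
Proof.
move=> Pdiff Pder Pf vs x _; apply: (Pdiff); move: x; elim: vs => //= v vs IH _.
by apply: Pder; apply: IH.
Qed.

Lemma smooth_diff f x : smooth f -> differentiable f x.
Proof. by move=> /(_ [::] x); apply. Qed.

Lemma smooth_derivable f x v : smooth f -> derivable f x v.
Proof. by move=> /smooth_diff sf; apply: diff_derivable. Qed.

Lemma smooth_cont f : smooth f -> continuous f.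
Proof. by move=> sf x; apply: differentiable_continuous; apply: smooth_diff. Qed.

Lemma smooth_derive f v : smooth f -> smooth ('D_v f).
Proof.
by move=> sf vs x _; have := sf (rcons vs v) x I; rewrite foldr_rcons.
Qed.

Lemma derive_lin (l : {linear V -> W}) c x v : continuous l ->
  'D_v (fun y => l y + c) x = l v.
Proof.
move=> lc; have dl : differentiable l x by apply: linear_differentiable.
have -> : (fun y => l y + c) = (l : V -> W) + cst c by [].
rewrite deriveD; [|exact: diff_derivable|exact: derivable_cst].
by rewrite derive_cst addr0 deriveE // diff_lin.
Qed.

Lemma smooth_affine (l : {linear V -> W}) c : continuous l ->
  smooth (fun y => l y + c).
Proof.
move=> lc; apply: (@smooth_coind (fun h => exists (l : {linear V -> W}) c,
    continuous l /\ h = (fun y => l y + c))) => [h x|h v|]; last by exists l, c.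
  move=> [l' [c' [lc' ->]]]; apply: (@differentiableD _ _ _ l' (cst c')).
    exact: linear_differentiable.
  exact: differentiable_cst.
move=> [l' [c' [lc' ->]]]; exists \0, (l' v); split; first exact: cst_continuous.
by apply/funext => y; rewrite derive_lin // add0r.
Qed.

Lemma smooth_cst c : smooth (cst c : V -> W).
Proof.
have := @smooth_affine \0 c (@cst_continuous _ _ _).
by congr (smooth _); apply/funext => y /=; rewrite add0r.
Qed.

Lemma deriveDr f x v w : smooth f -> 'D_(v + w) f x = 'D_v f x + 'D_w f x.
Proof. by move=> sf; rewrite !deriveE ?linearD //; exact: smooth_diff. Qed.

Lemma deriveZr f x (c : R) w : smooth f -> 'D_(c *: w) f x = c *: 'D_w f x.
Proof. by move=> sf; rewrite !deriveE ?linearZ //; exact: smooth_diff. Qed.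

End General.

(** The derivative of a product is a sum of products, so that coinduction has to
    be applied to a class which is stable under both operations. *)
Inductive smooth_alg : (V -> R^o) -> Prop :=
| SmoothBase f of smooth f : smooth_alg f
| SmoothAdd f g of smooth_alg f & smooth_alg g : smooth_alg (f + g)
| SmoothMul f g of smooth_alg f & smooth_alg g : smooth_alg (f * g : V -> R).

Lemma smooth_alg_diff f x : smooth_alg f -> differentiable f x.
Proof.
elim=> [g|g h _ dg _ dh|g h _ dg _ dh]; first exact: smooth_diff.
  exact: differentiableD.
exact: (@differentiableM R V g h x).
Qed.

Lemma smooth_algP f : smooth_alg f -> smooth f.
Proof.
apply: smooth_coind => [h x|h v]; first exact: smooth_alg_diff.
elim=> [g sg|g k ag sg ak sk|g k ag sg ak sk].
- by apply: SmoothBase; apply: smooth_derive.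
- have -> : 'D_v (g + k) = 'D_v g + 'D_v k.
    apply/funext => x; apply: deriveD; apply: diff_derivable;
    exact: smooth_alg_diff.
  exact: SmoothAdd.
- have -> : 'D_v (g * k : V -> R) = g * ('D_v k) + k * ('D_v g) :> (V -> R).
    apply/funext => x; apply: (@deriveM R V g k); apply: diff_derivable;
    exact: smooth_alg_diff.
  by apply: SmoothAdd; apply: SmoothMul.
Qed.

Lemma smoothD (f g : V -> R^o) : smooth f -> smooth g -> smooth (f + g).
Proof. by move=> sf sg; apply/smooth_algP/SmoothAdd; apply: SmoothBase. Qed.

Lemma smoothM (f g : V -> R^o) : smooth f -> smooth g ->
  smooth (fun y => f y * g y : R^o).
Proof. by move=> sf sg; apply/smooth_algP/SmoothMul; apply: SmoothBase. Qed.

Lemma smoothN (f : V -> R^o) : smooth f -> smooth (- f).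
Proof.
move=> sf; have := smoothM (smooth_cst (-1 : R^o)) sf.
by congr (smooth _); apply/funext => y; rewrite /= mulN1r.
Qed.

Lemma ReD (a b : R[i]) : complex.Re (a + b) = complex.Re a + complex.Re b.
Proof. by case: a b => [? ?] [? ?]. Qed.

Lemma ImD (a b : R[i]) : complex.Im (a + b) = complex.Im a + complex.Im b.
Proof. by case: a b => [? ?] [? ?]. Qed.

Lemma ReM (a b : R[i]) : complex.Re (a * b) =
  complex.Re a * complex.Re b - complex.Im a * complex.Im b.
Proof. by case: a b => [? ?] [? ?]. Qed.

Lemma ImM (a b : R[i]) : complex.Im (a * b) =
  complex.Re a * complex.Im b + complex.Im a * complex.Re b.
Proof. by case: a b => [? ?] [? ?]. Qed.

Definition csmooth (f : V -> R[i]) : Prop :=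
  smooth (fun y => complex.Re (f y) : R^o) /\
  smooth (fun y => complex.Im (f y) : R^o).

Lemma csmooth_cst (c : R[i]) : csmooth (fun=> c).
Proof. by split; apply: smooth_cst. Qed.

Lemma csmoothR (f : V -> R^o) : smooth f -> csmooth (fun y => (f y)%:C%C).
Proof. by move=> sf; split => //; apply: smooth_cst. Qed.

Lemma csmoothD f g : csmooth f -> csmooth g -> csmooth (fun y => f y + g y).
Proof.
move=> [f1 f2] [g1 g2]; split.
have := smoothD f1 g1; congr (smooth _); apply/funext => y /=.
  exact/esym/ReD.
have := smoothD f2 g2; congr (smooth _); apply/funext => y /=.
exact/esym/ImD.
Qed.

Lemma csmoothM f g : csmooth f -> csmooth g -> csmooth (fun y => f y * g y).
Proof.
move=> [f1 f2] [g1 g2]; split.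
  have := smoothD (smoothM f1 g1) (smoothN (smoothM f2 g2)).
  congr (smooth _); apply/funext => y /=.
  exact/esym/ReM.
have := smoothD (smoothM f1 g2) (smoothM f2 g1).
congr (smooth _); apply/funext => y /=.
exact/esym/ImM.
Qed.

Lemma csmoothZ (c : R[i]) f : csmooth f -> csmooth (fun y => c * f y).
Proof. by move=> sf; apply: csmoothM => //; apply: csmooth_cst. Qed.

Lemma csmooth_sum (I : Type) (r : seq I) (P : pred I) (F : I -> V -> R[i]) :
  (forall i, csmooth (F i)) -> csmooth (fun y => \sum_(i <- r | P i) F i y).
Proof.
move=> sF; elim: r => [|i r IH].
  have -> : (fun y => \sum_(i <- [::] | P i) F i y) = (fun=> 0).
    by apply/funext => y; rewrite big_nil.
  exact: csmooth_cst.
have -> : (fun y => \sum_(j <- i :: r | P j) F j y) =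
    (fun y => (if P i then F i y else 0) + \sum_(j <- r | P j) F j y).
  by apply/funext => y; rewrite big_cons; case: ifP => // _; rewrite add0r.
by apply: csmoothD => //; case: (P i) => //; apply: csmooth_cst.
Qed.

Lemma csmooth_cderive f v : csmooth f -> csmooth (cderive v f).
Proof. by move=> [f1 f2]; split; apply: smooth_derive. Qed.

Lemma cderive_cst (v : V) (c : R[i]) x : cderive v (fun=> c) x = 0.
Proof. by rewrite /cderive !derive_cst. Qed.

Lemma cderiveR v (f : V -> R^o) x : 
  cderive v (fun y => (f y)%:C%C) x = ('D_v f x)%:C%C.
Proof. by rewrite /cderive /= derive_cst. Qed.

Lemma cderiveD v f g x : csmooth f -> csmooth g ->
  cderive v (fun y => f y + g y) x = cderive v f x + cderive v g x.
Proof.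
move=> [f1 f2] [g1 g2]; rewrite /cderive.
have -> : (fun y => complex.Re (f y + g y) : R^o) =
    (fun y => complex.Re (f y) : R^o) + (fun y => complex.Re (g y) : R^o).
  by apply/funext => y; rewrite ReD.
have -> : (fun y => complex.Im (f y + g y) : R^o) =
    (fun y => complex.Im (f y) : R^o) + (fun y => complex.Im (g y) : R^o).
  by apply/funext => y; rewrite ImD.
by rewrite !deriveD //; apply: smooth_derivable.
Qed.

Lemma derive_mul (f g : V -> R^o) v x : smooth f -> smooth g ->
  'D_v (fun y => f y * g y : R^o) x = 'D_v f x * g x + f x * 'D_v g x.
Proof.
move=> /(@smooth_derivable R^o _ x v) df /(@smooth_derivable R^o _ x v) dg.
apply: (etrans (@deriveM R V f g x v df dg)).
by rewrite addrC; congr (_ + _); exact: mulrC.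
Qed.

Lemma derive_add (f g : V -> R^o) v x : smooth f -> smooth g ->
  'D_v (fun y => f y + g y : R^o) x = 'D_v f x + 'D_v g x.
Proof.
move=> /(@smooth_derivable R^o _ x v) df /(@smooth_derivable R^o _ x v) dg.
exact: (@deriveD R V R^o f g x v df dg).
Qed.

Lemma derive_sub (f g : V -> R^o) v x : smooth f -> smooth g ->
  'D_v (fun y => f y - g y : R^o) x = 'D_v f x - 'D_v g x.
Proof.
move=> /(@smooth_derivable R^o _ x v) df /(@smooth_derivable R^o _ x v) dg.
exact: (@deriveB R V R^o f g x v df dg).
Qed.

Lemma cderiveM v f g x : csmooth f -> csmooth g ->
  cderive v (fun y => f y * g y) x = cderive v f x * g x + f x * cderive v g x.
Proof.
move=> [f1 f2] [g1 g2]; rewrite /cderive.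
under [X in 'D_v X x]eq_fun do rewrite ReM.
under [X in Complex _ ('D_v X x)]eq_fun do rewrite ImM.
rewrite derive_sub ?derive_add ?derive_mul //; do ?exact: smoothM.
apply/eqP; rewrite eq_complex ReD ImD !ReM !ImM /=.
by apply/andP; split; apply/eqP; ring.
Qed.

Lemma cderiveZ v (c : R[i]) f x : csmooth f ->
  cderive v (fun y => c * f y) x = c * cderive v f x.
Proof.
by move=> sf; rewrite cderiveM ?cderive_cst ?mul0r ?add0r //; apply: csmooth_cst.
Qed.

Lemma cderive_sum (I : Type) (r : seq I) (P : pred I) v (F : I -> V -> R[i]) x :
  (forall i, csmooth (F i)) ->
  cderive v (fun y => \sum_(i <- r | P i) F i y) x =
  \sum_(i <- r | P i) cderive v (F i) x.
Proof.
move=> sF; elim: r => [|i r IH].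
  have -> : (fun y => \sum_(i <- [::] | P i) F i y) = (fun=> 0).
    by apply/funext => y; rewrite big_nil.
  by rewrite big_nil cderive_cst.
have -> : (fun y => \sum_(j <- i :: r | P j) F j y) =
    (fun y => (if P i then F i y else 0) + \sum_(j <- r | P j) F j y).
  by apply/funext => y; rewrite big_cons; case: ifP => // _; rewrite add0r.
rewrite big_cons cderiveD; [|by case: (P i) => //; apply: csmooth_cst|].
  by rewrite IH; case: ifP => // _; rewrite cderive_cst add0r.
exact: csmooth_sum.
Qed.

Lemma cderiveDr f x v w : csmooth f ->
  cderive (v + w) f x = cderive v f x + cderive w f x.
Proof. by move=> [f1 f2]; rewrite /cderive !deriveDr. Qed.

Lemma cderiveZr f x (c : R) w : csmooth f ->
  cderive (c *: w) f x = c%:C%C * cderive w f x.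
Proof.
move=> [f1 f2]; rewrite /cderive !deriveZr //.
by apply/eqP; rewrite eq_complex /= !mul0r subr0 addr0 !eqxx.
Qed.

End Smooth.

(** * Bidegrees *)

Section Projection.
Variables (R : realType) (V : Type) (A : V -> V).
Local Notation C := R[i].

Definition insert k (i : 'I_k.+1) (a : V) (v : 'I_k -> V) : 'I_k.+1 -> V :=
  fun j => if unlift i j is Some j' then v j' else a.

Lemma insert_id k (i : 'I_k.+1) a v : insert i a v i = a.
Proof. by rewrite /insert unlift_none. Qed.

Lemma insert_lift k (i : 'I_k.+1) a v j : insert i a v (lift i j) = v j.
Proof. by rewrite /insert liftK. Qed.

Definition set_insert k (i : 'I_k.+1) (b : bool) (S : {set 'I_k}) : {set 'I_k.+1} :=
  finset (fun j => if unlift i j is Some j' then j' \in S else b).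

Lemma in_set_insert k (i : 'I_k.+1) b S : (i \in set_insert i b S) = b.
Proof. by rewrite inE unlift_none. Qed.

Lemma in_set_insert_lift k (i : 'I_k.+1) b S j :
  (lift i j \in set_insert i b S) = (j \in S).
Proof. by rewrite inE liftK. Qed.

Lemma big_set_insert (T : Type) (idx : T) (op : Monoid.com_law idx) k
    (i : 'I_k.+1) b S (F : 'I_k.+1 -> T) :
  \big[op/idx]_(j in set_insert i b S) F j =
  op (if b then F i else idx) (\big[op/idx]_(j in S) F (lift i j)).
Proof.
rewrite big_mkcond (bigD1_ord i) //= in_set_insert; congr (op _ _).
by rewrite [RHS]big_mkcond; apply: eq_bigr => j _; rewrite in_set_insert_lift.
Qed.

Lemma card_set_insert k (i : 'I_k.+1) b S : #|set_insert i b S| = (b + #|S|)%N.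
Proof. by rewrite -!sum1_card big_set_insert; case: b. Qed.

Lemma sum_set_insert (T : nmodType) k (i : 'I_k.+1) (P : pred {set 'I_k.+1}) F :
  \sum_(S : {set 'I_k.+1} | P S) F S =
  \sum_(b : bool) \sum_(S : {set 'I_k} | P (set_insert i b S)) F (set_insert i b S) :> T.
Proof.
rewrite pair_big_dep /=.
rewrite (reindex (fun p : bool * {set 'I_k} => set_insert i p.1 p.2)) //=.
exists (fun S : {set 'I_k.+1} => (i \in S, finset (fun j : 'I_k => lift i j \in S))) => [[b S] _ | S _] /=.
  rewrite in_set_insert; congr (_, _); apply/setP => j.
  by rewrite inE in_set_insert_lift.
apply/setP => j; case: (unliftP i j) => [j'|] ->; last by rewrite in_set_insert.
by rewrite in_set_insert_lift inE.
Qed.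

(** The value at [v] of the component of type [(p, k - p)] of [f] with respect
    to the complex structure [A]; [bidegree J p w x] is this for [A = J x]. *)
Definition type_part (p k : nat) (f : ('I_k -> V) -> C) (v : 'I_k -> V) : C :=
  (2 ^ k)%:R^-1 * \sum_(S : {set 'I_k} | #|S| == p) \sum_(T : {set 'I_k})
    (\prod_(j in T) (if j \in S then - 'i%C else 'i%C)) *
    f (fun j => if j \in T then A (v j) else v j).

Definition conj_sign (b : bool) : C := if b then - 'i%C else 'i%C.

Lemma conj_sign_sqr b : conj_sign b * conj_sign b = -1.
Proof. by case: b; rewrite /conj_sign /= ?mulNr ?mulrN ?opprK -expr2 sqr_i. Qed.

Lemma conj_signK b : conj_sign b * conj_sign (~~ b) = 1.
Proof. by case: b; rewrite /conj_sign /= ?mulNr ?mulrN -expr2 sqr_i opprK. Qed.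

Lemma type_part_ext p k f g v : (forall u, f u = g u) ->
  @type_part p k f v = type_part p g v.
Proof. by move=> fg; have -> : f = g by apply/funext. Qed.

Lemma type_partZ p k (c : C) f v :
  @type_part p k (fun u => c * f u) v = c * type_part p f v.
Proof.
rewrite /type_part mulrCA; congr (_ * _).
rewrite mulr_sumr; apply: eq_bigr => S _; rewrite mulr_sumr.
by apply: eq_bigr => T _; rewrite mulrCA.
Qed.

Lemma type_partD p k f g v :
  @type_part p k (fun u => f u + g u) v = type_part p f v + type_part p g v.
Proof.
rewrite /type_part -mulrDr -big_split /=; congr (_ * _).
apply: eq_bigr => S _; rewrite -big_split /=.
by apply: eq_bigr => T _; rewrite mulrDr.
Qed.

Lemma type_part0 p k v : @type_part p k (fun=> 0) v = 0.
Proof.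
rewrite -[RHS](mul0r (@type_part p k (fun=> 0) v)) -type_partZ.
by apply: type_part_ext => u; rewrite mul0r.
Qed.

Lemma type_part_sum p k (I : Type) (r : seq I) F v :
  @type_part p k (fun u => \sum_(i <- r) F i u) v =
  \sum_(i <- r) type_part p (F i) v.
Proof.
elim: r => [|i r IH].
  rewrite big_nil -[RHS](type_part0 p v).
  by apply: type_part_ext => u; rewrite big_nil.
rewrite big_cons -IH -type_partD.
by apply: type_part_ext => u; rewrite big_cons.
Qed.

Lemma type_part_nil p (f : ('I_0 -> V) -> C) v :
  type_part p f v = if p == 0%N then f v else 0.
Proof.
rewrite /type_part expn0 invr1 mul1r.
have e0 (S : {set 'I_0}) : S = finset.set0.
  by apply/setP => -[].
case: eqP => [->|p0]; last first.
  by rewrite big1 // => S /eqP; rewrite (e0 S) cards0 => p0'; case: p0.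
have all0 (F : {set 'I_0} -> C) : \sum_(S : {set 'I_0}) F S = F finset.set0.
  rewrite (bigD1 finset.set0) //= big1 ?addr0 // => S.
  by rewrite (e0 S) eqxx.
rewrite (eq_bigl xpredT); last by move=> S; rewrite (e0 S) cards0.
rewrite !all0 big_set0 mul1r; congr (f _); by apply/funext => -[].
Qed.

(** The projection onto a type is a product over the arguments: the argument [i] is
    projected onto its complex linear part, which uses up one unit of [p], or onto
    its antilinear part. *)
Lemma type_part_lift (p k : nat) (i : 'I_k.+1) (f : ('I_k.+1 -> V) -> C) v :
  type_part p f v = 2^-1 * \sum_(b : bool | (b <= p)%N)
    type_part (p - b)%N (fun u => f (insert i (v i) u) +
                        conj_sign b * f (insert i (A (v i)) u))
      (fun j => v (lift i j)).
Proof.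
rewrite /type_part -mulr_sumr mulrA -invfM -natrM -expnS; congr (_ * _).
rewrite (sum_set_insert i) [RHS]big_mkcond /=; apply: eq_bigr => b _.
case: ifPn => [bp|bp]; last first.
  rewrite big1 // => S; rewrite card_set_insert => /eqP e.
  by move: bp; rewrite -e leq_addr.
apply: eq_big => [S|S _].
  by rewrite card_set_insert -[RHS](eqn_add2l b) subnKC.
have ins T c : (fun j => if j \in set_insert i c T then A (v j) else v j) =
    insert i (if c then A (v i) else v i)
      (fun j => if j \in T then A (v (lift i j)) else v (lift i j)).
  apply/funext => j; case: (unliftP i j) => [j'|] ->.
    by rewrite in_set_insert_lift insert_lift.
  by rewrite in_set_insert insert_id.
rewrite (sum_set_insert i xpredT) big_bool /= addrC -big_split /=.
apply: eq_bigr => T _; rewrite !ins !big_set_insert /= in_set_insert mul1r.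
rewrite mulrDr; congr (_ * _ + _).
  by apply: eq_bigr => j _; rewrite in_set_insert_lift.
rewrite [RHS]mulrCA mulrA; congr (_ * _ * _).
by apply: eq_bigr => j _; rewrite in_set_insert_lift.
Qed.

(** Wedging with a one-form of type (1,0) or (0,1) shifts the type, because the
    other projection of the argument fed to [e] kills it. *)
Lemma type_part_alt_sum (p k : nat) (e : V -> C) (u : ('I_k -> V) -> C) (b : bool) v :
  (forall h, e (A h) = conj_sign (~~ b) * e h) ->
  type_part p (alt_sum (fun h w => e h * u w)) v =
  if (b <= p)%N then alt_sum (fun h w => e h * type_part (p - b)%N u w) v else 0.
Proof.
move=> eA; rewrite [LHS]type_part_sum.
have step (i : 'I_k.+1) : type_part p (fun w : 'I_k.+1 -> V =>
      (-1) ^+ i * (e (w i) * u (fun j => w (lift i j)))) v =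
    if (b <= p)%N then (-1) ^+ i *
      (e (v i) * type_part (p - b)%N u (fun j => v (lift i j))) else 0.
  rewrite type_partZ (type_part_lift _ i).
  have inner (c : bool) : type_part (p - c)%N (fun w : 'I_k -> V =>
        e (insert i (v i) w i) * u (fun j => insert i (v i) w (lift i j)) +
        conj_sign c * (e (insert i (A (v i)) w i) *
          u (fun j => insert i (A (v i)) w (lift i j)))) (fun j => v (lift i j)) =
      (1 + conj_sign c * conj_sign (~~ b)) *
      (e (v i) * type_part (p - c)%N u (fun j => v (lift i j))).
    rewrite mulrA -type_partZ; apply: type_part_ext => w.
    rewrite !insert_id eA.
    have E a : (fun j => insert i a w (lift i j)) = w.
      by apply/funext => j; rewrite insert_lift.
    by rewrite !E; ring.
  rewrite (eq_bigr _ (fun c _ => inner c)) big_mkcond big_bool /=.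
  have -> : (if (b <= p)%N then (-1) ^+ i *
      (e (v i) * type_part (p - b)%N u (fun j => v (lift i j))) else 0) =
      (-1) ^+ i * (2^-1 * (if (b <= p)%N then
      2 * (e (v i) * type_part (p - b)%N u (fun j => v (lift i j))) else 0)).
    case: ifP => _; last by rewrite !mulr0.
    by rewrite [2^-1 * _]mulrA mulVf ?mul1r // pnatr_eq0.
  congr (_ * (_ * _)); case: b eA inner => eA inner /=.
    by rewrite (conj_signK true) (conj_sign_sqr false) subrr mul0r addr0.
  by rewrite (conj_signK false) (conj_sign_sqr true) subrr mul0r if_same add0r.
case: ifPn => [bp|/negbTE bp].
  by apply: eq_bigr => i _; rewrite step bp.
by rewrite big1 // => i _; rewrite step bp.
Qed.

End Projection.

Section ProjectionLinear.
Variables (R : realType) (V : zmodType) (A : V -> V).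
Local Notation C := R[i].
Hypothesis AA : forall a, A (A a) = - a.

(** The bivector [a /\ A a] is of type (1,1), so that a pair of arguments [a, A a]
    uses up exactly one unit of [p] and is otherwise left alone. *)
Lemma type_part_pair (p k : nat) (f : ('I_k.+2 -> V) -> C) (v : 'I_k.+2 -> V) :
  (forall a b u, f (insert ord0 b (insert ord0 a u)) =
                 - f (insert ord0 a (insert ord0 b u))) ->
  (forall a b u, f (insert ord0 a (insert ord0 (- b) u)) =
                 - f (insert ord0 a (insert ord0 b u))) ->
  v (lift ord0 ord0) = A (v ord0) ->
  type_part A p f v = if (0 < p)%N then type_part A p.-1
    (fun u => f (insert ord0 (v ord0) (insert ord0 (A (v ord0)) u)))
    (fun j => v (lift ord0 (lift ord0 j))) else 0.
Proof.
move=> fC fN ev.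
pose a := v ord0.
have f0 b u : f (insert ord0 b (insert ord0 b u)) = 0.
  have /eqP := fC b b u; rewrite -subr_eq0 opprK -mulr2n.
  by rewrite mulrn_eq0 /= => /eqP.
have inner (q : nat) b c : type_part A q (fun u =>
    f (insert ord0 a (insert ord0 (A a) u)) +
    conj_sign R b * f (insert ord0 (A a) (insert ord0 (A a) u)) +
    conj_sign R c * (f (insert ord0 a (insert ord0 (A (A a)) u)) +
    conj_sign R b * f (insert ord0 (A a) (insert ord0 (A (A a)) u))))
    (fun j => v (lift ord0 (lift ord0 j))) =
  (1 + conj_sign R b * conj_sign R c) * type_part A q
    (fun u => f (insert ord0 a (insert ord0 (A a) u)))
    (fun j => v (lift ord0 (lift ord0 j))).
  rewrite -type_partZ; apply: type_part_ext => u.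
  by rewrite AA !fN !f0 (fC a (A a)); ring.
have step (q : nat) b : type_part A q (fun u => f (insert ord0 (v ord0) u) +
    conj_sign R b * f (insert ord0 (A (v ord0)) u)) (fun j => v (lift ord0 j)) =
  2^-1 * \sum_(c : bool | (c <= q)%N) (1 + conj_sign R b * conj_sign R c) *
    type_part A (q - c)%N (fun u => f (insert ord0 a (insert ord0 (A a) u)))
    (fun j => v (lift ord0 (lift ord0 j))).
  rewrite (type_part_lift _ _ ord0); congr (_ * _); apply: eq_bigr => c _.
  by rewrite -inner ev.
rewrite (type_part_lift _ _ ord0) (eq_bigr _ (fun b _ => step _ b)).
rewrite big_mkcond big_bool /= !(big_mkcond (fun b : bool => (b <= _)%N)) !big_bool /=.
rewrite (conj_signK R true) (conj_signK R false) (conj_sign_sqr R true) (conj_sign_sqr R false) !subrr !mul0r !if_same addr0 add0r.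
rewrite !subn0; case: p => [|p] /=; first by rewrite !mulr0 addr0 mulr0.
rewrite !subSS !subn0; set t := type_part _ _ _ _.
have two : (2 : C) != 0 by rewrite pnatr_eq0.
by field.
Qed.

Lemma type_part_invariant2 (p : nat) (h : V -> V -> C) (v : 'I_2 -> V) :
  (forall a b, h (A a) (A b) = h a b) ->
  (forall a b, h a (- b) = - h a b) ->
  type_part A p (fun u => h (u ord0) (u ord_max)) v =
  if p == 1%N then h (v ord0) (v ord_max) else 0.
Proof.
move=> hA hN; pose a := v ord0; pose d := v ord_max.
have hAa x y : h (A x) y = - h x (A y) by rewrite -(hA x) AA hN opprK.
have mx : ord_max = lift ord0 ord0 :> 'I_2 by apply: ord_inj.
have step (q : nat) b : type_part A q (fun u : 'I_1 -> V =>
    h (insert ord0 (v ord0) u ord0) (insert ord0 (v ord0) u ord_max) +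
    conj_sign R b * h (insert ord0 (A (v ord0)) u ord0)
                      (insert ord0 (A (v ord0)) u ord_max))
    (fun j => v (lift ord0 j)) =
  2^-1 * \sum_(c : bool | (c <= q)%N) if (q - c)%N == 0%N then
    (1 + conj_sign R b * conj_sign R c) * h a d +
    (conj_sign R c - conj_sign R b) * h a (A d) else 0.
  rewrite (type_part_lift _ _ ord0); congr (_ * _); apply: eq_bigr => c _.
  rewrite type_part_nil mx !insert_id !insert_lift !insert_id -mx.
  case: ifP => // _; rewrite -/a -/d !hA !hAa; ring.
rewrite (type_part_lift _ _ ord0) (eq_bigr _ (fun b _ => step _ b)).
rewrite big_mkcond big_bool /= !(big_mkcond (fun b : bool => (b <= _)%N)) !big_bool /=.
rewrite (conj_signK R true) (conj_signK R false) (conj_sign_sqr R true) (conj_sign_sqr R false) !subrr !mul0r !addr0 !subn0.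
have two : (2 : C) != 0 by rewrite pnatr_eq0.
case: p => [|[|[|p]]] /=; rewrite ?(mulr0, addr0) //.
by rewrite /conj_sign -/a -/d; field.
Qed.

End ProjectionLinear.

(** * Exterior algebra *)

Section Wedge.
Variables (R : realType) (V : normedModType R).
Local Notation C := R[i].
Implicit Types (e : V -> V -> C).

Definition alt_form k (w : dform V k) : Prop := forall x, alternates (w x).

Lemma bidegreeE J p k (w : dform V k) x v :
  bidegree J p w x v = type_part (J x) p (w x) v.
Proof. by []. Qed.

Definition ext1 e k (u : dform V k) : dform V k.+1 := fun x v =>
  alt_sum (fun h z => e x h * u x z) v.

Definition unit_form : dform V 0 := fun _ _ => 1.

Lemma unit_form_alt : alt_form unit_form.
Proof.
move=> x v s; rewrite /unit_form mulr1.
have -> : s = 1%g by apply/permP => -[].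
by rewrite odd_perm1.
Qed.

Lemma ext1C e f k (u : dform V k) :
  ext1 e (ext1 f u) = fun x v => - ext1 f (ext1 e u) x v.
Proof.
have E g g' (w : dform V k) x v : ext1 g (ext1 g' w) x v =
    alt_sum (fun h => alt_sum (fun h' z => g x h * (g' x h' * w x z))) v.
  apply: eq_bigr => i _; congr (_ * _); rewrite mulr_sumr.
  by apply: eq_bigr => j _; rewrite !mulrA (mulrC (g x (v i))).
apply/funext => x; apply/funext => v; rewrite !E alt_sum_swap; congr (- _).
by apply: eq_bigr => i _; congr (_ * _); apply: eq_bigr => j _; congr (_ * _); exact: mulrCA.
Qed.

Lemma ext1_id e k (u : dform V k) : ext1 e (ext1 e u) = fun _ _ => 0.
Proof.
apply/funext => x; apply/funext => v; apply/eqP.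
have /eqP : ext1 e (ext1 e u) x v = - ext1 e (ext1 e u) x v by rewrite {1}ext1C.
by rewrite -addr_eq0 -mulr2n mulrn_eq0.
Qed.

Lemma ext1D e k (u w : dform V k) :
  ext1 e (fun x v => u x v + w x v) = fun x v => ext1 e u x v + ext1 e w x v.
Proof.
apply/funext => x; apply/funext => v; rewrite -big_split /=.
by apply: eq_bigr => i _; rewrite -mulrDr -mulrDr.
Qed.

Lemma ext1Z e k (c : C) (u : dform V k) :
  ext1 e (fun x v => c * u x v) = fun x v => c * ext1 e u x v.
Proof.
apply/funext => x; apply/funext => v; rewrite mulr_sumr.
by apply: eq_bigr => i _; rewrite (mulrCA _ c) (mulrCA _ c).
Qed.

Lemma ext1Dl e f k (u : dform V k) :
  ext1 (fun x h => e x h + f x h) u = fun x v => ext1 e u x v + ext1 f u x v.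
Proof.
apply/funext => x; apply/funext => v; rewrite -big_split /=.
by apply: eq_bigr => i _; rewrite -mulrDr -mulrDl.
Qed.

Lemma ext1Zl e k (c : C) (u : dform V k) :
  ext1 (fun x h => c * e x h) u = fun x v => c * ext1 e u x v.
Proof.
apply/funext => x; apply/funext => v; rewrite mulr_sumr.
by apply: eq_bigr => i _; rewrite -mulrA (mulrCA _ c).
Qed.

(** [(e /\ u) /\ w = e /\ (u /\ w)]: the permutations in the left-hand side are
    sorted by the slot [i] of [u] in which [e] is evaluated and by its image, and
    the [k.+1] slots contribute equally. *)
Lemma wedge_ext1 e k l (u : dform V k) (w : dform V l) :
  wedge (ext1 e u) w = ext1 e (wedge u w) :> dform V (k + l).+1.
Proof.
apply/funext => x; apply/funext => v; rewrite /wedge.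
have kl0 : ((k`! * l`!)%:R : C) != 0 by rewrite pnatr_eq0 -lt0n muln_gt0 !fact_gt0.
have k0 : (k.+1%:R : C) != 0 by rewrite pnatr_eq0.
rewrite factS -mulnA natrM invfM -mulrA.
apply: (canLR (mulKf k0)).
under [in LHS]eq_bigr => s _ do rewrite /ext1 /alt_sum mulr_sumr mulr_suml.
rewrite exchange_big /= mulr_sumr mulr_natl -[in RHS](card_ord k.+1) -sumr_const.
apply: eq_bigr => i _; rewrite (big_lift_perm (lshift l i : 'I_(k + l).+1)).
rewrite mulr_sumr; apply: eq_bigr => j _.
rewrite [X in _ = _ * X]mulrCA [RHS]mulrCA; congr (_ * _).
rewrite mulrA mulr_sumr; apply: eq_bigr => t _.
rewrite lift_perm_id sign_lift_perm.
have -> : (fun i0 : 'I_k => v (lift_perm (lshift l i : 'I_(k + l).+1) j t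
      (lshift l (lift i i0)))) = (fun i0 => v (lift j (t (lshift l i0)))).
  apply/funext => i0; rewrite -(lift_perm_lift (lshift l i : 'I_(k + l).+1)).
  by congr (v (lift_perm _ _ _ _)); apply: ord_inj.
have -> : (fun i0 : 'I_l => v (lift_perm (lshift l i : 'I_(k + l).+1) j t
      (rshift k.+1 i0))) = (fun i0 => v (lift j (t (rshift k i0)))).
  apply/funext => i0; rewrite -(lift_perm_lift (lshift l i : 'I_(k + l).+1)).
  congr (v (lift_perm _ _ _ _)); apply: ord_inj.
  by rewrite /= /bump; case: leqP => //; move: (ltn_ord i); lia.
rewrite [(-1) ^+ (lshift l i : 'I_(k + l).+1)]/=.
have s1 : (-1) ^+ i * (-1) ^+ i = 1 :> C by rewrite -expr2 sqrr_sign.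
move: s1; set s := (-1) ^+ i; set s' := (-1) ^+ j; set st := (-1) ^+ t.
set E := e x _; set U := u x _; set W := w x _ => s1.
by transitivity (s * s * (s' * st * E * U * W)); [ring|rewrite s1; ring].
Qed.

Lemma wedge_unit_form l (w : dform V l) : alt_form w -> wedge unit_form w = w.
Proof.
move=> aw; apply/funext => x; apply/funext => v; rewrite /wedge fact0 mul1n.
have l0 : (l`!%:R : C) != 0 by rewrite pnatr_eq0 -lt0n fact_gt0.
apply: (canLR (mulKf l0)); rewrite mulr_natl -[in RHS](card_Sn l) -sumr_const.
apply: eq_bigr => s _; rewrite mulr1.
have -> : (fun i => v (s (rshift 0 i))) = (fun i => v (s i)).
  by apply/funext => i; congr (v (s _)); apply: ord_inj.
by rewrite (aw x v s) mulrA -expr2 sqrr_sign mul1r.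
Qed.

Lemma wedgeDl k l (u u' : dform V k) (w : dform V l) :
  wedge (fun x v => u x v + u' x v) w = fun x v => wedge u w x v + wedge u' w x v.
Proof.
apply/funext => x; apply/funext => v; rewrite /wedge -mulrDr -big_split /=.
by congr (_ * _); apply: eq_bigr => s _; rewrite mulrDr mulrDl.
Qed.

Lemma wedgeZl k l c (u : dform V k) (w : dform V l) :
  wedge (fun x v => c * u x v) w = fun x v => c * wedge u w x v.
Proof.
apply/funext => x; apply/funext => v; rewrite /wedge mulrCA; congr (_ * _).
rewrite mulr_sumr.
by apply: eq_bigr => s _; rewrite [RHS]mulrA [in RHS]mulrCA.
Qed.

(** The slots of [u] contribute equally, so that only the two slots of the two-form
    have to be summed over; this is what makes the powers of [Omega] computable. *)
Lemma wedge2E k (w : dform V 2) (u : dform V k) (h : V -> V -> V -> C) x v :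
  alt_form u -> (forall x z, w x z = h x (z ord0) (z ord_max)) ->
  wedge w u x v =
  2^-1 * alt_sum (fun a => alt_sum (fun b z => h x a b * u x z)) v.
Proof.
move=> au wh; rewrite /wedge natrM invfM -mulrA; congr (_ * _).
have k0 : (k`!%:R : C) != 0 by rewrite pnatr_eq0 -lt0n fact_gt0.
apply: (canLR (mulKf k0)).
rewrite (@big_lift_perm _ k.+1 ord0) mulr_sumr; apply: eq_bigr => i _.
rewrite (@big_lift_perm _ k ord0) mulrCA [in RHS]mulr_sumr mulr_sumr.
apply: eq_bigr => j _.
rewrite mulr_natl -[in RHS](card_Sn k) -mulrnAr -mulrnAr -sumr_const !mulr_sumr.
apply: eq_bigr => t _; rewrite !sign_lift_perm wh.
have e0 : lshift k (ord0 : 'I_2) = ord0 by apply: ord_inj.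
have e1 : lshift k (ord_max : 'I_2) = lift ord0 ord0 by apply: ord_inj.
rewrite e0 e1 lift_perm_id lift_perm_lift lift_perm_id.
have -> : (fun i0 : 'I_k => v (lift_perm ord0 i (lift_perm ord0 j t) (rshift 2 i0))) =
    (fun i0 => v (lift i (lift j (t i0)))).
  apply/funext => i0; rewrite -2!(lift_perm_lift ord0).
  by congr (v (lift_perm _ _ _ _)); apply: ord_inj.
rewrite (au x (fun i0 => v (lift i (lift j i0))) t).
have s1 : (-1) ^+ t * (-1) ^+ t = 1 :> C by rewrite -expr2 sqrr_sign.
rewrite expr0; move: s1; set s := (-1) ^+ t; set s' := (-1) ^+ j; set st := (-1) ^+ i.
set E := h x _ _; set U := u x _ => s1.
by transitivity (s * s * (s' * st * E * U)); [ring|rewrite s1; ring].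
Qed.

Lemma wedge_alt k l (u : dform V k) (w : dform V l) : alt_form (wedge u w).
Proof.
move=> x v t; rewrite /wedge [RHS]mulrCA; congr (_ * _).
rewrite mulr_sumr [RHS](reindex_inj (mulIg t)) /=; apply: eq_bigr => s _.
have pE (f : 'I_k -> 'I_(k + l)) :
    (fun i => v (t (s (f i)))) = (fun i => v ((s * t)%g (f i))).
  by apply/funext => i; rewrite permM.
have pE' (f : 'I_l -> 'I_(k + l)) :
    (fun i => v (t (s (f i)))) = (fun i => v ((s * t)%g (f i))).
  by apply/funext => i; rewrite permM.
rewrite pE pE' odd_permM signr_addb.
have s1 : (-1) ^+ t * (-1) ^+ t = 1 :> C by rewrite -expr2 sqrr_sign.
move: s1; set a := (-1) ^+ t; set b := (-1) ^+ s; set f := u x _; set g := w x _ => s1.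
by transitivity (a * a * (b * f * g)); [rewrite s1 mul1r|ring].
Qed.

Lemma form_exp_alt (w : dform V 2) k : alt_form (form_exp w k).
Proof. by case: k => [|k]; [exact: unit_form_alt|exact: (@wedge_alt 2 k.*2 w (form_exp w k))]. Qed.

End Wedge.

(** * The exterior derivative and the Dolbeault operators *)

Section Calculus.
Variables (R : realType) (V : normedModType R).
Local Notation C := R[i].
Implicit Types (e : V -> V -> C) (J : V -> V -> V).

Definition smooth_form k (w : dform V k) : Prop :=
  forall v, csmooth (fun y => w y v).

Lemma smooth_form_ext_d k (w : dform V k) :
  smooth_form w -> smooth_form (ext_d w).
Proof.
move=> sw v; apply: csmooth_sum => i; apply: csmoothZ.
exact: csmooth_cderive (sw _).
Qed.

Lemma smooth_form_ext1 e k (u : dform V k) :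
  (forall h, csmooth (e^~ h)) -> smooth_form u -> smooth_form (ext1 e u).
Proof.
move=> se su v; apply: csmooth_sum => i; apply: csmoothZ.
by apply: csmoothM; [exact: se|exact: su].
Qed.

Lemma smooth_form_wedge k l (u : dform V k) (w : dform V l) :
  smooth_form u -> smooth_form w -> smooth_form (wedge u w).
Proof.
move=> su sw v; apply: csmoothZ; apply: csmooth_sum => s.
by apply: csmoothM; [apply: csmoothZ; exact: su|exact: sw].
Qed.

Lemma smooth_unit_form : smooth_form (@unit_form R V).
Proof. by move=> v; apply: csmooth_cst. Qed.

Lemma smooth_form_exp (w : dform V 2) k : smooth_form w -> smooth_form (form_exp w k).
Proof.
move=> sw; elim: k => [|k IH]; first exact: smooth_unit_form.
exact: (@smooth_form_wedge 2 k.*2 w (form_exp w k)).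
Qed.

Lemma ext_d_alt k (w : dform V k) : smooth_form w -> alt_form w ->
  alt_form (ext_d w).
Proof.
move=> sw aw x; apply: (@alt_sum_alternating V C k (fun h z => cderive h (w^~ z) x)) => h v s.
rewrite -(@cderiveZ R V h ((-1) ^+ s) (w^~ v) x (sw v)).
by congr (cderive _ _ _); apply/funext => y; exact: aw.
Qed.

(** The Leibniz rule, in which the first summand is [de /\ u]. *)
Lemma ext_d_ext1 e k (u : dform V k) x v :
  (forall h, csmooth (e^~ h)) -> smooth_form u ->
  ext_d (ext1 e u) x v =
  alt_sum (fun a => alt_sum (fun b z => cderive a (e^~ b) x * u x z)) v
  - ext1 e (ext_d u) x v.
Proof.
move=> se su.
have step a z : cderive a (fun y => ext1 e u y z) x =
    alt_sum (fun b z => cderive a (e^~ b) x * u x z) z +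
    alt_sum (fun b z => e x b * cderive a (u^~ z) x) z.
  rewrite cderive_sum => [|i]; last by apply: csmoothZ; apply: csmoothM.
  rewrite -big_split /=; apply: eq_bigr => i _.
  rewrite cderiveZ; last exact: csmoothM.
  by rewrite cderiveM // mulrDr.
transitivity (alt_sum (fun a => alt_sum (fun b z => cderive a (e^~ b) x * u x z)) v
   + alt_sum (fun a => alt_sum (fun b z => e x b * cderive a (u^~ z) x)) v).
  by rewrite -big_split /=; apply: eq_bigr => i _; rewrite -mulrDr step.
congr (_ + _); rewrite alt_sum_swap; congr (- _).
apply: eq_bigr => i _; congr (_ * _); rewrite mulr_sumr.
by apply: eq_bigr => j _; rewrite mulrCA.
Qed.

Lemma ext_dD k (u w : dform V k) : smooth_form u -> smooth_form w ->
  ext_d (fun x v => u x v + w x v) = fun x v => ext_d u x v + ext_d w x v.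
Proof.
move=> su sw; apply/funext => x; apply/funext => v; rewrite -big_split /=.
by apply: eq_bigr => i _; rewrite cderiveD // mulrDr.
Qed.

Lemma ext_dZ k (c : C) (u : dform V k) : smooth_form u ->
  ext_d (fun x v => c * u x v) = fun x v => c * ext_d u x v.
Proof.
move=> su; apply/funext => x; apply/funext => v; rewrite mulr_sumr.
by apply: eq_bigr => i _; rewrite cderiveZ // mulrCA.
Qed.

Lemma ext_d0 k : ext_d (fun _ _ => 0 : C) = (fun _ _ => 0) :> dform V k.+1.
Proof.
apply/funext => x; apply/funext => v.
by rewrite /ext_d big1 // => i _; rewrite cderive_cst mulr0.
Qed.

Lemma bidegree0 J p k : bidegree J p (fun _ _ => 0) = (fun _ _ => 0) :> dform V k.
Proof. by apply/funext => x; apply/funext => v; exact: type_part0. Qed.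

Definition has_type J (p k : nat) (u : dform V k) : Prop := forall q,
  bidegree J q u = if q == p then u else (fun _ _ => 0).

Lemma has_type_one J : has_type J 0 (@unit_form R V).
Proof.
move=> q; apply/funext => x; apply/funext => v.
by rewrite bidegreeE type_part_nil; case: eqP.
Qed.

Lemma has_type_ext1 J (b : bool) e p k (u : dform V k) :
  (forall x h, e x (J x h) = conj_sign R (~~ b) * e x h) -> has_type J p u ->
  has_type J (b + p)%N (ext1 e u).
Proof.
move=> eJ pu q; apply/funext => x; apply/funext => v.
rewrite bidegreeE (type_part_alt_sum _ _ _ (eJ x)).
have E : type_part (J x) (q - b)%N (u x) =
    if (q - b == p)%N then u x else fun=> 0.
  by apply/funext => z; rewrite -bidegreeE pu; case: ifP.
case: leqP => [bq|bq]; last first.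
  by case: eqP => // qe; move: bq; rewrite qe; lia.
rewrite E -{2}(subnKC bq) eqn_add2l; case: ifP => // _.
by rewrite /alt_sum big1 // => i _; rewrite !mulr0.
Qed.

Lemma has_typeD J p k (u w : dform V k) : has_type J p u -> has_type J p w ->
  has_type J p (fun x v => u x v + w x v).
Proof.
move=> pu pw q; apply/funext => x; apply/funext => v.
rewrite bidegreeE type_partD -!bidegreeE pu pw.
by case: ifP => // _; rewrite addr0.
Qed.

Lemma has_typeZ J p k c (u : dform V k) : has_type J p u ->
  has_type J p (fun x v => c * u x v).
Proof.
move=> pu q; apply/funext => x; apply/funext => v.
rewrite bidegreeE type_partZ -!bidegreeE pu.
by case: ifP => // _; rewrite mulr0.
Qed.

(** On a form of pure type a single summand of the definition survives, which
    is the projection of [ext_d u]. *)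
Lemma delbar_typeE J p k (u : dform V k) : has_type J p u -> (p <= k)%N ->
  delbar J u = bidegree J p (ext_d u).
Proof.
move=> pu pk; apply/funext => x; apply/funext => v; rewrite /delbar.
have pk1 : (p < k.+1)%N by [].
rewrite (bigD1 (Ordinal pk1)) //= pu eqxx big1 ?addr0 // => q /eqP qp.
rewrite pu ifF ?ext_d0 ?bidegree0 //.
by apply/eqP => e; apply: qp; apply: ord_inj.
Qed.

Lemma del_typeE J p k (u : dform V k) : has_type J p u -> (p <= k)%N ->
  del J u = bidegree J p.+1 (ext_d u).
Proof.
move=> pu pk; apply/funext => x; apply/funext => v; rewrite /del.
have pk1 : (p < k.+1)%N by [].
rewrite (bigD1 (Ordinal pk1)) //= pu eqxx big1 ?addr0 // => q /eqP qp.
rewrite pu ifF ?ext_d0 ?bidegree0 //.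
by apply/eqP => e; apply: qp; apply: ord_inj.
Qed.

Lemma bidegreeD J p k (u w : dform V k) :
  bidegree J p (fun x v => u x v + w x v) =
  fun x v => bidegree J p u x v + bidegree J p w x v.
Proof. by apply/funext => x; apply/funext => v; exact: (@type_partD R V (J x) p k (u x) (w x) v). Qed.

Lemma bidegreeZ J p k c (u : dform V k) :
  bidegree J p (fun x v => c * u x v) = fun x v => c * bidegree J p u x v.
Proof. by apply/funext => x; apply/funext => v; exact: (@type_partZ R V (J x) p k c (u x) v). Qed.

End Calculus.

(** * Multilinear forms on vector fields *)

Section Multilinear.
Variables (R : realType) (V : normedModType R).
Local Notation C := R[i].

Definition update k (v : 'I_k -> V) (j : 'I_k) (a : V) : 'I_k -> V :=
  fun i => if i == j then a else v i.

Lemma updateC k (v : 'I_k -> V) i j a b : i != j ->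
  update (update v i a) j b = update (update v j b) i a.
Proof.
move=> ij; apply/funext => l; rewrite /update.
by case: (l =P j) => // ->; rewrite eq_sym (negbTE ij).
Qed.

Lemma update_twice k (v : 'I_k -> V) j a b : update (update v j a) j b = update v j b.
Proof. by apply/funext => l; rewrite /update; case: eqP. Qed.

Lemma update_inj k l (v : 'I_l -> V) (s : 'I_k -> 'I_l) j a : injective s ->
  (fun i => update v (s j) a (s i)) = update (fun i => v (s i)) j a.
Proof. by move=> si; apply/funext => i; rewrite /update (inj_eq si). Qed.

Lemma update_out k l (v : 'I_l -> V) (s : 'I_k -> 'I_l) m a :
  (forall i, s i != m) -> (fun i => update v m a (s i)) = (fun i => v (s i)).
Proof. by move=> sm; apply/funext => i; rewrite /update (negbTE (sm i)). Qed.

Definition multilinear k (f : ('I_k -> V) -> C) : Prop :=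
  forall v j c a b, f (update v j (c *: a + b)) =
    c%:C%C * f (update v j a) + f (update v j b).

Lemma mlin0 k (f : ('I_k -> V) -> C) v j : multilinear f -> f (update v j 0) = 0.
Proof.
move=> fl; have := fl v j 0 0 0; rewrite scaler0 addr0 mul0r add0r => _.
have := fl v j 1 0 0; rewrite scaler0 addr0 mul1r => /eqP.
by rewrite -[X in X == _]addr0 (inj_eq (addrI _)) eq_sym => /eqP.
Qed.

Lemma mlinZ k (f : ('I_k -> V) -> C) v j c a : multilinear f ->
  f (update v j (c *: a)) = c%:C%C * f (update v j a).
Proof. by move=> fl; have := fl v j c a 0; rewrite addr0 (mlin0 _ _ fl) addr0. Qed.

Lemma mlinN k (f : ('I_k -> V) -> C) v j a : multilinear f ->
  f (update v j (- a)) = - f (update v j a).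
Proof. by move=> fl; rewrite -scaleN1r mlinZ // rmorphN1 mulN1r. Qed.

Lemma mlin_sum k (f : ('I_k -> V) -> C) v j (I : Type) (r : seq I) (c : I -> R)
    (E : I -> V) : multilinear f ->
  f (update v j (\sum_(b <- r) c b *: E b)) =
  \sum_(b <- r) (c b)%:C%C * f (update v j (E b)).
Proof.
move=> fl; elim: r => [|b r IH]; first by rewrite !big_nil mlin0.
by rewrite !big_cons fl IH.
Qed.

Lemma alt_sum_mlin k (F : V -> ('I_k -> V) -> C) :
  (forall h, multilinear (F h)) ->
  (forall z c a b, F (c *: a + b) z = c%:C%C * F a z + F b z) ->
  multilinear (alt_sum F).
Proof.
move=> Fz Fh v m c a b; rewrite mulr_sumr -big_split /=; apply: eq_bigr => i _.
case: (unliftP i m) => [j|] ->.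
  rewrite !(update_inj _ _ _ (@lift_inj _ i)) Fz /update.
  by rewrite (negbTE (neq_lift i j)); ring.
rewrite !(@update_out _ _ _ (lift i)) => [|j|j|j]; rewrite 1?eq_sym ?neq_lift //.
by rewrite /update eqxx Fh; ring.
Qed.

Lemma type_part_mlin (A : V -> V) p k (f : ('I_k -> V) -> C) :
  linear A -> multilinear f -> multilinear (type_part A p f).
Proof.
move=> lA fl v m c a b.
rewrite /type_part mulrCA -mulrDr; congr (_ * _).
rewrite mulr_sumr -big_split /=; apply: eq_bigr => S _.
rewrite mulr_sumr -big_split /=; apply: eq_bigr => T _.
have E d : (fun j => if j \in T then A (update v m d j) else update v m d j) =
    update (fun j => if j \in T then A (v j) else v j) m
      (if m \in T then A d else d).
  by apply/funext => j; rewrite /update; case: (j =P m) => // ->.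
rewrite !E; case: ifP => _; rewrite ?lA fl; ring.
Qed.

Lemma type_part_alternates (A : V -> V) p k (f : ('I_k -> V) -> C) :
  alternates f -> alternates (type_part A p f).
Proof.
move=> fa v s; rewrite /type_part mulrCA; congr (_ * _).
rewrite (reindex_inj (imset_inj (@perm_inj _ s^-1%g))) mulr_sumr /=.
apply: eq_big => [S|S _]; first by rewrite card_imset //; apply: perm_inj.
rewrite (reindex_inj (imset_inj (@perm_inj _ s^-1%g))) mulr_sumr /=.
apply: eq_bigr => T _; rewrite mulrCA; congr (_ * _).
  rewrite big_imset /=; last by move=> ? ? _ _; apply: perm_inj.
  by apply: eq_bigr => j _; rewrite (mem_imset _ _ (@perm_inj _ s^-1%g)).
rewrite -fa; congr f; apply/funext => j.
by rewrite -{1}(permK s j) (mem_imset _ _ (@perm_inj _ s^-1%g)).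
Qed.

Definition mlin_form k (w : dform V k) : Prop := forall x, multilinear (w x).

Lemma bidegree_mlin J p k (w : dform V k) : (forall x, linear (J x)) ->
  mlin_form w -> mlin_form (bidegree J p w).
Proof. by move=> lJ lw x; exact: (@type_part_mlin (J x) p k (w x)). Qed.

Lemma bidegree_alt J p k (w : dform V k) : alt_form w -> alt_form (bidegree J p w).
Proof. by move=> aw x; exact: (@type_part_alternates (J x) p k (w x)). Qed.

Lemma ext_d_mlin k (w : dform V k) : smooth_form w -> mlin_form w ->
  mlin_form (ext_d w).
Proof.
move=> sw lw x; apply: (@alt_sum_mlin k (fun h z => cderive h (w^~ z) x)).
  move=> h v j c a b.
  transitivity (cderive h (fun y => c%:C%C * w y (update v j a) +
      w y (update v j b)) x).
    by congr (cderive h _ x); apply/funext => y; exact: lw.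
  by rewrite cderiveD ?cderiveZ //; apply: csmoothZ.
by move=> z c a b; rewrite cderiveDr // cderiveZr.
Qed.

Lemma wedge_mlin k l (u : dform V k) (w : dform V l) :
  mlin_form u -> mlin_form w -> mlin_form (wedge u w).
Proof.
move=> lu lw x v m c a b; rewrite /wedge mulrCA -mulrDr; congr (_ * _).
rewrite mulr_sumr -big_split /=; apply: eq_bigr => s _.
rewrite -[m](permKV s); set n := (s^-1%g m).
have il : injective (fun i => s (lshift l i) : 'I_(k + l)).
  by apply: inj_comp perm_inj (@lshift_inj _ _).
have ir : injective (fun i => s (rshift k i) : 'I_(k + l)).
  by apply: inj_comp perm_inj (@rshift_inj _ _).
case: (split_ordP n) => j ->.
  rewrite !(@update_inj _ _ v _ j _ il).
  rewrite !(@update_out _ _ _ (fun i => s (rshift k i))) => [|i|i|i];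
    try by rewrite (inj_eq perm_inj) eq_rlshift.
  rewrite lu; move: (u x (update _ _ a)) (u x (update _ _ b)) (w x _) => A B D; move: (_ ^+ s) => sg.
  by ring.
rewrite !(@update_inj _ _ v _ j _ ir).
rewrite !(@update_out _ _ _ (fun i => s (lshift l i))) => [|i|i|i];
  try by rewrite (inj_eq perm_inj) eq_lrshift.
rewrite lw; move: (w x (update _ _ a)) (w x (update _ _ b)) (u x _) => A B D; move: (_ ^+ s) => sg.
by ring.
Qed.

Lemma form_exp_mlin (w : dform V 2) k : mlin_form w -> mlin_form (form_exp w k).
Proof.
move=> lw; elim: k => [|k IH]; first by move=> x v [].
exact: (@wedge_mlin 2 k.*2 w (form_exp w k)).
Qed.

End Multilinear.

(** Forms are differentiated below after evaluation on the vector fields [U j],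
    whose values are expanded in a basis with smooth coefficients. *)
Section Substitution.
Variables (R : realType) (V : normedModType R) (m : nat).
Variables (E : 'I_m -> V) (coor : 'I_m -> V -> R).
Hypothesis coorK : forall v, v = \sum_b coor b v *: E b.
Variables (k : nat) (w : dform V k) (U : 'I_k -> V -> V).
Hypotheses (sw : smooth_form w) (lw : mlin_form w).
Hypothesis sU : forall j b, smooth_on setT (fun y => coor b (U j y) : R^o).

Definition field_deriv (h x : V) (j : 'I_k) : V :=
  \sum_b 'D_h (fun y => coor b (U j y) : R^o) x *: E b.

(* The first [n] arguments vary with the point, the others are frozen: the
   fields are substituted one at a time. *)
Let mix n (v : 'I_k -> V) y : 'I_k -> V := fun j => if (j < n)%N then U j y else v j.

Let mixS n v (jn : 'I_k) y : jn = n :> nat ->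
  mix n.+1 v y = mix n (update v jn (U jn y)) y.
Proof.
move=> jne; apply/funext => j; rewrite /mix /update ltnS leq_eqVlt -jne.
by case: (j =P jn) => [->|]; rewrite ?eqxx ?ltnn //= => /eqP; rewrite -val_eqE => /negbTE ->.
Qed.

Let mix_update n v (jn : 'I_k) y a : jn = n :> nat ->
  mix n (update v jn a) y = update (mix n v y) jn a.
Proof.
move=> jne; apply/funext => j; rewrite /mix /update -jne.
by case: (j =P jn) => [->|]; rewrite ?ltnn.
Qed.

Let subst_step n : (n <= k)%N -> forall v,
  csmooth (fun y => w y (mix n v y)) /\
  forall h x, cderive h (fun y => w y (mix n v y)) x =
    cderive h (fun y => w y (mix n v x)) x +
    \sum_(j < k | (j < n)%N) w x (update (mix n v x) j (field_deriv h x j)).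
Proof.
elim: n => [_ v|n IH nk v].
  have E0 y : mix 0 v y = v by [].
  under eq_fun do rewrite E0.
  by split=> // h x; rewrite E0 big_pred0 ?addr0.
pose jn : 'I_k := Ordinal nk; have jne : jn = n :> nat by [].
have {}IH := IH (ltnW nk).
have expand y : w y (mix n.+1 v y) =
    \sum_b (coor b (U jn y))%:C%C * w y (mix n (update v jn (E b)) y).
  rewrite (mixS _ _ jne) [U jn y in LHS]coorK mix_update // mlin_sum //.
  by apply: eq_bigr => b _; rewrite mix_update.
under eq_fun do rewrite expand.
have sm b : csmooth (fun y => (coor b (U jn y))%:C%C * w y (mix n (update v jn (E b)) y)).
  by apply: csmoothM; [exact: csmoothR | exact: (IH _).1].
split=> [|h x]; first exact: csmooth_sum.
rewrite cderive_sum //.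
under eq_bigr => b _.
  rewrite cderiveM; [|exact: csmoothR|exact: (IH _).1].
  rewrite cderiveR (IH _).2 mulrDr mix_update //.
  over.
rewrite big_split big_split /= addrC -addrA; congr (_ + _).
  under [in RHS]eq_fun => y.
    rewrite (mixS _ _ jne) [U jn x]coorK mix_update // mlin_sum //.
    over.
  rewrite cderive_sum => [|b]; last exact: csmoothZ.
  by apply: eq_bigr => b _; rewrite cderiveZ.
rewrite [RHS](bigD1 jn) //= addrC; congr (_ + _).
  rewrite -mlin_sum //; congr (w x _).
  by rewrite (mixS _ _ jne) mix_update // update_twice.
under eq_bigr do rewrite mulr_sumr.
rewrite exchange_big /=; apply: eq_big => [j|j jn'].
  by rewrite ltnS andbC ltn_neqAle -val_eqE.
have jnj : jn != j by rewrite -val_eqE /= neq_ltn jn' orbT.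
rewrite (mixS _ _ jne) mix_update // [U jn x]coorK updateC // mlin_sum //.
by apply: eq_bigr => b _; rewrite -coorK updateC.
Qed.

Lemma mlin_subst_smooth : csmooth (fun y => w y (U^~ y)).
Proof.
have [+ _] := subst_step (leqnn k) (fun _ => 0); congr csmooth.
by apply/funext => y; congr (w y _); apply/funext => j; rewrite /mix ltn_ord.
Qed.

(** The product rule: either [w] is differentiated with its arguments frozen, or
    one of the fields is. *)
Lemma mlin_subst_derive h x :
  cderive h (fun y => w y (U^~ y)) x = cderive h (fun y => w y (U^~ x)) x +
  \sum_(j < k) w x (update (U^~ x) j (field_deriv h x j)).
Proof.
have [_ /(_ h x)] := subst_step (leqnn k) (fun _ => 0).
have mE y : mix k (fun _ => 0) y = U^~ y.
  by apply/funext => j; rewrite /mix ltn_ord.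
under eq_fun do rewrite mE.
rewrite mE => ->; congr (_ + _); apply: eq_bigl => j.
by rewrite ltn_ord.
Qed.

End Substitution.

(** * Left translations in coordinates *)

(** Linear coordinates in the order [x_0, y_0, x_1, y_1, x_2, y_2, z_0, z_1], where
    [x_0, y_0, z_0] are those of [H_3] and the others those of [H_5]. *)
Record coord_system (R : realType) (V : normedModType R) := CoordSystem {
  crd : nat -> {linear V -> R^o};
  bas : nat -> V;
  crd_cont : forall n, continuous (crd n);
  crd_bas : forall n m, (n < 8)%N -> crd n (bas m) = (n == m)%:R;
  crdK : forall v, v = \sum_(b < 8) crd b v *: bas b }.

Section LeftInvariant.
Variables (R : realType) (V : normedModType R) (K : coord_system V).
Local Notation crd := (crd K).
Local Notation bas := (bas K).
Local Notation smooth := (@smooth_on R V _ setT).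

Lemma crd_ext p q : (forall n, (n < 8)%N -> crd n p = crd n q) -> p = q.
Proof.
move=> pq; rewrite (crdK K p) (crdK K q); apply: eq_bigr => b _.
by rewrite pq.
Qed.

Lemma smooth_crd n : smooth (crd n).
Proof.
have := @smooth_affine R V R^o (crd n) 0 (@crd_cont _ _ K n).
by congr smooth_on; apply/funext => y; rewrite addr0.
Qed.

Lemma derive_crd n x v : 'D_v (crd n) x = crd n v.
Proof.
rewrite -(@derive_lin R V R^o (crd n) 0 x v (@crd_cont _ _ K n)).
by congr ('D_v _ x); apply/funext => y; rewrite addr0.
Qed.

Lemma crdD n u v : crd n (u + v) = crd n u + crd n v.
Proof. exact: raddfD. Qed.
Lemma crdN n u : crd n (- u) = - crd n u.
Proof. exact: raddfN. Qed.
Lemma crdZ n c u : crd n (c *: u) = c * crd n u.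
Proof. exact: (linearZ_LR (crd n)). Qed.
Lemma crd0 n : crd n 0 = 0.
Proof. exact: raddf0. Qed.
Definition crdE := (crdD, crdN, crdZ, crd0).

Definition of_crd (f : nat -> R) : V := \sum_(b < 8) f b *: bas b.

Lemma crd_of_crd f n : (n < 8)%N -> crd n (of_crd f) = f n.
Proof.
move=> n8; rewrite /of_crd raddf_sum (bigD1 (Ordinal n8)) //=.
rewrite linearZ_LR crd_bas // eqxx big1 => [|j jn].
  by rewrite addr0; exact: mulr1.
rewrite linearZ_LR crd_bas // -(inj_eq val_inj) /= in jn *.
by rewrite eq_sym (negbTE jn); exact: mulr0.
Qed.

Lemma smooth_of_crd (f : V -> nat -> R) :
  (forall n, (n < 8)%N -> smooth (fun y => f y n : R^o)) ->
  smooth (fun y => of_crd (f y)).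
Proof.
move=> sf; pose P (h : V -> V) := exists phi : 'I_8 -> V -> R^o,
  (forall b, smooth (phi b)) /\ h = \sum_(b < 8) (fun y => phi b y *: bas b).
apply: (@smooth_coind R V V P) => [h x|h v|].
- move=> [phi [sphi ->]]; apply: differentiable_sum => b.
  by apply: (@differentiableZl R V V); apply: smooth_diff.
- move=> [phi [sphi ->]]; exists (fun b => 'D_v (phi b)); split.
    by move=> b; apply: smooth_derive.
  have dphi b x : differentiable (fun y => phi b y *: bas b) x.
    by apply: (@differentiableZl R V V); apply: smooth_diff.
  apply/funext => x; rewrite derive_sum => [|b]; last exact: diff_derivable.
  rewrite fct_sumE; apply: eq_bigr => b _; rewrite !deriveE //.
    by rewrite (@diffZl R V V) //; apply: smooth_diff.
  exact: smooth_diff.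
exists (fun b y => f y b); split; first by move=> b; apply: sf.
by apply/funext => y; rewrite fct_sumE.
Qed.

(** The cocycle of the group law: the central part of [a * b - a - b]. *)
Definition cocycle (a b : V) (n : nat) : R :=
  match n with
  | 6 => crd 0 a * crd 1 b
  | 7 => crd 2 a * crd 3 b + crd 4 a * crd 5 b
  | _ => 0
  end.

(** The differential of left translation by [a], which does not depend on the
    point where it is taken. *)
Definition ltrans (a v : V) : V :=
  v + (cocycle a v 6 *: bas 6 + cocycle a v 7 *: bas 7).

Lemma ltransE a v :
  ltrans a v = v + (cocycle a v 6 *: bas 6 + cocycle a v 7 *: bas 7).
Proof. by []. Qed.

(** The group law; the vector space is identified with the group. *)
Definition gmul (a x : V) : V := ltrans a x + a.

Lemma crd_ltrans n a v : (n < 8)%N -> crd n (ltrans a v) = crd n v + cocycle a v n.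
Proof.
move=> n8; rewrite !raddfD /= !linearZ_LR !crd_bas //; congr (_ + _).
do 8?[case: n n8 => [|n] n8] => //=; rewrite /GRing.scale /=.
all: by rewrite ?(mulr0, mulr1, addr0, add0r).
Qed.

Lemma crd_ltrans6 a v : crd 6 (ltrans a v) = crd 6 v + crd 0 a * crd 1 v.
Proof. exact: crd_ltrans. Qed.
Lemma crd_ltrans7 a v :
  crd 7 (ltrans a v) = crd 7 v + (crd 2 a * crd 3 v + crd 4 a * crd 5 v).
Proof. exact: crd_ltrans. Qed.
Lemma crd_ltrans_id n a v : (n < 6)%N -> crd n (ltrans a v) = crd n v.
Proof.
move=> n6; rewrite crd_ltrans ?(leq_trans n6) //.
by do 6?[case: n n6 => [|n] n6] => //=; rewrite addr0.
Qed.

Lemma cocycle_linear a n : linear (fun v => cocycle a v n : R^o).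
Proof.
move=> c u v; do 8?[case: n => [|n]] => /=; rewrite ?crdE /GRing.scale /=; ring.
Qed.

Lemma ltrans_is_linear a : linear (ltrans a).
Proof.
move=> c u v; apply: crd_ext => n n8.
rewrite [RHS]crdD crdZ !crd_ltrans // crdD crdZ cocycle_linear.
by rewrite /GRing.scale /=; ring.
Qed.

HB.instance Definition _ a :=
  GRing.isLinear.Build R V V _ (ltrans a) (ltrans_is_linear a).

Lemma ltrans_cont a : continuous (ltrans a).
Proof.
have cc n : continuous (fun v => cocycle a v n : R^o).
  have cM c m : continuous (fun v => c * crd m v : R^o).
    move=> x; apply: (@continuousM _ V); first exact: cst_continuous.
    exact: crd_cont.
  do 8?[case: n => [|n]]; try exact: cst_continuous; first exact: cM.
  by move=> x; apply: (@continuousD _ R^o V) (@cM _ _ x) (@cM _ _ x).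
move=> x; apply: (@cvgD R V V); first exact: cvg_id.
by apply: (@cvgD R V V); apply: (@cvgZr_tmp R V V); exact: cc.
Qed.

Lemma derive_gmul a x v : 'D_v (gmul a) x = ltrans a v.
Proof. exact: derive_lin (@ltrans_cont a). Qed.

(** [ltrans a] depends on [a] modulo the centre only, where the group law is
    addition. *)
Lemma ltransD a b v : ltrans (a + b) v = ltrans a (ltrans b v).
Proof.
apply: crd_ext => n n8; rewrite !crd_ltrans // -addrA; congr (_ + _).
do 8?[case: n n8 => [|n] n8] => //=; rewrite ?(crd_ltrans_id, raddfD) //= ?addr0 //.
all: by ring.
Qed.

Lemma ltransK a v : ltrans (- a) (ltrans a v) = v.
Proof.
apply: crd_ext => n n8; rewrite -ltransD addNr crd_ltrans //.
by do 8?[case: n n8 => [|n] n8] => //=; rewrite ?raddf0 ?mul0r ?addr0.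
Qed.

Lemma ltransVK a v : ltrans a (ltrans (- a) v) = v.
Proof. by rewrite -{1}(opprK a) ltransK. Qed.

Lemma eq_ltrans a b v : (forall n, (n < 6)%N -> crd n a = crd n b) ->
  ltrans a v = ltrans b v.
Proof.
move=> ab; apply: crd_ext => n n8; rewrite !crd_ltrans //; congr (_ + _).
by do 8?[case: n n8 => [|n] n8] => //=; rewrite ?ab.
Qed.

Lemma crd_gmul n a x : (n < 6)%N -> crd n (gmul a x) = crd n x + crd n a.
Proof. by move=> n6; rewrite /gmul crdD crd_ltrans_id. Qed.

Lemma ltrans_gmul a x v : ltrans (gmul a x) v = ltrans a (ltrans x v).
Proof.
rewrite -ltransD; apply: eq_ltrans => n n6.
by rewrite crd_gmul // crdD addrC.
Qed.

Lemma ltransN_gmul a x v : ltrans (- gmul a x) (ltrans a v) = ltrans (- x) v.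
Proof.
rewrite -ltransD; apply: eq_ltrans => n n6.
by rewrite crdD !crdN crd_gmul // opprD addrNK.
Qed.

End LeftInvariant.

(** * The complex structure and the Hermitian metric *)

Section ComplexStructure.
Variables (R : realType) (V : normedModType R) (K : coord_system V).
Local Notation C := R[i].
Local Notation crd := (crd K).
Local Notation bas := (bas K).
Local Notation smooth := (@smooth_on R V _ setT).

(** The complex structure at the neutral element: [J X_j = Y_j],
    [J Z_0 = - Z_0 - 2 Z_1] and [J Z_1 = Z_0 + Z_1]. *)
Definition frame_cplx (v : V) (n : nat) : R :=
  match n with
  | 0 => - crd 1 v | 1 => crd 0 v | 2 => - crd 3 v | 3 => crd 2 v
  | 4 => - crd 5 v | 5 => crd 4 v
  | 6 => crd 7 v - crd 6 v | _ => crd 7 v - 2 * crd 6 v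
  end.

Definition cplx (x v : V) : V := ltrans K x (of_crd K (frame_cplx (ltrans K (- x) v))).

(** The left-invariant forms dual to the frame; [coframe 6] and [coframe 7] are
    [dz_0 - x_0 dy_0] and [dz_1 - x_1 dy_1 - x_2 dy_2]. *)
Definition coframe (n : nat) (x v : V) : R := crd n (ltrans K (- x) v).

Lemma coframe_id n x v : (n < 6)%N -> coframe n x v = crd n v.
Proof. by move=> n6; rewrite /coframe crd_ltrans_id. Qed.

Lemma coframe6 x v : coframe 6 x v = crd 6 v - crd 0 x * crd 1 v.
Proof. by rewrite /coframe crd_ltrans6 crdN mulNr. Qed.

Lemma coframe7 x v : coframe 7 x v = crd 7 v - (crd 2 x * crd 3 v + crd 4 x * crd 5 v).
Proof. by rewrite /coframe crd_ltrans7 !crdN; ring. Qed.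

Lemma coframe_cplx n x v : (n < 8)%N ->
  coframe n x (cplx x v) = frame_cplx (ltrans K (- x) v) n.
Proof. by move=> n8; rewrite /coframe /cplx ltransK crd_of_crd. Qed.

Lemma coframe_ext x v w : (forall n, (n < 8)%N -> coframe n x v = coframe n x w) -> v = w.
Proof.
by move=> /crd_ext vw; rewrite -(ltransVK K x v) vw ltransVK.
Qed.

Lemma frame_cplx_linear c u v n : frame_cplx (c *: u + v) n = c * frame_cplx u n + frame_cplx v n.
Proof. by do 7?[case: n => [|n]] => /=; rewrite !crdE; ring. Qed.

Lemma cplx_linear x : linear (cplx x).
Proof.
move=> c u v; apply: (coframe_ext (x := x)) => n n8.
rewrite [in RHS]/coframe [in RHS]linearP /= crdD crdZ -!/(coframe _ _ _).
by rewrite !coframe_cplx // linearP frame_cplx_linear.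
Qed.

Lemma cplxK x v : cplx x (cplx x v) = - v.
Proof.
apply: (coframe_ext (x := x)) => n n8; rewrite coframe_cplx //.
rewrite [in RHS]/coframe linearN crdN -/(coframe n x v).
have E m : (m < 8)%N -> crd m (ltrans K (- x) (cplx x v)) = frame_cplx (ltrans K (- x) v) m.
  exact: coframe_cplx.
by do 8?[case: n n8 => [|n] n8] => //=; rewrite !E //= /coframe; ring.
Qed.

Lemma cplx_gmul a x v : cplx (gmul K a x) (ltrans K a v) = ltrans K a (cplx x v).
Proof. by rewrite /cplx ltransN_gmul ltrans_gmul. Qed.

Lemma smoothB (f g : V -> R^o) : smooth f -> smooth g ->
  smooth (fun y => f y - g y : R^o).
Proof. by move=> sf sg; apply: smoothD sf (smoothN sg). Qed.

Lemma smooth_coframe n v : (n < 8)%N -> smooth (fun y => coframe n y v : R^o).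
Proof.
have sM m c : smooth (fun y => crd m y * c : R^o).
  by apply: smoothM; [exact: smooth_crd|exact: smooth_cst].
do 6?[case: n => [_|n];
  first by under eq_fun do rewrite coframe_id //; apply: smooth_cst].
case: n => [_|[_|//]].
  by under eq_fun do rewrite coframe6; apply: smoothB; first exact: smooth_cst.
under eq_fun do rewrite coframe7; apply: smoothB; first exact: smooth_cst.
exact: smoothD.
Qed.

Lemma smooth_crd_cplx n v : (n < 8)%N -> smooth (fun y => crd n (cplx y v) : R^o).
Proof.
move=> n8; have E y : crd n (cplx y v) = frame_cplx (ltrans K (- y) v) n +
    cocycle K y (of_crd K (frame_cplx (ltrans K (- y) v))) n.
  by rewrite /cplx crd_ltrans // crd_of_crd.
under eq_fun do rewrite E.
clear E; have sJ m : (m < 8)%N -> smooth (fun y => frame_cplx (ltrans K (- y) v) m : R^o).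
  have sc l := @smooth_coframe l v.
  do 7?[case: m => [|m]] => //= _; do ?exact: sc; do ?exact: smoothN (sc _ _).
    by apply: smoothB; exact: sc.
  apply: smoothB; first exact: sc.
  by apply: smoothM; [exact: smooth_cst|exact: sc].
apply: smoothD; first exact: sJ.
do 8?[case: n n8 => [|n] n8] => //=; do ?exact: smooth_cst.
  under eq_fun do rewrite crd_of_crd //.
  by apply: smoothM; [exact: smooth_crd|exact: sJ].
under eq_fun do rewrite !crd_of_crd //.
by apply: smoothD; apply: smoothM; do ?exact: smooth_crd; exact: sJ.
Qed.

Lemma smooth_cplx v : smooth (fun y => cplx y v).
Proof.
have -> : (fun y => cplx y v) = fun y => of_crd K (fun n => crd n (cplx y v)).
  by apply/funext => y; exact: crdK.
by apply: smooth_of_crd => n n8; exact: smooth_crd_cplx.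
Qed.

(** The last summand is the squared modulus of [z_1^* + (i - 1) z_0^*]; the factor
    2 is the one that makes the permanent in [permanent0] vanish. *)
Definition metric0 (u v : V) : R :=
  2 * (crd 0 u * crd 0 v + crd 1 u * crd 1 v) +
  (crd 2 u * crd 2 v + crd 3 u * crd 3 v) + (crd 4 u * crd 4 v + crd 5 u * crd 5 v) +
  ((crd 7 u - crd 6 u) * (crd 7 v - crd 6 v) + crd 6 u * crd 6 v).

Definition metric (x u v : V) : R := metric0 (ltrans K (- x) u) (ltrans K (- x) v).

Lemma metric_linear x u : linear (metric x u : V -> R^o).
Proof.
have E u' v' w' c : metric0 u' (c *: v' + w') = c * metric0 u' v' + metric0 u' w'.
  rewrite /metric0 !crdE.
  move: (crd 0 u') (crd 1 u') (crd 2 u') (crd 3 u') (crd 4 u') (crd 5 u') (crd 6 u') (crd 7 u').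
  move: (crd 0 v') (crd 1 v') (crd 2 v') (crd 3 v') (crd 4 v') (crd 5 v') (crd 6 v') (crd 7 v').
  move: (crd 0 w') (crd 1 w') (crd 2 w') (crd 3 w') (crd 4 w') (crd 5 w') (crd 6 w') (crd 7 w').
  move=> *; ring.
by move=> c v w; rewrite /metric linearP E.
Qed.

Lemma metricC x u v : metric x u v = metric x v u.
Proof. rewrite /metric /metric0; ring. Qed.

Lemma metric_gt0 x v : v != 0 -> 0 < metric x v v.
Proof.
apply: contraNT; rewrite -leNgt /metric; set w := ltrans K (- x) v => w0.
have : w = 0.
  have s n : 0 <= crd n w ^+ 2 by exact: sqr_ge0.
  have := sqr_ge0 (crd 7 w - crd 6 w); move: w0 (s 0%N) (s 1%N) (s 2%N) (s 3%N)
    (s 4%N) (s 5%N) (s 6%N); rewrite /metric0 -!expr2 => w0 s0 s1 s2 s3 s4 s5 s6 s7.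
  have z t : t ^+ 2 <= 0 -> t = 0 :> R.
    by move=> t0; apply/eqP; rewrite -sqrf_eq0 eq_le t0 sqr_ge0.
  have z6 : crd 6 w = 0 by apply: z; lra.
  have z7 : crd 7 w = 0.
    by have : crd 7 w - crd 6 w = 0 by [apply: z; lra]; rewrite z6 subr0.
  apply: (crd_ext (K := K)) => n n8; rewrite crd0.
  by do 8?[case: n n8 => [|n] n8] => //; apply: z; lra.
by move=> w_eq0; rewrite -(ltransVK K x v) -/w w_eq0 linear0.
Qed.

Lemma smooth_metric u v : smooth (fun x => metric x u v : R^o).
Proof.
have sc n w := @smooth_coframe n w.
have sp n : (n < 8)%N -> smooth (fun x => coframe n x u * coframe n x v : R^o).
  by move=> n8; apply: smoothM; exact: sc.
have sB w : smooth (fun x => coframe 7 x w - coframe 6 x w : R^o).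
  by apply: smoothB; exact: sc.
have sD n m : (n < 8)%N -> (m < 8)%N -> smooth (fun x =>
    coframe n x u * coframe n x v + coframe m x u * coframe m x v : R^o).
  by move=> n8 m8; exact: smoothD (sp _ n8) (sp _ m8).
apply: (smoothD (smoothD (smoothD (smoothM (smooth_cst (2 : R^o)) (sD 0%N 1%N _ _))
  (sD 2%N 3%N _ _)) (sD 4%N 5%N _ _)) (smoothD (smoothM (sB u) (sB v)) (sp 6%N _))) => //.
Qed.

Lemma metric_gmul a x u v :
  metric (gmul K a x) (ltrans K a u) (ltrans K a v) = metric x u v.
Proof. by rewrite /metric !ltransN_gmul. Qed.

Lemma metric_cplx x u v : metric x (cplx x u) (cplx x v) = metric x u v.
Proof. rewrite /metric /cplx !ltransK /metric0 !crd_of_crd //=; ring. Qed.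

End ComplexStructure.

(** * Invariant forms and the structure equations *)

Section GauduchonMetric.
Variables (R : realType) (V : normedModType R) (K : coord_system V).
Local Notation C := R[i].
Local Notation crd := (crd K).
Local Notation cplx := (cplx K).
Local Notation coframe := (coframe K).
Local Notation one := (@unit_form R V).

Definition dcrd n (x v : V) : C := (crd n v)%:C%C.
(** The flag [b] tells a form of type (1,0) from its conjugate. *)
Definition zeta b j (x v : V) : C := dcrd j.*2 x v + conj_sign R (~~ b) * dcrd j.*2.+1 x v.
Definition vert_form b (x v : V) : C :=
  (coframe 7 x v - coframe 6 x v)%:C%C + conj_sign R (~~ b) * (coframe 6 x v)%:C%C.

Lemma vert_formE b x v : vert_form b x v =
  (coframe 7 x v - coframe 6 x v)%:C%C + conj_sign R (~~ b) * (coframe 6 x v)%:C%C.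
Proof. by []. Qed.

(** [plane j u] is [sigma_j /\ u] with [sigma_j = dx_j /\ dy_j], [vertical u] is
    [om /\ om^- /\ u] and [diag a b c u] is
    [(a sigma_0 + b sigma_1 + c sigma_2) /\ u].  Forms are handled through the
    operators of exterior multiplication by them; those of two-forms commute. *)
Definition plane j k (u : dform V k) : dform V k.+2 :=
  ext1 (dcrd j.*2) (ext1 (dcrd j.*2.+1) u).
Definition vertical k (u : dform V k) : dform V k.+2 :=
  ext1 (vert_form true) (ext1 (vert_form false) u).
Definition diag (a b c : C) k (u : dform V k) : dform V k.+2 := fun x v =>
  a * plane 0 u x v + b * plane 1 u x v + c * plane 2 u x v.

Lemma diagE a b c k (u : dform V k) x v : diag a b c u x v =
  a * plane 0 u x v + b * plane 1 u x v + c * plane 2 u x v.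
Proof. by []. Qed.

Lemma diag_fun a b c k (u : dform V k) : diag a b c u = fun x v =>
  a * plane 0 u x v + b * plane 1 u x v + c * plane 2 u x v.
Proof. by []. Qed.

Definition half_i : C := Complex 0 (2^-1).

Lemma half_iK : half_i * (- 'i%C *+ 2) = 1.
Proof. by apply/eqP; rewrite eq_complex /=; apply/andP; split; apply/eqP; field. Qed.

Lemma zeta_cplx b j x v : (j < 3)%N ->
  zeta b j x (cplx x v) = conj_sign R (~~ b) * zeta b j x v.
Proof.
move=> j3; rewrite /zeta /dcrd.
have E n : (n < 6)%N -> crd n (cplx x v) = frame_cplx K (ltrans K (- x) v) n.
  move=> n6; rewrite -(coframe_id K x (cplx x v) n6) coframe_cplx //.
  exact: leq_trans n6 _.
have E' n : (n < 6)%N -> crd n (ltrans K (- x) v) = crd n v.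
  by move=> n6; rewrite crd_ltrans_id.
rewrite mulrDr mulrA conj_sign_sqr mulN1r addrC.
by do 3?[case: j j3 => [|j] j3] => //=; rewrite !E //= !E' // rmorphN.
Qed.

Lemma vert_form_cplx b x v : vert_form b x (cplx x v) = conj_sign R (~~ b) * vert_form b x v.
Proof.
rewrite /vert_form !coframe_cplx //= -![crd _ _]/(coframe _ x v) mulrDr mulrA conj_sign_sqr mulN1r addrC.
by congr (_ + _); rewrite -rmorphN; congr (_ %:C%C); ring.
Qed.

Lemma ext1_pair (e f : V -> V -> C) x v :
  ext1 e (ext1 f one) x v =
  e x (v ord0) * f x (v ord_max) - e x (v ord_max) * f x (v ord0).
Proof.
rewrite /ext1 /alt_sum big_ord_recl big_ord1 !big_ord1 /= /unit_form expr0 expr1.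
have -> : lift ord0 ord0 = ord_max :> 'I_2 by apply: ord_inj.
have -> : lift ord_max ord0 = ord0 :> 'I_2 by apply: ord_inj.
by rewrite !mulr1 !mul1r mulN1r.
Qed.

(** [sigma_j = (i / 2) zeta_j /\ zeta_j^-], which shows that it has type (1,1). *)
Lemma plane_zeta j k (u : dform V k) :
  plane j u = fun x v => half_i * ext1 (zeta true j) (ext1 (zeta false j) u) x v.
Proof.
apply/funext => x; apply/funext => v; rewrite /plane.
have Z b l (w' : dform V l) : ext1 (zeta b j) w' =
    fun x v => ext1 (dcrd j.*2) w' x v + conj_sign R (~~ b) * ext1 (dcrd j.*2.+1) w' x v.
  by rewrite /zeta ext1Dl ext1Zl.
rewrite !Z !ext1D !ext1Z !ext1_id /=.
rewrite (ext1C (dcrd j.*2.+1)) /conj_sign /=.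
set t := ext1 _ _ x v; rewrite -[LHS]mul1r -half_iK; ring.
Qed.

Lemma ext1N e k (u : dform V k) :
  ext1 e (fun x v => - u x v) = fun x v => - ext1 e u x v.
Proof.
have -> : (fun x v => - u x v) = (fun x v => (-1) * u x v).
  by apply/funext => x; apply/funext => v; rewrite mulN1r.
by rewrite ext1Z; apply/funext => x; apply/funext => v; rewrite mulN1r.
Qed.

Lemma ext1_0 e k : ext1 e (fun _ _ => 0) = (fun _ _ => 0) :> dform V k.+1.
Proof.
apply/funext => x; apply/funext => v.
by rewrite /ext1 /alt_sum big1 // => i _; rewrite !mulr0.
Qed.

Lemma plane_ext1 j e k (u : dform V k) : plane j (ext1 e u) = ext1 e (plane j u).
Proof.
rewrite /plane (ext1C _ e) ext1N (ext1C _ e).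
by apply/funext => x; apply/funext => v; rewrite opprK.
Qed.

Lemma planeC j l k (u : dform V k) : plane j (plane l u) = plane l (plane j u).
Proof.
rewrite -[plane l u]/(ext1 (dcrd l.*2) (ext1 (dcrd l.*2.+1) u)).
by rewrite [LHS]plane_ext1 (plane_ext1 j (dcrd l.*2.+1) u).
Qed.

Lemma plane_0 j k : plane j (fun _ _ => 0) = (fun _ _ => 0) :> dform V k.+2.
Proof. by rewrite /plane !ext1_0. Qed.

Lemma plane_id j k (u : dform V k) : plane j (plane j u) = fun _ _ => 0.
Proof. by rewrite [LHS](plane_ext1 j (dcrd j.*2)) /plane ext1_id. Qed.

Lemma vertical_id k (u : dform V k) : vertical (vertical u) = fun _ _ => 0.
Proof.
rewrite /vertical (ext1C (vert_form false)) ext1N ext1_id.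
by apply/funext => x; apply/funext => v; rewrite oppr0.
Qed.

Lemma vertical_0 k : vertical (fun _ _ => 0) = (fun _ _ => 0) :> dform V k.+2.
Proof. by rewrite /vertical !ext1_0. Qed.

Lemma plane_diag j a b c k (u : dform V k) :
  plane j (diag a b c u) = diag a b c (plane j u).
Proof.
rewrite /diag {1}/plane !ext1D !ext1Z -!/(plane j _).
by rewrite !(planeC j).
Qed.

Lemma ext1_diag e a b c k (u : dform V k) :
  ext1 e (diag a b c u) = diag a b c (ext1 e u).
Proof. by rewrite /diag !plane_ext1 !ext1D !ext1Z. Qed.

Lemma diag_vertical a b c k (u : dform V k) :
  diag a b c (vertical u) = vertical (diag a b c u).
Proof. by rewrite /vertical !ext1_diag. Qed.

Lemma diagD a b c k (u w : dform V k) :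
  diag a b c (fun x v => u x v + w x v) =
  fun x v => diag a b c u x v + diag a b c w x v.
Proof.
rewrite /diag /plane !ext1D; apply/funext => x; apply/funext => v.
by rewrite !mulrDr [RHS]addrACA [in RHS](addrACA (a * _)).
Qed.

Lemma diagZ a b c d k (u : dform V k) :
  diag a b c (fun x v => d * u x v) = fun x v => d * diag a b c u x v.
Proof.
rewrite /diag /plane !ext1Z; apply/funext => x; apply/funext => v.
by rewrite !mulrDr !(mulrCA _ d).
Qed.

Lemma diag_0 a b c k : diag a b c (fun _ _ => 0) = (fun _ _ => 0) :> dform V k.+2.
Proof.
rewrite /diag /plane !ext1_0; apply/funext => x; apply/funext => v.
by rewrite !mulr0 !addr0.
Qed.

(** The [sigma_j] commute and have square zero, so that only products of three
    distinct ones survive, each with the same sign. *)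
Lemma diag_permanent a0 a1 a2 b0 b1 b2 c0 c1 c2 k (u : dform V k) :
  diag a0 a1 a2 (diag b0 b1 b2 (diag c0 c1 c2 u)) = fun x v =>
  (a0 * (b1 * c2 + b2 * c1) + a1 * (b0 * c2 + b2 * c0) + a2 * (b0 * c1 + b1 * c0)) *
  plane 0 (plane 1 (plane 2 u)) x v.
Proof.
apply/funext => x; apply/funext => v.
rewrite diagE !plane_diag !diagE !plane_diag !diagE.
rewrite !(planeC 1 0) !(planeC 2 0) !(planeC 2 1) !(planeC 1 0) !plane_id !plane_0.
move: (plane 0 _ x v) => t; ring.
Qed.

Lemma diag_has_type a b c (p k : nat) (u : dform V k) :
  has_type cplx p u -> has_type cplx p.+1 (diag a b c u).
Proof.
move=> pu; have pl j : (j < 3)%N -> has_type cplx p.+1 (plane j u).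
  move=> j3; rewrite plane_zeta; apply: has_typeZ.
  apply: (@has_type_ext1 _ _ _ true) => [x h|]; first exact: zeta_cplx.
  by apply: (@has_type_ext1 _ _ _ false) => // x h; exact: zeta_cplx.
by apply: has_typeD; [apply: has_typeD|]; apply: has_typeZ; exact: pl.
Qed.

Lemma smooth_dcrd n h : csmooth ((dcrd n)^~ h).
Proof. exact: csmooth_cst. Qed.

Lemma smooth_vert_form b h : csmooth ((vert_form b)^~ h).
Proof.
have sc n : (n < 8)%N -> smooth_on setT (fun y => coframe n y h : R^o).
  exact: smooth_coframe.
apply: csmoothD; first by apply: csmoothR; apply: smoothB; exact: sc.
by apply: csmoothZ; apply: csmoothR; exact: sc.
Qed.

Lemma smooth_plane j k (u : dform V k) : smooth_form u -> smooth_form (plane j u).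
Proof. move=> su; apply: smooth_form_ext1; first exact: smooth_dcrd.
by apply: smooth_form_ext1 su; exact: smooth_dcrd. Qed.

Lemma smooth_diag a b c k (u : dform V k) : smooth_form u -> smooth_form (diag a b c u).
Proof.
by move=> su v; apply: csmoothD; [apply: csmoothD|];
   apply: csmoothZ; exact: smooth_plane.
Qed.

Lemma ext_d_dcrd n k (u : dform V k) : smooth_form u ->
  ext_d (ext1 (dcrd n) u) = fun x v => - ext1 (dcrd n) (ext_d u) x v.
Proof.
move=> su; apply/funext => x; apply/funext => v.
rewrite ext_d_ext1 //; last exact: smooth_dcrd.
rewrite [X in X - _]big1 ?sub0r // => i _.
rewrite [alt_sum _ _]big1 ?mulr0 // => j _.
by rewrite cderive_cst mul0r mulr0.
Qed.

Lemma ext_d_plane j k (u : dform V k) : smooth_form u ->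
  ext_d (plane j u) = plane j (ext_d u).
Proof.
move=> su; rewrite /plane ext_d_dcrd ?ext_d_dcrd //; last first.
  by apply: smooth_form_ext1 => //; exact: smooth_dcrd.
by rewrite ext1N; apply/funext => x; apply/funext => v; rewrite opprK.
Qed.

Lemma ext_d_diag a b c k (u : dform V k) : smooth_form u ->
  ext_d (diag a b c u) = diag a b c (ext_d u).
Proof.
move=> su; have sZ d j : smooth_form (fun x v => d * plane j u x v).
  by move=> v; apply: csmoothZ; exact: smooth_plane.
have sD d e j l : smooth_form (fun x v => d * plane j u x v + e * plane l u x v).
  by move=> v; apply: csmoothD; exact: sZ.
rewrite /diag ext_dD // ext_dD // !ext_dZ ?ext_d_plane //; exact: smooth_plane.
Qed.

(** The structure equation [- d om = (i - 1) sigma_0 + sigma_1 + sigma_2] and its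
    conjugate: the only non-constant terms of [vert_form b] are multiples of
    [x_j dy_j]. *)
Lemma ext_d_vert_form b k (u : dform V k) : smooth_form u ->
  ext_d (ext1 (vert_form b) u) = fun x v =>
  - diag (conj_sign R (~~ b) - 1) 1 1 u x v - ext1 (vert_form b) (ext_d u) x v.
Proof.
move=> su; apply/funext => x; apply/funext => v.
rewrite ext_d_ext1 //; last exact: smooth_vert_form.
congr (_ - _); set s := conj_sign R (~~ b).
have dom a h : cderive a ((vert_form b)^~ h) x = - ((s - 1) * (dcrd 0 x a * dcrd 1 x h) +
    1 * (dcrd 2 x a * dcrd 3 x h) + 1 * (dcrd 4 x a * dcrd 5 x h)).
  have sm n m : csmooth (fun y => (crd n y * crd m h)%:C%C).
    by apply: csmoothR; apply: smoothM; [exact: smooth_crd|exact: smooth_cst].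
  have dm n m : cderive a (fun y => (crd n y * crd m h)%:C%C) x =
      dcrd n x a * dcrd m x h.
    rewrite cderiveR derive_mul ?derive_crd ?derive_cst ?mulr0 ?addr0.
    - by rewrite -rmorphM.
    - exact: smooth_crd.
    - exact: smooth_cst.
  have -> : (vert_form b)^~ h = fun y => (dcrd 7 x h + (s - 1) * dcrd 6 x h) +
     ((1 - s) * (crd 0 y * crd 1 h)%:C%C +
      ((-1) * (crd 2 y * crd 3 h)%:C%C + (-1) * (crd 4 y * crd 5 h)%:C%C)).
    apply/funext => y; rewrite /vert_form coframe6 coframe7 -/s /dcrd.
    by rewrite !(rmorphB, rmorphD, rmorphM) /=; ring.
  rewrite cderiveD; [|exact: csmooth_cst|]; last first.
    by apply: csmoothD; [|apply: csmoothD]; apply: csmoothZ.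
  rewrite cderive_cst add0r cderiveD; [|exact: csmoothZ|]; last first.
    by apply: csmoothD; apply: csmoothZ.
  rewrite cderiveD; [|exact: csmoothZ|exact: csmoothZ].
  by rewrite !cderiveZ // !dm; ring.
transitivity (alt_sum (fun a => alt_sum (fun h z =>
    (- (s - 1)) * (dcrd 0 x a * (dcrd 1 x h * u x z)) +
    ((-1) * (dcrd 2 x a * (dcrd 3 x h * u x z)) +
     (-1) * (dcrd 4 x a * (dcrd 5 x h * u x z))))) v).
  apply: eq_bigr => i _; congr (_ * _); apply: eq_bigr => j _; congr (_ * _).
  by rewrite dom; ring.
have pl n m c : alt_sum (fun a => alt_sum (fun h z =>
    c * (dcrd n x a * (dcrd m x h * u x z)))) v =
    c * ext1 (dcrd n) (ext1 (dcrd m) u) x v.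
  rewrite mulr_sumr; apply: eq_bigr => i _; rewrite mulrCA; congr (_ * _).
  rewrite [ext1 (dcrd m) u x _]/ext1 /alt_sum !mulr_sumr.
  by apply: eq_bigr => j _; ring.
have aD (F H : V -> V -> ('I_k -> V) -> C) :
    alt_sum (fun a => alt_sum (fun h z => F a h z + H a h z)) v =
    alt_sum (fun a => alt_sum (F a)) v + alt_sum (fun a => alt_sum (H a)) v.
  rewrite -big_split /=; apply: eq_bigr => i _; rewrite -mulrDr; congr (_ * _).
  by rewrite -big_split /=; apply: eq_bigr => j _; rewrite -mulrDr.
rewrite !aD !pl /diag /plane; ring.
Qed.

End GauduchonMetric.

(** * The Gauduchon conditions *)

Section Gauduchon.
Variables (R : realType) (V : normedModType R) (K : coord_system V).
Local Notation C := R[i].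
Local Notation crd := (crd K).
Local Notation cplx := (cplx K).
Local Notation coframe := (coframe K).
Local Notation one := (@unit_form R V).
Local Notation vert_form := (vert_form K).
Local Notation plane := (plane K).
Local Notation vertical := (vertical K).
Local Notation diag := (diag K).
Local Notation half_i := (half_i R).

Local Notation Omega := (fundamental_form cplx (metric K)).

Lemma fundamental_formE :
  Omega = fun x v => diag 2 1 1 one x v + half_i * vertical one x v.
Proof.
apply/funext => x; apply/funext => v.
rewrite /diag /plane /vertical !ext1_pair /fundamental_form.
set a := v ord0; set b := v ord_max; rewrite /metric /cplx ltransK /metric0 !crd_of_crd //=.
have E n z : (n < 6)%N -> crd n (ltrans K (- x) z) = crd n z.
  by move=> n6; rewrite crd_ltrans_id.
rewrite !(E 0%N) // !(E 1%N) // !(E 2%N) // !(E 3%N) // !(E 4%N) // !(E 5%N) //.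
rewrite !vert_formE /dcrd /conj_sign /=.
rewrite -!/(coframe _ x _).
move: (coframe 6 x a) (coframe 7 x a) (coframe 6 x b) (coframe 7 x b) => a6 a7 b6 b7.
move: (crd 0 a) (crd 1 a) (crd 2 a) (crd 3 a) (crd 4 a) (crd 5 a) => a0 a1 a2 a3 a4 a5.
move: (crd 0 b) (crd 1 b) (crd 2 b) (crd 3 b) (crd 4 b) (crd 5 b) => b0 b1 b2 b3 b4 b5.
by apply/eqP; rewrite eq_complex /=; apply/andP; split; apply/eqP; field.
Qed.

Lemma Omega_wedge k (u : dform V k) : alt_form u ->
  wedge Omega u = fun x v => diag 2 1 1 u x v + half_i * vertical u x v.
Proof.
move=> au; have W e f : wedge (ext1 e (ext1 f one)) u = ext1 e (ext1 f u).
  rewrite (@wedge_ext1 R V e 1 k (ext1 f one) u).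
  by rewrite (@wedge_ext1 R V f 0 k one u) wedge_unit_form.
rewrite fundamental_formE wedgeDl wedgeZl /vertical W /diag.
by rewrite !wedgeDl !wedgeZl /plane !W.
Qed.

(* Exterior multiplication by [- d (vert_form b)]. *)
Local Notation curv b := (diag (conj_sign R (~~ b) - 1) 1 1).

Lemma smooth_vertical k (u : dform V k) : smooth_form u -> smooth_form (vertical u).
Proof.
move=> su; apply: smooth_form_ext1; first exact: smooth_vert_form.
by apply: smooth_form_ext1 su; exact: smooth_vert_form.
Qed.

Lemma ext_d_vertical k (s : dform V k) : smooth_form s -> ext_d s = (fun _ _ => 0) ->
  ext_d (vertical s) = fun x v =>
  (-1) * curv true (ext1 (vert_form false) s) x v + ext1 (vert_form true) (curv false s) x v.
Proof.
move=> ss s0; rewrite /vertical ext_d_vert_form; last first.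
  by apply: smooth_form_ext1 => //; exact: smooth_vert_form.
rewrite ext_d_vert_form // s0 ext1_0; apply/funext => x; apply/funext => v.
have -> : (fun x v => - curv false s x v - 0) = (fun x v => - curv false s x v).
  by apply/funext => y; apply/funext => z; rewrite subr0.
by rewrite ext1N opprK mulN1r.
Qed.

Lemma has_type_vertical (p k : nat) (u : dform V k) :
  has_type cplx p u -> has_type cplx p.+1 (vertical u).
Proof.
move=> pu; apply: (@has_type_ext1 _ _ _ true) => [x h|]; first exact: vert_form_cplx.
by apply: (@has_type_ext1 _ _ _ false) => // x h; exact: vert_form_cplx.
Qed.

(** [d (om /\ om^- /\ s)] has a summand in which [om] is replaced by its
    differential, which has one more antilinear slot and is picked by [delbar], and
    one in which [om^-] is; [del] then replaces the other factor. *)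
Lemma del_delbar_vertical (q k : nat) c (B : dform V k.+2) (s : dform V k) :
  smooth_form B -> smooth_form s ->
  ext_d B = (fun _ _ => 0) -> ext_d s = (fun _ _ => 0) ->
  has_type cplx q.+1 B -> has_type cplx q s -> (q <= k)%N ->
  del cplx (delbar cplx (fun x v => B x v + c * vertical s x v)) =
  fun x v => c * curv true (curv false s) x v.
Proof.
move=> sB ss B0 s0 tB ts qk.
have sver := smooth_vertical ss.
have som : smooth_form (ext1 (vert_form false) s).
  by apply: smooth_form_ext1 => //; exact: smooth_vert_form.
have tom : has_type cplx q (ext1 (vert_form false) s).
  by apply: (@has_type_ext1 _ _ _ false) => // x h; exact: vert_form_cplx.
have tF : has_type cplx q.+1 (fun x v => B x v + c * vertical s x v).
  by apply: has_typeD => //; apply: has_typeZ; exact: has_type_vertical.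
have dF : ext_d (fun x v => B x v + c * vertical s x v) = fun x v => c *
    ((-1) * curv true (ext1 (vert_form false) s) x v + ext1 (vert_form true) (curv false s) x v).
  rewrite ext_dD //; last by move=> v; apply: csmoothZ.
  rewrite ext_dZ // B0 ext_d_vertical //.
  by apply/funext => x; apply/funext => v; rewrite add0r.
have tP : has_type cplx q.+1 (curv true (ext1 (vert_form false) s)) by apply: diag_has_type.
have tQ : has_type cplx q.+2 (ext1 (vert_form true) (curv false s)).
  apply: (@has_type_ext1 _ _ _ true) => [x h|]; first exact: vert_form_cplx.
  exact: diag_has_type.
have -> : delbar cplx (fun x v => B x v + c * vertical s x v) =
    fun x v => (- c) * curv true (ext1 (vert_form false) s) x v.
  rewrite (delbar_typeE tF) ?dF; last by rewrite ltnS (leq_trans qk).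
  rewrite bidegreeZ bidegreeD bidegreeZ tP tQ eqxx (ltn_eqF (ltnSn _)).
  by apply/funext => x; apply/funext => v; rewrite addr0 mulN1r mulrN mulNr.
rewrite (@del_typeE _ _ _ q.+1); [|exact: has_typeZ|by rewrite ltnS !leqW].
rewrite ext_dZ; last exact: smooth_diag.
rewrite ext_d_diag // ext_d_vert_form // s0 ext1_0.
have -> : (fun x v => - curv false s x v - 0) = (fun x v => (-1) * curv false s x v).
  by apply/funext => y; apply/funext => z; rewrite subr0 mulN1r.
rewrite diagZ bidegreeZ bidegreeZ.
have -> : bidegree cplx q.+2 (curv true (curv false s)) = curv true (curv false s).
  by rewrite (diag_has_type _ _ _ (diag_has_type _ _ _ ts)) eqxx.
by apply/funext => x; apply/funext => v; rewrite mulN1r mulrNN.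
Qed.

Lemma verticalD k (u w : dform V k) :
  vertical (fun x v => u x v + w x v) = fun x v => vertical u x v + vertical w x v.
Proof. by rewrite /vertical !ext1D. Qed.

Lemma verticalZ k c (u : dform V k) :
  vertical (fun x v => c * u x v) = fun x v => c * vertical u x v.
Proof. by rewrite /vertical !ext1Z. Qed.

Lemma form_exp_Omega1 : form_exp Omega 1 = fun x v => diag 2 1 1 one x v + half_i * vertical one x v.
Proof. exact: Omega_wedge (@unit_form_alt R V). Qed.

(** [om /\ om^-] has square zero, so that the powers of [Omega] are linear in it. *)
Lemma form_exp_Omega2 : form_exp Omega 2 = fun x v =>
  diag 2 1 1 (diag 2 1 1 one) x v + (2 * half_i) * vertical (diag 2 1 1 one) x v.
Proof.
have a1 := @form_exp_alt R V Omega 1.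
transitivity (wedge Omega (form_exp Omega 1) : dform V 4); first by [].
rewrite (Omega_wedge a1) form_exp_Omega1 diagD diagZ.
have -> : vertical (fun x v => diag 2 1 1 one x v + half_i * vertical one x v) =
    fun x v => vertical (diag 2 1 1 one) x v.
  rewrite verticalD verticalZ vertical_id.
  by apply/funext => x; apply/funext => v; rewrite mulr0 addr0.
rewrite diag_vertical; apply/funext => x; apply/funext => v; ring.
Qed.

(** With [p = i - 1] the permanent is [2 (p + p^-) + 4 = 0]. *)
Lemma permanent0 k (u : dform V k) : curv true (curv false (diag 2 1 1 u)) = fun _ _ => 0.
Proof.
rewrite diag_permanent; apply/funext => x; apply/funext => v.
set t := plane 0 _ x v; rewrite /conj_sign /=; ring.
Qed.

Lemma ext_d_one : ext_d one = (fun _ _ => 0).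
Proof.
apply/funext => x; apply/funext => v.
by rewrite /ext_d big1 // => i _; rewrite cderive_cst mulr0.
Qed.

Lemma wedge0l k l (w : dform V l) :
  wedge (fun _ _ => 0 : C) w = (fun _ _ => 0) :> dform V (k + l).
Proof.
apply/funext => x; apply/funext => v; rewrite /wedge big1 ?mulr0 // => s _.
by rewrite mulr0 mul0r.
Qed.

Let diag_closed a b c k (u : dform V k) : smooth_form u ->
  ext_d u = (fun _ _ => 0) -> ext_d (diag a b c u) = (fun _ _ => 0).
Proof. by move=> su u0; rewrite ext_d_diag // u0 diag_0. Qed.

(** [del delbar Omega] is proportional to [tau /\ tau^-]; multiplied by [Omega^2],
    whose base part is [s^2] and whose vertical part is proportional to
    [om /\ om^- /\ s], it has a factor [tau /\ tau^- /\ s = 0] in both terms. *)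
Lemma metric_gauduchon1 : gauduchon 4 1 cplx (metric K).
Proof.
rewrite /gauduchon => x v.
have s1 := @smooth_unit_form R V; have t1 := @has_type_one R V cplx.
rewrite form_exp_Omega1 (@del_delbar_vertical 0); last by [].
- rewrite wedgeZl.
  have W (w : dform V 4) : alt_form w -> wedge (curv true (curv false one)) w = curv true (curv false w).
    have E (j k : nat) (u : dform V k) : wedge (plane j u : dform V k.+2) w = plane j (wedge u w).
      rewrite /plane (@wedge_ext1 R V _ k.+1 4).
      by rewrite (@wedge_ext1 R V _ k 4).
    have L a b c k (u : dform V k) : wedge (diag a b c u : dform V k.+2) w = diag a b c (wedge u w).
      by rewrite {1}diag_fun !wedgeDl !wedgeZl !E.
    by move=> aw; rewrite (L _ _ _ 2) (L _ _ _ 0) wedge_unit_form.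
  rewrite (W _ (@form_exp_alt R V Omega 2)) form_exp_Omega2.
  have D a b c d k (X Y : dform V k) : diag a b c (fun x v => X x v + d * Y x v) =
      fun x v => diag a b c X x v + d * diag a b c Y x v by rewrite diagD diagZ.
  rewrite (D _ _ _ _ _ (diag 2 1 1 (diag 2 1 1 one)) (vertical (diag 2 1 1 one))).
  rewrite (D _ _ _ _ _ (curv false (diag 2 1 1 (diag 2 1 1 one)))
    (curv false (vertical (diag 2 1 1 one)))).
  rewrite permanent0 (diag_vertical _ _ _ _ (diag 2 1 1 one)).
  rewrite (diag_vertical _ _ _ _ (curv false (diag 2 1 1 one))) permanent0.
  rewrite vertical_0.
  by rewrite mulr0 addr0 mulr0.
- exact: smooth_diag.
- exact: s1.
- exact: diag_closed s1 ext_d_one.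
- exact: ext_d_one.
- exact: diag_has_type.
- exact: t1.
Qed.

Lemma metric_gauduchon2 : gauduchon 4 2 cplx (metric K).
Proof.
rewrite /gauduchon => x v.
have s1 := @smooth_unit_form R V; have t1 := @has_type_one R V cplx.
have s2 : smooth_form (diag 2 1 1 one) by exact: smooth_diag.
have c2 := diag_closed 2 1 1 s1 ext_d_one.
have t2 := diag_has_type 2 1 1 t1.
rewrite form_exp_Omega2 (@del_delbar_vertical 1); last by [].
- rewrite permanent0.
  have -> : (fun (x : V) (v : 'I_6 -> V) => 2 * half_i * 0) = fun _ _ => 0.
    by apply/funext => y; apply/funext => z; rewrite mulr0.
  by rewrite wedge0l.
- exact: smooth_diag.
- exact: s2.
- exact: diag_closed s2 c2.
- exact: c2.
- exact: diag_has_type.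
- exact: t2.
Qed.

End Gauduchon.

(** * Divergences on a box *)

Section MeanDivergence.
Variables (R : realType) (V : normedModType R).
Local Notation smooth := (@smooth_on R V _ setT).

Lemma is_derive_line (F : V -> R^o) p e (s : R) : smooth F ->
  is_derive s 1 (fun s : R => F (p + s *: e) : R) ('D_e F (p + s *: e)).
Proof.
move=> sF; have E : (fun h : R => h^-1 *: (((fun s : R => F (p + s *: e)) \o shift s) (h *: 1) -
      F (p + s *: e))) =
   (fun h => h^-1 *: ((F \o shift (p + s *: e)) (h *: e) - F (p + s *: e))).
  apply/funext => h /=; rewrite [h *: 1]mulr1.
  by congr (_ *: (F _ - _)); rewrite scalerDl addrCA.
by split; [rewrite /derivable E; exact: smooth_derivable|rewrite /derive E].
Qed.

Lemma smooth_line_MVT (F : V -> R^o) p e (d : R) : smooth F -> 0 <= d ->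
  exists2 c, 0 <= c <= d & F (p + d *: e) - F p = 'D_e F (p + c *: e) * d.
Proof.
move=> sF d0.
have cont : {within `[0, d], continuous (fun s : R => F (p + s *: e) : R)}.
  apply: derivable_within_continuous => s _.
  by have [] := is_derive_line p e s sF.
have [c cd] := MVT_segment d0 (fun s _ => is_derive_line p e s sF) cont.
by rewrite scale0r addr0 subr0 => H; exists c => //; move: cd; rewrite in_itv.
Qed.

(** The derivative at [p] is replaced by the difference quotient, with an error
    bounded by the second derivative. *)
Lemma smooth_increment (F : V -> R^o) p e (d K : R) : smooth F -> 0 <= d ->
  (forall s, 0 <= s <= d -> `|'D_e ('D_e F) (p + s *: e)| <= K) ->
  d * ('D_e F p - K * d) <= F (p + d *: e) - F p.
Proof.
move=> sF d0 hK; have [c /andP[c0 cd] ->] := smooth_line_MVT p e sF d0.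
have [c' /andP[c'0 c'c] E] := smooth_line_MVT p e (smooth_derive e sF) c0.
rewrite mulrC ler_wpM2r //.
have -> : 'D_e F (p + c *: e) = 'D_e F p + 'D_e ('D_e F) (p + c' *: e) * c.
  by rewrite -E [RHS]addrC subrK.
rewrite lerD2l lerNl -mulNr.
have K' : `|'D_e ('D_e F) (p + c' *: e)| <= K.
  by apply: hK; rewrite c'0 (le_trans c'c).
have K0 : 0 <= K by rewrite (le_trans _ K').
apply: le_trans (ler_wpM2l K0 cd); apply: ler_wpM2r => //.
by rewrite (le_trans _ K') // -normrN ler_norm.
Qed.

Variables (m : nat) (e : 'I_m -> V).
Definition lin_comb (t : 'I_m -> R) : V := \sum_(i < m) t i *: e i.

Lemma smooth_bounded_box (F : V -> R^o) (T : 'I_m -> R) : smooth F ->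
  (forall i, 0 <= T i) ->
  exists K, forall t, (forall i, 0 <= t i <= T i) -> `|F (lin_comb t)| <= K.
Proof.
move=> sF T0; pose A := [set v : 'rV[R]_m | forall i, [set` `[0, T i]] (v ord0 i)].
have cA : compact A by apply: (@rV_compact R m (fun i => [set` `[0, T i]])) => i; exact: segment_compact.
have A0 : A !=set0 by exists 0 => i /=; rewrite mxE in_itv /= lexx T0.
have pc : continuous (fun v : 'rV[R]_m => lin_comb (v ord0)).
  move=> v; apply: differentiable_continuous.
  have -> : (fun v : 'rV[R]_m => lin_comb (v ord0)) =
      \sum_(i < m) (fun v : 'rV[R]_m => v ord0 i *: e i).
    by apply/funext => u; rewrite fct_sumE.
  apply: differentiable_sum => i; apply: differentiableZl.
  exact: differentiable_coord.
have cf : {within A, continuous (fun v : 'rV[R]_m => `|F (lin_comb (v ord0))|)}.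
  apply: continuous_subspaceT => v; apply: continuous_comp.
    by apply: continuous_comp; [exact: pc|exact: smooth_cont].
  exact: norm_continuous.
have [c _ maxc] := compact_EVT_max A0 cA cf.
exists `|F (lin_comb (c ord0))| => t tT.
have -> : lin_comb t = lin_comb ((\row_i t i : 'rV[R]_m) ord0).
  by apply: eq_bigr => i _; rewrite mxE.
by apply: maxc; rewrite inE => i /=; rewrite mxE in_itv /=; exact: tT.
Qed.

(** Every grid point is reached [n] times when one of its coordinates is
    overwritten, which sorts the points into lines parallel to an axis. *)
Lemma sum_slot n (i : 'I_m) (H : {ffun 'I_m -> 'I_n} -> R) :
  \sum_(k : {ffun 'I_m -> 'I_n}) \sum_(a < n) H [ffun j => if j == i then a else k j] =
  n%:R * \sum_k H k.
Proof.
rewrite pair_big /=.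
pose sw (p : {ffun 'I_m -> 'I_n} * 'I_n) : {ffun 'I_m -> 'I_n} * 'I_n :=
  ([ffun j => if j == i then p.2 else p.1 j], p.1 i).
have swK : involutive sw.
  move=> [k a]; rewrite /sw /= ffunE eqxx; congr (_, _); apply/ffunP => j.
  by rewrite !ffunE; case: eqP => // ->.
rewrite (reindex_inj (inv_inj swK)) /=.
under eq_bigr => p _.
  have -> : [ffun j => if j == i then p.1 i
      else [ffun j0 => if j0 == i then p.2 else p.1 j0] j] = p.1.
    by apply/ffunP => j; rewrite !ffunE; case: eqP => // ->.
  over.
rewrite -(pair_big xpredT xpredT (fun k a => H k)) /= mulr_sumr.
by apply: eq_bigr => k _; rewrite sumr_const card_ord mulr_natl.
Qed.

(** The divergence theorem on a box, with the flux through the faces estimated by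
    the sup norm [M i].  The integral is replaced by a sum over a grid with [n]
    points in each direction, whose error is of order [1 / n] because the second
    derivatives are bounded on the box; [n] is then large. *)
Lemma mean_divergence (F : 'I_m -> V -> R^o) (T M : 'I_m -> R) (c : R) :
  (forall i, smooth (F i)) -> (forall i, 0 < T i) ->
  (forall i t, (forall j, 0 <= t j <= T j) -> `|F i (lin_comb t)| <= M i) ->
  (forall t, (forall j, 0 <= t j <= T j) -> c <= \sum_i 'D_(e i) (F i) (lin_comb t)) ->
  c <= \sum_i 2 * M i / T i.
Proof.
move=> sF T0 FM cdiv.
have [K hK] : exists K : R, forall i t, (forall j, 0 <= t j <= T j) ->
    `|'D_(e i) ('D_(e i) (F i)) (lin_comb t)| <= K.
  have B i := @smooth_bounded_box ('D_(e i) ('D_(e i) (F i))) T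
    (smooth_derive _ (smooth_derive _ (sF i))) (fun j => ltW (T0 j)).
  pose Ki i := sval (cid (B i)); exists (\sum_i `|Ki i|) => i t tT.
  apply: (le_trans (svalP (cid (B i)) t tT)); rewrite (bigD1 i) //=.
  by rewrite (le_trans (ler_norm _)) // lerDl sumr_ge0.
have main n : (0 < n)%N -> c - (K * \sum_i T i) / n%:R <= \sum_i 2 * M i / T i.
  move=> n0; have nR : 0 < n%:R :> R by rewrite ltr0n.
  (* the mesh, and the grid point with index [k] *)
  pose d i := T i / n%:R.
  have d0 i : 0 < d i by rewrite divr_gt0.
  pose q (k : {ffun 'I_m -> 'I_n}) : 'I_m -> R := fun i => (k i)%:R * d i.
  have qs (k : {ffun 'I_m -> 'I_n}) i s : 0 <= s <= d i ->
      forall j, 0 <= q k j + (if j == i then s else 0) <= T j.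
    move=> /andP[s0 sd] j; have kd : 0 <= q k j by rewrite mulr_ge0 // ltW.
    have kT : q k j + d j <= T j.
      rewrite /q -[X in _ + X]mul1r -mulrDl natr1 -[leRHS](divfK (lt0r_neq0 nR)).
      rewrite [leRHS]mulrC ler_wpM2r //; first exact: ltW.
      by rewrite ler_nat ltn_ord.
    case: eqP => [ji|_]; last by rewrite addr0 kd /= (le_trans _ kT) // lerDl ltW.
    by rewrite addr_ge0 //= (le_trans _ kT) // lerD2l ji.
  have ptS (t : 'I_m -> R) i s : lin_comb (fun j => t j + (if j == i then s else 0)) =
      lin_comb t + s *: e i.
    rewrite /lin_comb; under eq_bigr do rewrite scalerDl.
    rewrite big_split /=; congr (_ + _); rewrite (bigD1 i) //= eqxx big1 ?addr0 //.
    by move=> j /negbTE ->; rewrite scale0r.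
  pose N := (#|{: {ffun 'I_m -> 'I_n}}|%:R : R).
  (* Along each line parallel to [e i] the increments telescope. *)
  have slot i : \sum_(k : {ffun 'I_m -> 'I_n}) (F i (lin_comb (q k) + d i *: e i) - F i (lin_comb (q k))) <=
      N * (2 * M i / n%:R).
    rewrite -(ler_pM2l nR).
    have -> : n%:R * (N * (2 * M i / n%:R)) = N * (2 * M i) by field; rewrite gt_eqF.
    rewrite -(sum_slot i) [N * _]mulr_natl -sumr_const.
    apply: ler_sum => k _; pose h a := F i (lin_comb (fun j => if j == i then a%:R * d j else q k j)).
    rewrite (eq_bigr (fun a : 'I_n => h a.+1 - h a)) => [|a _]; last first.
      have -> : lin_comb (q [ffun j => if j == i then a else k j]) =
          lin_comb (fun j => if j == i then a%:R * d j else q k j).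
        by apply: eq_bigr => j _; rewrite /q ffunE; case: eqP.
      congr (F i _ - _); rewrite -ptS; apply: eq_bigr => j _.
      by case: eqP => [->|_]; rewrite ?addr0 // -natr1 mulrDl mul1r.
    rewrite -(big_mkord xpredT (fun a => h a.+1 - h a)) telescope_sumr //.
    have hM a : (a <= n)%N -> `|h a| <= M i.
      move=> an; apply: FM => j; case: eqP => [->|_].
        have di := ltW (d0 i).
        rewrite mulr_ge0 //= -[leRHS](divfK (lt0r_neq0 nR)) [leRHS]mulrC.
        by rewrite ler_wpM2r ?ler_nat.
      by have := qs k j 0; rewrite lexx (ltW (d0 j)) => /(_ isT j); rewrite eqxx addr0.
    apply: le_trans (ler_norm _) _; apply: le_trans (ler_normB _ _) _.
    by rewrite mulr2n mulrDl mul1r lerD ?hM.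
  have low i : \sum_(k : {ffun 'I_m -> 'I_n}) ('D_(e i) (F i) (lin_comb (q k)) - K * d i) <= N * (2 * M i / T i).
    rewrite -(ler_pM2l (d0 i)).
    have -> : d i * (N * (2 * M i / T i)) = N * (2 * M i / n%:R).
      by rewrite /d; field; rewrite !gt_eqF.
    apply: le_trans (slot i); rewrite mulr_sumr; apply: ler_sum => k _.
    apply: smooth_increment => // [|s sd]; first exact: ltW.
    by rewrite -ptS; apply: hK; exact: qs.
  have N0 : 0 < N.
    by rewrite ltr0n; apply/card_gt0P; exists [ffun=> Ordinal n0].
  rewrite -(ler_pM2l N0) [leRHS]mulr_sumr.
  apply: le_trans (ler_sum _ (fun i _ => low i)).
  rewrite exchange_big /= [N * _]mulr_natl -sumr_const; apply: ler_sum => k _.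
  rewrite big_split /= sumrN -mulr_sumr -mulr_suml mulrA lerD2r.
  apply: cdiv => j; have := qs k j 0; rewrite lexx (ltW (d0 j)) => /(_ isT j).
  by rewrite eqxx addr0.
rewrite leNgt; apply/negP => cS; set S := \sum_i _ in cS main.
pose L := K * \sum_i T i; have gap : 0 < c - S by rewrite subr_gt0.
pose n := (Num.truncn (`|L| / (c - S))).+1.
have /main : (0 < n)%N by [].
rewrite -/L; have nR : 0 < n%:R :> R by rewrite ltr0n.
apply/negP; rewrite -ltNge ltrBrDl -ltrBrDr ltr_pdivrMr //.
rewrite (le_lt_trans (ler_norm _)) // mulrC -ltr_pdivrMr //.
exact: truncnS_gt.
Qed.

End MeanDivergence.

(** * Divergences on the compact quotient *)

Section FrameDivergence.
Variables (R : realType) (V : normedModType R) (K : coord_system V).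
Local Notation crd := (crd K).
Local Notation bas := (bas K).
Local Notation ltrans := (ltrans K).
Local Notation smooth := (@smooth_on R V _ setT).

Definition frame n (y : V) : V := ltrans y (bas n).

Definition gamma_invariant (Gam : set V) (f : V -> R^o) : Prop :=
  forall a x, Gam a -> f (gmul K a x) = f x.

(** The form in which compactness of the quotient enters: invariant continuous
    functions attain their minimum. *)
Definition cocompact (Gam : set V) : Prop := forall f : V -> R^o,
  continuous f -> gamma_invariant Gam f -> exists x0, forall x, f x0 <= f x.

Lemma frameE n y : (n < 8)%N -> frame n y = bas n +
  (crd 0 y * (n == 1%N)%:R *: bas 6 +
  (crd 2 y * (n == 3%N)%:R + crd 4 y * (n == 5%N)%:R) *: bas 7).
Proof.
move=> n8; rewrite /frame ltransE /= !crd_bas //.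
by rewrite !(eq_sym n).
Qed.

Lemma cocompact_bounded (Gam : set V) (f : V -> R^o) : cocompact Gam ->
  continuous f -> gamma_invariant Gam f -> exists C : R, forall x, `|f x| <= C.
Proof.
move=> cG cf gf; have [x0 m0] := cG f cf gf.
have [x1 m1] : exists x1, forall x, - f x1 <= - f x.
  apply: cG => [x|a x Ga]; first by apply: (@continuousN _ R^o); exact: cf.
  by rewrite gf.
exists (`|f x0| + `|f x1|) => x; rewrite ler_norml; apply/andP.
have := ler_norm (f x1); have := ler_norm (- f x0); rewrite normrN.
have := normr_ge0 (f x0); have := normr_ge0 (f x1).
by move: (m0 x) (m1 x); rewrite lerN2 => *; split; lra.
Qed.

Lemma derive_frame n (f : V -> R^o) y : (n < 8)%N -> smooth f ->
  'D_(frame n y) f y = 'D_(bas n) f y + crd 0 y * (n == 1%N)%:R * 'D_(bas 6) f y +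
    (crd 2 y * (n == 3%N)%:R + crd 4 y * (n == 5%N)%:R) * 'D_(bas 7) f y.
Proof.
move=> n8 sf; rewrite frameE // !deriveDr // !deriveZr //.
by rewrite addrA.
Qed.

(** In the coordinate frame the field [\sum_n f_n E_n] has the components [F] below,
    with the same divergence since the factors [x_j] do not involve the central
    coordinates.  Its flux through the boundary of a large box is of lower order
    than the volume, whereas [u] is bounded below by its positive minimum. *)
Lemma frame_divergence (Gam : set V) (f : nat -> V -> R^o) (u : V -> R^o) :
  cocompact Gam -> (forall n, (n < 8)%N -> smooth (f n)) ->
  (forall n, (n < 8)%N -> gamma_invariant Gam (f n)) ->
  continuous u -> gamma_invariant Gam u ->
  (forall x, u x = \sum_(n < 8) 'D_(frame n x) (f n) x) ->
  ~ (forall x, 0 < u x).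
Proof.
move=> cG sf gf cu gu uE u0; have [x0 m0] := cG u cu gu.
pose c := u x0; have c0 : 0 < c by exact: u0.
have [C C0 fC] : exists2 C : R, 0 < C & forall n x, (n < 8)%N -> `|f n x| <= C.
  have B n : exists C : R, (n < 8)%N -> forall x, `|f n x| <= C.
    case: (ltnP n 8) => [n8|_]; last by exists 0.
    by have [C HC] := cocompact_bounded cG (smooth_cont (sf n n8)) (gf n n8); exists C.
  pose D n := sval (cid (B n)).
  exists (1 + \sum_(n < 8) `|D n|) => [|n x n8].
    by rewrite ltr_wpDr // sumr_ge0.
  apply: le_trans (svalP (cid (B n)) n8 x) _; rewrite -/(D n).
  rewrite (bigD1 (Ordinal n8)) //= addrCA.
  by rewrite (le_trans (ler_norm _)) // lerDl addr_ge0 // sumr_ge0.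
pose F (i : 'I_8) : V -> R^o := match val i with
  | 6 => fun y => f 6 y + crd 0 y * f 1 y
  | 7 => fun y => f 7 y + (crd 2 y * f 3 y + crd 4 y * f 5 y)
  | n => f n end.
have sM n m : (m < 8)%N -> smooth (fun y => crd n y * f m y : R^o).
  by move=> m8; apply: smoothM; [exact: smooth_crd|exact: sf].
have sF i : smooth (F i).
  rewrite /F; case: i => n n8 /=; do 6?[case: n n8 => [|n] n8; first exact: sf].
  case: n n8 => [|n] n8; first by apply: smoothD; [exact: sf|exact: sM].
  case: n n8 => [|//] n8; apply: smoothD; first exact: sf.
  by apply: smoothD; exact: sM.
have divF y : \sum_(i < 8) 'D_(bas i) (F i) y = u y.
  have dM n m k : (m < 8)%N -> 'D_(bas k) (fun y => crd n y * f m y : R^o) y =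
      crd n (bas k) * f m y + crd n y * 'D_(bas k) (f m) y.
    move=> m8; rewrite derive_mul ?derive_crd //; first exact: smooth_crd.
    exact: sf.
  rewrite uE !big_ord_recl !big_ord0 /= /F /=.
  rewrite !derive_frame //; try exact: sf.
  rewrite derive_add ?dM //; [|exact: sf|exact: sM].
  rewrite derive_add ?derive_add ?dM //; try exact: sM; try exact: sf; last first.
    by apply: smoothD; exact: sM.
  rewrite !crd_bas //=.
  repeat match goal with |- context [derive ?g ?x ?v] =>
    let d := fresh "d" in move: (derive g x v : R) => d end.
  move: (crd 0 y : R) (crd 2 y : R) (crd 4 y : R) => c1 c2 c3.
  move: (f 1 y : R) (f 3 y : R) (f 5 y : R) => f1 f3 f5.
  by ring.
(* The central components of [F] grow like [t], hence the sides [t ^+ 2]; each of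
   the eight directions then contributes [2 C / t] or [6 C / t], in total
   [24 C / t < c]. *)
pose t := 1 + 24 * C / c; have t0 : 0 < t by rewrite ltr_wpDr // divr_ge0 ?mulr_ge0 // ltW.
have t1 : 1 <= t by rewrite lerDl divr_ge0 ?mulr_ge0 // ltW.
pose T (i : 'I_8) : R := if (i < 6)%N then t else t ^+ 2.
pose M (i : 'I_8) : R := if (i < 6)%N then C else 3 * C * t.
have T0 i : 0 < T i by rewrite /T; case: ifP => _ //; rewrite exprn_gt0.
have ptE s (i : 'I_8) : crd i (lin_comb (fun i : 'I_8 => bas i) s) = s i.
  rewrite /lin_comb raddf_sum /= (bigD1 i) //= big1 => [|j ji]; rewrite crdZ crd_bas //.
    by rewrite eqxx mulr1 addr0.
  by rewrite eq_sym -val_eqE in ji *; rewrite (negbTE ji) mulr0.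
have FM i s : (forall j, 0 <= s j <= T j) -> `|F i (lin_comb (fun i : 'I_8 => bas i) s)| <= M i.
  move=> sT; set y := lin_comb _ s.
  have yb n : (n < 6)%N -> `|crd n y| <= t.
    move=> n6; have n8 : (n < 8)%N by rewrite (leq_trans n6).
    have := sT (Ordinal n8); rewrite -(ptE s (Ordinal n8)) /T /= n6 => /andP[p q].
    by rewrite ger0_norm.
  have Mb n m : (n < 6)%N -> (m < 8)%N -> `|crd n y * f m y| <= t * C.
    by move=> n6 m8; rewrite normrM ler_pM // ?yb ?fC.
  have Ct : C <= t * C by rewrite ler_peMl // ltW.
  rewrite /F /M; case: i => n n8 /=; do 6?[case: n n8 => [|n] n8; first exact: fC].
  have C1 : 0 <= t * C by rewrite mulr_ge0 // ltW.
  case: n n8 => [|n] n8.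
    apply: le_trans (ler_normD _ _) _; have := fC 6%N y isT.
    by have := Mb 0%N 1%N isT isT; lra.
  case: n n8 => [|//] n8; apply: le_trans (ler_normD _ _) _.
  have := ler_normD (crd 2 y * f 3 y) (crd 4 y * f 5 y); have := fC 7%N y isT.
  by have := Mb 2%N 3%N isT isT; have := Mb 4%N 5%N isT isT; lra.
have := @mean_divergence R V 8 (fun i => bas i) F T M c sF T0 FM.
have cd s : (forall j, 0 <= s j <= T j) ->
    c <= \sum_(i < 8) 'D_(bas i) (F i) (lin_comb (fun i : 'I_8 => bas i) s).
  by move=> _; rewrite divF; exact: m0.
move=> /(_ cd); apply/negP; rewrite -ltNge !big_ord_recl big_ord0 /T /M /=.
have -> : 2 * (3 * C * t) / t ^+ 2 = 6 * C / t by field; rewrite gt_eqF.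
have e : c * t = c + 24 * C by rewrite /t mulrDr mulr1; congr (_ + _); field; rewrite gt_eqF.
rewrite -(ltr_pM2r t0) e.
set S := (X in X < _); have -> : S = 24 * C by rewrite /S; field; rewrite gt_eqF.
by rewrite ltrDr.
Qed.

End FrameDivergence.

(** * Forms on the left-invariant frame *)

Section Vectors.
Variables (R : realType) (V : normedModType R).
Local Notation C := R[i].

(** The arguments of a form as a list, so that deleting or replacing one of them
    computes. *)
Definition args (k : nat) (s : seq V) : 'I_k -> V := fun i => s`_i.
Arguments args k s : clear implicits.

Definition delete (s : seq V) (i : nat) : seq V := take i s ++ drop i.+1 s.

Lemma args_lift k (s : seq V) (i : 'I_k.+1) : size s = k.+1 ->
  (fun j => args k.+1 s (lift i j)) = args k (delete s i).
Proof.
move=> sk; apply/funext => j; rewrite /args /delete nth_cat size_take sk ltn_ord /= /bump.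
case: ltnP => ij; first by rewrite add0n nth_take.
by rewrite nth_drop add1n addSn subnKC.
Qed.

Lemma args_map k (f : {linear V -> V}) s :
  (fun j => f (args k s j)) = args k (map f s).
Proof.
apply/funext => j; rewrite /args; case: (ltnP j (size s)) => js.
  by rewrite (nth_map 0).
by rewrite !nth_default ?size_map // linear0.
Qed.

Lemma args_update k (s : seq V) (j : 'I_k) a :
  update (args k s) j a = args k (set_nth 0 s j a).
Proof.
apply/funext => i; rewrite /update /args nth_set_nth /=.
by rewrite -val_eqE.
Qed.

Lemma args_insert k a s : insert ord0 a (args k s) = args k.+1 (a :: s).
Proof.
apply/funext => i; case: (unliftP ord0 i) => [j|] ->.
  by rewrite insert_lift.
by rewrite insert_id.
Qed.

Lemma args_swap k (s : seq V) (i j : 'I_k) f : alternates f -> i != j ->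
  f (args k (set_nth 0 (set_nth 0 s i s`_j) j s`_i)) = - f (args k s) :> C.
Proof.
move=> fa ij; have := fa (args k s) (tperm i j); rewrite odd_tperm ij expr1 mulN1r => <-.
congr f; apply/funext => l; rewrite /args !nth_set_nth /=.
rewrite -!/(nat_of_ord _) !val_eqE nth_set_nth /= val_eqE.
case: tpermP => [->|->|/eqP li /eqP lj]; last by rewrite (negbTE li) (negbTE lj).
  by rewrite eqxx (negbTE ij).
by rewrite eqxx.
Qed.

Lemma alternates_eq0 k (f : ('I_k -> V) -> C) v i j : alternates f -> i != j ->
  v i = v j -> f v = 0.
Proof.
move=> fa ij vij; have := fa v (tperm i j); rewrite odd_tperm ij expr1 mulN1r.
have -> : (fun l => v (tperm i j l)) = v.
  by apply/funext => l; case: tpermP => [->|->|].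
by move=> /eqP; rewrite -addr_eq0 -mulr2n mulrn_eq0 => /eqP.
Qed.

Lemma alternates_insert k (f : ('I_k.+1 -> V) -> C) a :
  alternates f -> alternates (fun u => f (insert ord0 a u)).
Proof.
move=> fa v s; have := fa (insert ord0 a v) (lift_perm ord0 ord0 s).
rewrite sign_lift_perm expr0 !mul1r => <-; congr f; apply/funext => i.
case: (unliftP ord0 i) => [j|] ->; first by rewrite lift_perm_lift !insert_lift.
by rewrite lift_perm_id !insert_id.
Qed.

Lemma multilinear_insert k (f : ('I_k.+1 -> V) -> C) a :
  multilinear f -> multilinear (fun u => f (insert ord0 a u)).
Proof.
move=> fl v j c b d; have E z : insert ord0 a (update v j z) =
    update (insert ord0 a v) (lift ord0 j) z.
  apply/funext => i; rewrite /update; case: (unliftP ord0 i) => [l|] ->.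
    by rewrite !insert_lift (inj_eq (@lift_inj _ _)).
  by rewrite !insert_id (negbTE (neq_lift _ _)).
by rewrite !E fl.
Qed.

Variables (A : V -> V).
Hypothesis AA : forall a, A (A a) = - a.

Lemma type_part_pair_alt (p k : nat) (f : ('I_k.+2 -> V) -> C) a s :
  alternates f -> multilinear f ->
  type_part A p f (args k.+2 [:: a, A a & s]) = if (0 < p)%N then type_part A p.-1
    (fun u => f (insert ord0 a (insert ord0 (A a) u))) (args k s) else 0.
Proof.
move=> fa fl; rewrite (type_part_pair AA) //.
  move=> b c u; have := fa (insert ord0 b (insert ord0 c u)) (tperm ord0 (lift ord0 ord0)).
  rewrite odd_tperm /= expr1 mulN1r => <-; congr f; apply/funext => l.
  case: tpermP => [->|->|l0 l1]; rewrite ?insert_lift ?insert_id //.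
  case: (unliftP ord0 l) l0 l1 => [l'|] -> //; rewrite !insert_lift => _.
  by case: (unliftP ord0 l') => [l''|] -> //; rewrite !insert_lift.
move=> b c u; have := @mlinN _ _ _ (fun u => f (insert ord0 b u)) (insert ord0 c u) ord0 c
  (multilinear_insert b fl).
have E z : update (insert ord0 c u) ord0 z = insert ord0 z u.
  apply/funext => l; rewrite /update; case: (unliftP ord0 l) => [l'|] ->.
    by rewrite !insert_lift.
  by rewrite eqxx !insert_id.
by rewrite !E.
Qed.

Lemma type_part_pair4 (p : nat) (f : ('I_4 -> V) -> C) a b :
  alternates f -> multilinear f ->
  type_part A p f (args 4 [:: a; A a; b; A b]) =
  if p == 2 then f (args 4 [:: a; A a; b; A b]) else 0.
Proof.
move=> fa fl; rewrite type_part_pair_alt //.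
rewrite type_part_pair_alt; last 2 first.
- exact: (alternates_insert (A a) (alternates_insert a fa)).
- exact: (multilinear_insert (A a) (multilinear_insert a fl)).
rewrite type_part_nil; case: p => [|[|[|p]]] //=.
by rewrite !args_insert.
Qed.

Lemma type_part_pair3 (f : ('I_3 -> V) -> C) a c :
  alternates f -> multilinear f ->
  type_part A 1 f (args 3 [:: a; A a; c]) =
  2^-1 * (f (args 3 [:: a; A a; c]) + 'i%C * f (args 3 [:: a; A a; A c])).
Proof.
move=> fa fl; rewrite type_part_pair_alt //= (type_part_lift _ _ ord0).
rewrite big_mkcond big_bool /= add0r type_part_nil /=.
have e d (z : 'I_0 -> V) : insert ord0 d z = args 1 [:: d].
  apply/funext => l; case: (unliftP ord0 l) => [[]//|->].
  by rewrite insert_id.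
by rewrite !e !args_insert.
Qed.

End Vectors.
Arguments args {R V} k s.
Section FrameFormula.
Variables (R : realType) (V : normedModType R) (K : coord_system V).
Local Notation C := R[i].
Local Notation crd := (crd K).
Local Notation bas := (bas K).
Local Notation ltrans := (ltrans K).

(** The derivative along [h] of the left-invariant field with value [v] at the
    neutral element; [shear h v - shear v h] is the Lie bracket. *)
Definition shear (h v : V) : V := cocycle K h v 6 *: bas 6 + cocycle K h v 7 *: bas 7.

Lemma shear_ltrans x h v : shear (ltrans x h) v = shear h v.
Proof. by rewrite /shear /cocycle !crd_ltrans_id. Qed.

Lemma field_deriv_ltrans k (u : 'I_k -> V) h x j :
  field_deriv (fun b : 'I_8 => bas b) (fun b : 'I_8 => crd b)
    (fun j y => ltrans y (u j)) h x j = shear h (u j).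
Proof.
rewrite [RHS](crdK K); apply: eq_bigr => b _; congr (_ *: _).
have -> : (fun y => crd b (ltrans y (u j)) : R^o) = fun y => cocycle K y (u j) b + crd b (u j).
  by apply/funext => y; rewrite crd_ltrans // addrC.
have sM n (c : R) : smooth_on setT (fun y => crd n y * c : R^o).
  by apply: smoothM; [exact: smooth_crd|exact: smooth_cst].
have dM n (c : R) : 'D_h (fun y => crd n y * c : R^o) x = crd n h * c.
  rewrite derive_mul ?derive_crd ?derive_cst ?mulr0 ?addr0 //.
    exact: smooth_crd.
  exact: smooth_cst.
have cE n : (n < 8)%N -> 'D_h (fun y => cocycle K y (u j) n + crd n (u j) : R^o) x =
    cocycle K h (u j) n.
  move=> n8; rewrite derive_add ?derive_cst ?addr0; last exact: smooth_cst.
    do 8?[case: n n8 => [|n] n8] => //=; rewrite ?derive_cst ?dM //.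
    by rewrite derive_add ?dM.
  do 8?[case: n n8 => [|n] n8] => //=; try exact: smooth_cst.
  exact: smoothD.
rewrite cE // /shear !crdE !crd_bas //.
by case: b => b b8; do 8?[case: b b8 => [|b] b8] => //=; rewrite ?(mulr0, mulr1, addr0, add0r).
Qed.

Lemma smooth_ltrans (v : V) (n : nat) : (n < 8)%N ->
  smooth_on setT (fun y => crd n (ltrans y v) : R^o).
Proof.
move=> n8; have -> : (fun y => crd n (ltrans y v) : R^o) = fun y => crd n v + cocycle K y v n.
  by apply/funext => y; rewrite crd_ltrans.
apply: smoothD; first exact: smooth_cst.
have sM m (c : R) : smooth_on setT (fun y => crd m y * c : R^o).
  by apply: smoothM; [exact: smooth_crd|exact: smooth_cst].
by do 8?[case: n n8 => [|n] n8] => //=; try exact: smooth_cst; exact: smoothD.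
Qed.

Definition on_frame k (w : dform V k) (s : seq V) (y : V) : C :=
  w y (args k (map (ltrans y) s)).

Lemma on_frameE k (w : dform V k) s y :
  on_frame w s y = w y (fun j => ltrans y (args k s j)).
Proof. by rewrite /on_frame (args_map k (ltrans y)). Qed.

Lemma on_frame_smooth k (w : dform V k) s : smooth_form w -> mlin_form w ->
  csmooth (on_frame w s).
Proof.
move=> sw lw; have := @mlin_subst_smooth R V 8 (fun b : 'I_8 => bas b)
  (fun b : 'I_8 => crd b) (crdK K) k w (fun j y => ltrans y (args k s j)) sw lw
  (fun j b => smooth_ltrans _ (ltn_ord b)).
by congr csmooth; apply/funext => y; rewrite on_frameE.
Qed.

(** Cartan's formula: the product rule turns the derivatives with frozen arguments
    into derivatives of functions on the group, and the derivatives of the frame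
    fields add up to the brackets. *)
Lemma ext_d_frame k (w : dform V k) s x : smooth_form w -> mlin_form w ->
  size s = k.+1 ->
  on_frame (ext_d w) s x = \sum_(i < k.+1) (-1) ^+ i *
    (cderive (ltrans x s`_i) (on_frame w (delete s i)) x -
     \sum_(j < k) w x (args k (set_nth 0 (map (ltrans x) (delete s i)) j
                              (shear s`_i (delete s i)`_j)))).
Proof.
move=> sw lw sk; rewrite on_frameE; apply: eq_bigr => i _; congr (_ * _).
have := @mlin_subst_derive R V 8 (fun b : 'I_8 => bas b)
  (fun b : 'I_8 => crd b) (crdK K) k w (fun j y => ltrans y (args k (delete s i) j)) sw lw
  (fun j b => smooth_ltrans _ (ltn_ord b)) (ltrans x s`_i) x.
have -> : (fun y => w y (fun j => ltrans y (args k (delete s i) j))) = on_frame w (delete s i).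
  by apply/funext => y; rewrite on_frameE.
move=> ->; have -> : (fun j => ltrans x (args k.+1 s (lift i j))) =
    (fun j => ltrans x (args k (delete s i) j)).
  by apply/funext => j; have := congr1 (fun f => f j) (args_lift i sk) => /= ->.
rewrite -addrA -[LHS]addr0; congr (_ + _).
apply/esym/eqP; rewrite subr_eq0; apply/eqP; apply: eq_bigr => j _.
rewrite field_deriv_ltrans -args_update -(args_map k (ltrans x)).
by rewrite shear_ltrans.
Qed.

Definition form_invariant (Gam : set V) k (w : dform V k) : Prop :=
  forall a x v, Gam a -> w (gmul K a x) (fun i => ltrans a (v i)) = w x v.

Lemma derive_gmul_comp (W : normedModType R) (f : V -> W) a x h :
  'D_(ltrans a h) f (gmul K a x) = 'D_h (fun y => f (gmul K a y)) x.
Proof.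
have E : (fun t => t^-1 *: ((f \o shift (gmul K a x)) (t *: ltrans a h) - f (gmul K a x))) =
    (fun t => t^-1 *: (((fun y => f (gmul K a y)) \o shift x) (t *: h) - f (gmul K a x))).
  apply/funext => t /=; congr (_ *: (f _ - _)).
  by rewrite /gmul addrA -linearZ -linearD.
by rewrite /derive E.
Qed.

Lemma ext_d_invariant Gam k (w : dform V k) :
  form_invariant Gam w -> form_invariant Gam (ext_d w).
Proof.
move=> wG a x v Ga; apply: eq_bigr => i _; congr (_ * _).
rewrite /cderive !derive_gmul_comp.
have E y : w (gmul K a y) (fun j => ltrans a (v (lift i j))) = w y (fun j => v (lift i j)).
  by rewrite wG.
by under [X in Complex ('D__ X _) _]eq_fun do rewrite E;
   under [X in Complex _ ('D__ X _)]eq_fun do rewrite E.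
Qed.

Lemma bidegree_invariant Gam p k (w : dform V k) :
  form_invariant Gam w -> form_invariant Gam (bidegree (cplx K) p w).
Proof.
move=> wG a x v Ga; congr (_ * _); apply: eq_bigr => S _; apply: eq_bigr => T _.
congr (_ * _); rewrite -[RHS](wG a) //; congr (w _ _); apply/funext => j.
by case: ifP => // _; rewrite cplx_gmul.
Qed.

Lemma wedge_invariant Gam k l (u : dform V k) (w : dform V l) :
  form_invariant Gam u -> form_invariant Gam w -> form_invariant Gam (wedge u w).
Proof.
move=> uG wG a x v Ga; congr (_ * _); apply: eq_bigr => s _.
by rewrite (uG a x (fun i => v (s (lshift l i)))) // (wG a x (fun i => v (s (rshift k i)))).
Qed.

Lemma form_exp_invariant Gam (w : dform V 2) k :
  form_invariant Gam w -> form_invariant Gam (form_exp w k).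
Proof.
move=> wG; elim: k => [|k IH]; first by [].
exact: (@wedge_invariant Gam 2 k.*2 w (form_exp w k)).
Qed.

Lemma on_frame_invariant Gam k (w : dform V k) s a x :
  form_invariant Gam w -> Gam a -> on_frame w s (gmul K a x) = on_frame w s x.
Proof.
move=> wG Ga; rewrite !on_frameE -[RHS](wG a) //; congr (w _ _).
by apply/funext => j; rewrite ltrans_gmul.
Qed.

End FrameFormula.

(** * Absence of SKT and balanced metrics *)

Section HermitianMetric.
Variables (R : realType) (V : normedModType R) (K : coord_system V).
Variables (Gam : set V) (g : V -> V -> V -> R).
Hypotheses (g_linear : forall x u, linear (g x u : V -> R^o))
  (g_sym : forall x u v, g x u v = g x v u)
  (g_gt0 : forall x v, v != 0 -> 0 < g x v v)
  (g_smooth : forall u v, smooth_on setT (fun x => g x u v : R^o))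
  (g_inv : forall a x u v, Gam a ->
     g (gmul K a x) (ltrans K a u) (ltrans K a v) = g x u v)
  (g_cplx : forall x u v, g x (cplx K x u) (cplx K x v) = g x u v).
Local Notation C := R[i].
Local Notation crd := (crd K).
Local Notation bas := (bas K).
Local Notation ltrans := (ltrans K).
Local Notation J := (cplx K).
Local Notation Om := (fundamental_form J g).

Definition Om_at x u v : R := g x (J x u) v.

Lemma g_linearl x v c u u' : g x (c *: u + u') v = c * g x u v + g x u' v.
Proof. by rewrite !(g_sym _ _ v) g_linear. Qed.

Lemma g_linearr x v c u u' : g x v (c *: u + u') = c * g x v u + g x v u'.
Proof. exact: g_linear. Qed.

Lemma g0r x v : g x v 0 = 0.
Proof. by have := g_linearr x v (-1) 0 0; rewrite scaler0 addr0 mulN1r addNr. Qed.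

Lemma gNr x u v : g x u (- v) = - g x u v.
Proof. by have := g_linearr x u (-1) v 0; rewrite scaleN1r g0r !addr0 mulN1r. Qed.

Lemma gDr x u v w : g x u (v + w) = g x u v + g x u w.
Proof. by have := g_linearr x u 1 v w; rewrite scale1r mul1r. Qed.

Lemma gJl x u v : g x (J x u) v = - g x u (J x v).
Proof. by rewrite -(g_cplx x u) cplxK gNr opprK. Qed.

Lemma Om_at_antisym x u v : Om_at x v u = - Om_at x u v.
Proof. by rewrite /Om_at gJl g_sym. Qed.

Lemma Om_at_linearr x u c v v' : Om_at x u (c *: v + v') = c * Om_at x u v + Om_at x u v'.
Proof. exact: g_linearr. Qed.

Lemma Om_at_linearl x u c v v' : Om_at x (c *: v + v') u = c * Om_at x v u + Om_at x v' u.
Proof. by rewrite !(Om_at_antisym x u) Om_at_linearr; ring. Qed.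

Lemma OmE x v : Om x v = (Om_at x (v ord0) (v ord_max))%:C%C.
Proof. by []. Qed.

Lemma Om_alt : alt_form Om.
Proof.
move=> x v s; have [t st] := lift_perm_surj s ord0.
have t1 : t = 1%g.
  by apply/permP => i; rewrite perm1 !ord1.
have mx : ord_max = lift ord0 ord0 :> 'I_2 by apply: ord_inj.
rewrite !OmE [in RHS]st sign_lift_perm t1 odd_perm1 expr0 mul1r mulr1.
have -> : s ord_max = lift (s ord0) ord0 by rewrite mx {1}st lift_perm_lift t1 perm1.
case: (unliftP ord0 (s ord0)) => [j|] ->.
  have -> : lift ord0 j = ord_max by apply: ord_inj; case: j => -[].
  have -> : lift ord_max ord0 = ord0 :> 'I_2 by apply: ord_inj.
  by rewrite expr1 Om_at_antisym rmorphN mulN1r.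
by rewrite -mx expr0 mul1r.
Qed.

Lemma Om_mlin : mlin_form Om.
Proof.
move=> x v j c a b; rewrite !OmE /update.
have jE : j = ord0 \/ j = ord_max.
  by case: j => -[|[|//]] ?; [left|right]; apply: ord_inj.
by case: jE => ->; rewrite ?eqxx /= ?Om_at_linearl ?Om_at_linearr rmorphD rmorphM.
Qed.

Lemma Om_smooth : smooth_form Om.
Proof.
move=> v; have -> : (fun y => Om y v) = fun y =>
    \sum_(b < 8) (crd b (J y (v ord0)) * g y (bas b) (v ord_max))%:C%C.
  apply/funext => y; rewrite -rmorph_sum OmE; congr (_ %:C%C).
  rewrite /Om_at {1}(crdK K (J y (v ord0))).
  elim/big_ind2: _ => [|a c a' c' <- <-|b _].
  - by rewrite g_sym g0r.
  - by rewrite !(g_sym _ _ (v ord_max)) gDr.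
  - by rewrite -[_ *: _]addr0 g_linearl (g_sym _ 0) g0r addr0.
apply: csmooth_sum => b; apply: csmoothR; apply: smoothM; last exact: g_smooth.
exact: smooth_crd_cplx.
Qed.

Lemma Om_invariant : form_invariant K Gam Om.
Proof. by move=> a x v Ga; rewrite !OmE /Om_at cplx_gmul g_inv. Qed.

(** [Omega] is invariant under [J]. *)
Lemma Om_type : has_type J 1 Om.
Proof.
move=> q; apply/funext => x; apply/funext => v; rewrite bidegreeE.
rewrite (@type_part_invariant2 R V (J x) (cplxK K x) q (fun a b => (Om_at x a b)%:C%C)).
- by case: eqP.
- by move=> a b; rewrite /Om_at g_cplx.
- by move=> a b; rewrite /Om_at gNr rmorphN.
Qed.

(** [delbar Omega] is the part of type (1,2) of [d Omega].  The projection in front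
    is the one in the definition of [del]; SKT says that the part of type (2,2) of
    [d skt_form] vanishes. *)
Definition skt_form : dform V 3 := bidegree J 1 (delbar J Om).

Lemma delbar_Om : delbar J Om = bidegree J 1 (ext_d Om).
Proof. exact: delbar_typeE Om_type _. Qed.

Let dOm_alt : alt_form (ext_d Om). Proof. exact: ext_d_alt Om_smooth Om_alt. Qed.
Let dOm_mlin : mlin_form (ext_d Om). Proof. exact: ext_d_mlin Om_smooth Om_mlin. Qed.

Lemma skt_form_alt : alt_form skt_form.
Proof. by rewrite /skt_form delbar_Om; do 2!apply: bidegree_alt. Qed.

Lemma skt_form_mlin : mlin_form skt_form.
Proof. by rewrite /skt_form delbar_Om; do 2!(apply: bidegree_mlin; first exact: cplx_linear). Qed.

Lemma bidegree_smooth p k (w : dform V k) : smooth_form w -> mlin_form w ->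
  smooth_form (bidegree J p w).
Proof.
move=> sw lw v; apply: csmoothZ; apply: csmooth_sum => S; apply: csmooth_sum => T.
apply: csmoothZ.
apply: (@mlin_subst_smooth R V 8 (fun b : 'I_8 => bas b) (fun b : 'I_8 => crd b)
  (crdK K) k w (fun j y => if j \in T then J y (v j) else v j) sw lw).
move=> j b; case: (j \in T); last exact: smooth_cst.
exact: smooth_crd_cplx.
Qed.

Lemma skt_form_smooth : smooth_form skt_form.
Proof.
rewrite /skt_form delbar_Om; apply: bidegree_smooth.
  by apply: bidegree_smooth => //; apply: smooth_form_ext_d; exact: Om_smooth.
by apply: bidegree_mlin; first exact: cplx_linear.
Qed.

Lemma skt_form_invariant : form_invariant K Gam skt_form.
Proof.
rewrite /skt_form delbar_Om; do 2!apply: bidegree_invariant.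
by apply: ext_d_invariant; exact: Om_invariant.
Qed.

(** On [a, J a, b, J b] a four-form takes the same value as its part of type
    (2,2). *)
Lemma SKT_closed a b x : SKT J g ->
  ext_d skt_form x (args 4 [:: a; J x a; b; J x b]) = 0.
Proof.
move=> /(_ x (args 4 [:: a; J x a; b; J x b])); rewrite /del => <-.
have E (p : nat) : bidegree J p.+1 (ext_d (bidegree J p (delbar J Om))) x
      (args 4 [:: a; J x a; b; J x b]) =
    if p.+1 == 2 then ext_d (bidegree J p (delbar J Om)) x (args 4 [:: a; J x a; b; J x b])
    else 0.
  have sB : smooth_form (bidegree J p (delbar J Om)).
    rewrite delbar_Om; apply: bidegree_smooth.
      by apply: bidegree_smooth => //; apply: smooth_form_ext_d; exact: Om_smooth.
    by apply: bidegree_mlin; first exact: cplx_linear.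
  rewrite bidegreeE type_part_pair4 //; first exact: cplxK.
    apply: ext_d_alt => //; rewrite delbar_Om.
    by do 2!apply: bidegree_alt.
  apply: ext_d_mlin => //; rewrite delbar_Om.
  by do 2!(apply: bidegree_mlin; first exact: cplx_linear).
under eq_bigr do rewrite E.
by rewrite !big_ord_recl big_ord0 /= !add0r !addr0.
Qed.

Lemma Im_dOm x v : complex.Im (ext_d Om x v) = 0.
Proof.
rewrite /ext_d; elim/big_ind: _ => [//|a b ha hb|i _].
  by rewrite ImD ha hb addr0.
have -> : cderive (v i) (fun y => Om y (fun j => v (lift i j))) x =
    ('D_(v i) (fun y => Om_at y (v (lift i ord0)) (v (lift i ord_max)) : R^o) x)%:C%C.
  exact: cderiveR.
by rewrite -signr_odd; case: (odd i); rewrite ?expr0 ?expr1 ?mul1r ?mulN1r //= oppr0.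
Qed.

(** The two projections onto type (1,2) are evaluated by [type_part_pair3], and
    [d Omega] is real. *)
Lemma Im_skt_form x a c :
  complex.Im (skt_form x (args 3 [:: a; J x a; c])) =
  2^-1 * complex.Re (ext_d Om x (args 3 [:: a; J x a; J x c])).
Proof.
rewrite /skt_form delbar_Om bidegreeE type_part_pair3; first last.
- by apply: bidegree_mlin; first exact: cplx_linear.
- exact: bidegree_alt.
- exact: cplxK.
rewrite !bidegreeE !type_part_pair3 //; try exact: cplxK.
rewrite cplxK.
have -> : ext_d Om x (args 3 [:: a; J x a; - c]) = - ext_d Om x (args 3 [:: a; J x a; c]).
  have := mlinN (args 3 [:: a; J x a; c]) (Ordinal (isT : (2 < 3)%N)) c (dOm_mlin x).
  by rewrite !args_update.
set u := ext_d Om x _; set w := ext_d Om x _.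
have u0 : complex.Im u = 0 by exact: Im_dOm.
have w0 : complex.Im w = 0 by exact: Im_dOm.
have -> : 2^-1 * (2^-1 * (u + 'i%C * w) + 'i%C * (2^-1 * (w + 'i%C * - u))) =
    2^-1 * (u + 'i%C * w) :> C.
  have i2 : 'i%C * 'i%C = -1 :> C by rewrite -expr2 sqr_i.
  transitivity (2^-1 * (2^-1 * (u + 'i%C * w) + 2^-1 * ('i%C * w - ('i%C * 'i%C) * u)) : C).
    by ring.
  by rewrite i2; field.
have -> : (2^-1 : C) = (2^-1)%:C%C by rewrite fmorphV rmorph_nat.
by case: u w u0 w0 => [u ?] [w ?] /= -> ->; ring.
Qed.

Lemma cplx_ltrans x u : J x (ltrans x u) = ltrans x (of_crd K (frame_cplx K u)).
Proof. by rewrite /cplx ltransK. Qed.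

(** [J Z_1 = Z_0 + Z_1]. *)
Definition JZ1 : V := bas 6 + bas 7.

Lemma frame_cplx_bas2 : of_crd K (frame_cplx K (bas 2)) = bas 3.
Proof.
apply: (crd_ext (K := K)) => n n8; rewrite crd_of_crd // crd_bas //.
by do 8?[case: n n8 => [|n] n8] => //=; rewrite !crd_bas //= ?(mulr0, subrr, oppr0).
Qed.

Lemma frame_cplx_bas4 : of_crd K (frame_cplx K (bas 4)) = bas 5.
Proof.
apply: (crd_ext (K := K)) => n n8; rewrite crd_of_crd // crd_bas //.
by do 8?[case: n n8 => [|n] n8] => //=; rewrite !crd_bas //= ?(mulr0, subrr, oppr0).
Qed.

Lemma frame_cplx_bas7 : of_crd K (frame_cplx K (bas 7)) = JZ1.
Proof.
apply: (crd_ext (K := K)) => n n8; rewrite crd_of_crd // /JZ1 crdD !crd_bas //.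
do 8?[case: n n8 => [|n] n8] => //=; rewrite !crd_bas //=.
all: by rewrite ?(mulr0, subr0, oppr0, addr0, add0r).
Qed.

Lemma ltrans_central x v : crd 1 v = 0 -> crd 3 v = 0 -> crd 5 v = 0 -> ltrans x v = v.
Proof.
move=> v1 v3 v5; apply: (crd_ext (K := K)) => n n8; rewrite crd_ltrans //.
do 8?[case: n n8 => [|n] n8] => //=; rewrite ?v1 ?v3 ?v5 ?mulr0 ?addr0 //.
Qed.

Lemma ltrans_JZ1 x : ltrans x JZ1 = JZ1.
Proof. by apply: ltrans_central; rewrite /JZ1 crdD !crd_bas //= addr0. Qed.

Lemma ltrans_bas7 x : ltrans x (bas 7) = bas 7.
Proof. by apply: ltrans_central; rewrite crd_bas. Qed.

Lemma ltrans_shear x h v : ltrans x (shear K h v) = shear K h v.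
Proof.
by apply: ltrans_central; rewrite /shear crdD !crdZ !crd_bas //= !mulr0 addr0.
Qed.

(** Brackets are central, hence invariant under [ltrans x], and the bracket terms
    are again values of [w] on the frame. *)
Lemma ext_d_frame_bracket k (w : dform V k) s x : smooth_form w -> mlin_form w ->
  size s = k.+1 ->
  on_frame K (ext_d w) s x = \sum_(i < k.+1) (-1) ^+ i *
    (cderive (ltrans x s`_i) (on_frame K w (delete s i)) x -
     \sum_(j < k) on_frame K w (set_nth 0 (delete s i) j (shear K s`_i (delete s i)`_j)) x).
Proof.
move=> sw lw sk; rewrite ext_d_frame //; apply: eq_bigr => i _.
congr (_ * (_ - _)); apply: eq_bigr => j _; rewrite /on_frame; congr (w x _).
apply/funext => l; have sr : size (delete s i) = k.
  by rewrite /delete size_cat size_take size_drop sk ltn_ord; move: (ltn_ord i); lia.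
rewrite /args (nth_map 0) ?size_set_nth ?sr; last first.
  by rewrite leq_max ltn_ord orbT.
rewrite !nth_set_nth /=; case: ifP => _; first by rewrite ltrans_shear.
by rewrite (nth_map 0) // sr.
Qed.

Lemma on_frame_eq0 k (w : dform V k) s x (j : nat) : mlin_form w -> (j < k)%N ->
  s`_j = 0 -> on_frame K w s x = 0.
Proof.
move=> lw jk sj; rewrite on_frameE.
have -> : (fun i => ltrans x (args k s i)) =
    update (fun i => ltrans x (args k s i)) (Ordinal jk) 0.
  apply/funext => l; rewrite /update; case: eqP => // ->.
  by rewrite /args /= sj linear0.
by rewrite mlin0.
Qed.

Lemma bump01 : bump 0 0 = 1%N. Proof. by []. Qed.
Lemma bump012 : bump 0 1 = 2%N. Proof. by []. Qed.
Lemma bump0123 : bump 0 2 = 3%N. Proof. by []. Qed.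

Definition bracket_free (n m : nat) : bool :=
  ~~ [|| (n == 0) && (m == 1), (n == 2) && (m == 3) | (n == 4) && (m == 5)]%N.

Lemma shear_bas0 n m : (n < 8)%N -> (m < 8)%N -> bracket_free n m ->
  shear K (bas n) (bas m) = 0.
Proof.
move=> n8 m8; rewrite /bracket_free /shear /cocycle !crd_bas // !(eq_sym _%N n) !(eq_sym _%N m).
by case: (n == 0)%N; case: (m == 1)%N; case: (n == 2)%N; case: (m == 3)%N;
   case: (n == 4)%N; case: (m == 5)%N => //= _;
   rewrite ?(mulr0, mul0r, addr0, scale0r).
Qed.

Lemma shear_bas23 : shear K (bas 2) (bas 3) = bas 7.
Proof.
by rewrite /shear /cocycle !crd_bas //= !(mulr0, mul0r, mulr1, addr0, scale0r, scale1r, add0r).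
Qed.

Lemma shear_bas45 : shear K (bas 4) (bas 5) = bas 7.
Proof.
by rewrite /shear /cocycle !crd_bas //= !(mulr0, mul0r, mulr1, addr0, scale0r, scale1r, add0r).
Qed.

Lemma shear_bas01 : shear K (bas 0) (bas 1) = bas 6.
Proof.
by rewrite /shear /cocycle !crd_bas //= !(mulr0, mul0r, mulr1, addr0, scale0r, scale1r, add0r).
Qed.

Lemma shear_JZ1l v : shear K JZ1 v = 0.
Proof.
by rewrite /shear /cocycle /JZ1 !crdD !crd_bas //= !(mulr0, mul0r, addr0, scale0r).
Qed.

Lemma shear_JZ1r v : shear K v JZ1 = 0.
Proof.
by rewrite /shear /cocycle /JZ1 !crdD !crd_bas //= !(mulr0, mul0r, addr0, scale0r).
Qed.

Definition norm_JZ1 (x : V) : R^o := g x JZ1 JZ1.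

(** Among [X_n, Y_n, J Z_1] (with [m = n.*2]) the only bracket is [[X_n, Y_n] = Z_1],
    and [Omega (Z_1, J Z_1) = g (J Z_1, J Z_1)]. *)
Lemma ext_d_Om_JZ1 m x : (m = 2 \/ m = 4)%N ->
  on_frame K (ext_d Om) [:: bas m; bas m.+1; JZ1] x =
  cderive (ltrans x (bas m)) (on_frame K Om [:: bas m.+1; JZ1]) x -
  cderive (ltrans x (bas m.+1)) (on_frame K Om [:: bas m; JZ1]) x +
  cderive (ltrans x JZ1) (on_frame K Om [:: bas m; bas m.+1]) x - (norm_JZ1 x)%:C%C.
Proof.
move=> m24; rewrite (ext_d_frame_bracket _ Om_smooth Om_mlin) //.
have sh : shear K (bas m) (bas m.+1) = bas 7.
  by case: m24 => ->; [exact: shear_bas23|exact: shear_bas45].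
have sh' : shear K (bas m.+1) (bas m) = 0.
  by case: m24 => ->; apply: shear_bas0.
rewrite !big_ord_recl !big_ord0 /delete /=.
rewrite !shear_JZ1l !shear_JZ1r sh sh'.
have z j s : (j < 2)%N -> s`_j = 0 -> on_frame K Om s x = 0.
  by move=> j2 sj; apply: (on_frame_eq0 _ Om_mlin j2 sj).
rewrite !(z 0%N [:: 0; _]) // !(z 1%N [:: _; 0]) // bump01 bump012.
have -> : on_frame K Om [:: bas 7; JZ1] x = (norm_JZ1 x)%:C%C.
  rewrite /on_frame OmE /Om_at /args /= ltrans_JZ1.
  by rewrite cplx_ltrans frame_cplx_bas7 ltrans_JZ1.
by rewrite !addr0 !subr0 expr0 expr1 sqrrN expr1n !mul1r mulN1r; ring.
Qed.

Lemma ext_d_frame2345 (w : dform V 3) x : smooth_form w -> mlin_form w ->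
  on_frame K (ext_d w) [:: bas 2; bas 3; bas 4; bas 5] x =
  cderive (ltrans x (bas 2)) (on_frame K w [:: bas 3; bas 4; bas 5]) x -
  cderive (ltrans x (bas 3)) (on_frame K w [:: bas 2; bas 4; bas 5]) x +
  cderive (ltrans x (bas 4)) (on_frame K w [:: bas 2; bas 3; bas 5]) x -
  cderive (ltrans x (bas 5)) (on_frame K w [:: bas 2; bas 3; bas 4]) x -
  on_frame K w [:: bas 7; bas 4; bas 5] x - on_frame K w [:: bas 2; bas 3; bas 7] x.
Proof.
move=> sw lw; rewrite (ext_d_frame_bracket _ sw lw) //.
rewrite !big_ord_recl.
rewrite !big_ord0 /delete /=.
rewrite shear_bas23 shear_bas45 !shear_bas0 //.
have z j s : (j < 3)%N -> s`_j = 0 -> on_frame K w s x = 0.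
  by move=> j3 sj; apply: (on_frame_eq0 _ lw j3 sj).
rewrite !(z 0%N [:: 0; _; _]) // !(z 1%N [:: _; 0; _]) // !(z 2%N [:: _; _; 0]) //.
rewrite bump01 bump012 bump0123 !addr0 !subr0 !add0r.
rewrite expr0 expr1 sqrrN expr1n (exprS _ 2) sqrrN expr1n mulr1 !mul1r !mulN1r.
ring.
Qed.

Lemma skt_form_cycle x : on_frame K skt_form [:: bas 7; bas 4; bas 5] x =
  on_frame K skt_form [:: bas 4; bas 5; bas 7] x.
Proof.
have swap i j s := @args_swap R V 3 s i j (skt_form x) (skt_form_alt x).
rewrite /on_frame /=.
rewrite -[LHS]opprK -(swap ord0 (Ordinal (isT : 1 < 3)%N)) //=.
by rewrite -(swap (Ordinal (isT : 1 < 3)%N) (Ordinal (isT : 2 < 3)%N)).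
Qed.

(** On [X_1, Y_1, X_2, Y_2] the equation [SKT_closed] says that the sum of
    [skt_form (X_n, Y_n, Z_1)] for [n = 1, 2] is a divergence.  By [Im_skt_form] the
    imaginary part of a summand is half of [d Omega (X_n, Y_n, J Z_1)], which is a
    divergence minus [g (J Z_1, J Z_1)] by [ext_d_Om_JZ1].  The components [f] of the
    resulting field are invariant under the lattice. *)
Theorem no_SKT : cocompact K Gam -> ~ SKT J g.
Proof.
move=> cG skt.
pose T s (y : V) : R^o := complex.Im (on_frame K skt_form s y).
pose O s (y : V) : R^o := complex.Re (on_frame K Om s y).
have sT s : smooth_on setT (T s).
  exact: (on_frame_smooth K s skt_form_smooth skt_form_mlin).2.
have sO s : smooth_on setT (O s).
  exact: (on_frame_smooth K s Om_smooth Om_mlin).1.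
have gT s : gamma_invariant K Gam (T s).
  by move=> a y Ga; rewrite /T (on_frame_invariant _ _ skt_form_invariant Ga).
have gO s : gamma_invariant K Gam (O s).
  by move=> a y Ga; rewrite /O (on_frame_invariant _ _ Om_invariant Ga).
pose f (n : nat) : V -> R^o := match n with
  | 2 => fun y => 2^-1 * O [:: bas 3; JZ1] y - T [:: bas 3; bas 4; bas 5] y
  | 3 => fun y => T [:: bas 2; bas 4; bas 5] y - 2^-1 * O [:: bas 2; JZ1] y
  | 4 => fun y => 2^-1 * O [:: bas 5; JZ1] y - T [:: bas 2; bas 3; bas 5] y
  | 5 => fun y => T [:: bas 2; bas 3; bas 4] y - 2^-1 * O [:: bas 4; JZ1] y
  | 6 | 7 => fun y => 2^-1 * O [:: bas 2; bas 3] y + 2^-1 * O [:: bas 4; bas 5] y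
  | _ => cst 0 end.
have sZ s : smooth_on setT (fun y => 2^-1 * O s y : R^o).
  by apply: smoothM; first exact: smooth_cst.
have sf n : smooth_on setT (f n).
  do 8?[case: n => [|n]] => /=; try exact: smooth_cst; try exact: smoothB.
    exact: smoothD.
  exact: smoothD.
have gf n : gamma_invariant K Gam (f n).
  move: gT gO; rewrite /f; move: (T) (O) => T' O' gT gO a y Ga.
  by do 8?[case: n => [|n]] => //=; rewrite ?gO // ?gT.
have cu : continuous norm_JZ1 by apply: smooth_cont; exact: g_smooth.
have gu : gamma_invariant K Gam norm_JZ1.
  by move=> a y Ga; rewrite /norm_JZ1 -[RHS](g_inv _ _ _ Ga) !ltrans_JZ1.
apply: (frame_divergence cG (fun n _ => sf n) (fun n _ => gf n) cu gu) => x; last first.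
  apply: g_gt0; apply/eqP => /(congr1 (crd 6)).
  by rewrite /JZ1 crdD !crd_bas // crd0 addr0 => /eqP; rewrite oner_eq0.
have closed : on_frame K (ext_d skt_form) [:: bas 2; bas 3; bas 4; bas 5] x = 0.
  rewrite /on_frame /= -frame_cplx_bas2 -frame_cplx_bas4 -!cplx_ltrans; exact: SKT_closed.
have ImE (a b c d e h : C) : a - b + c - d = e + h -> complex.Im a - complex.Im b +
    complex.Im c - complex.Im d = complex.Im e + complex.Im h.
  by case: a b c d e h => [? ?] [? ?] [? ?] [? ?] [? ?] [? ?] [].
have ReE (a b c : C) (d : R) : complex.Re (a - b + c - d%:C%C) =
    complex.Re a - complex.Re b + complex.Re c - d.
  by case: a b c => [? ?] [? ?] [? ?].
have F1 : 'D_(ltrans x (bas 2)) (T [:: bas 3; bas 4; bas 5]) x -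
    'D_(ltrans x (bas 3)) (T [:: bas 2; bas 4; bas 5]) x +
    'D_(ltrans x (bas 4)) (T [:: bas 2; bas 3; bas 5]) x -
    'D_(ltrans x (bas 5)) (T [:: bas 2; bas 3; bas 4]) x =
    T [:: bas 4; bas 5; bas 7] x + T [:: bas 2; bas 3; bas 7] x.
  have /esym/eqP := ext_d_frame2345 x skt_form_smooth skt_form_mlin.
  rewrite closed -addrA -opprD subr_eq0 skt_form_cycle => /eqP.
  exact: ImE.
have F2 m : (m = 2 \/ m = 4)%N -> T [:: bas m; bas m.+1; bas 7] x =
    2^-1 * ('D_(ltrans x (bas m)) (O [:: bas m.+1; JZ1]) x -
     'D_(ltrans x (bas m.+1)) (O [:: bas m; JZ1]) x +
     'D_(ltrans x JZ1) (O [:: bas m; bas m.+1]) x - norm_JZ1 x).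
  move=> m24; have Jm : of_crd K (frame_cplx K (bas m)) = bas m.+1.
    by case: m24 => ->; [exact: frame_cplx_bas2|exact: frame_cplx_bas4].
  transitivity (2^-1 * complex.Re (on_frame K (ext_d Om) [:: bas m; bas m.+1; JZ1] x)).
    by rewrite /T /on_frame /= -Jm -!cplx_ltrans Im_skt_form (cplx_ltrans x (bas 7)) frame_cplx_bas7.
  by rewrite ext_d_Om_JZ1 // ReE.
have F3 := F2 2%N (or_introl erefl); have F4 := F2 4%N (or_intror erefl).
have hor67 (F : V -> R^o) : smooth_on setT F ->
    'D_(ltrans x JZ1) F x = 'D_(ltrans x (bas 6)) F x + 'D_(ltrans x (bas 7)) F x.
  by move=> sF; rewrite /JZ1 linearD deriveDr.
rewrite F3 F4 {F2 F3 F4} !hor67 // {hor67} in F1.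
move: F1 sT sO; rewrite /f {f sf gf sZ gT gO}.
move: (T) (O) => T' O' F1 sT sO.
have sZ s : smooth_on setT (fun y => 2^-1 * O' s y : R^o).
  by apply: smoothM; first exact: smooth_cst.
have dZ v s : 'D_v (fun y => 2^-1 * O' s y : R^o) x = 2^-1 * 'D_v (O' s) x.
  by rewrite derive_mul // ?derive_cst ?mul0r ?add0r //; exact: smooth_cst.
rewrite !big_ord_recl big_ord0 /= !derive_cst !derive_sub // !derive_add // !dZ.
rewrite /frame (_ : bump 0 3 = 4)%N // (_ : bump 0 4 = 5)%N // (_ : bump 0 5 = 6)%N //.
rewrite (_ : bump 0 6 = 7)%N //; move: F1.
repeat match goal with |- context [derive ?h ?y ?v] =>
  let d := fresh "d" in move: (derive h y v : R) => d end.
by move: (norm_JZ1 x : R) => u F1; lra.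
Qed.

Lemma Om_wedge_args k (u : dform V k) s x : alt_form u -> size s = k.+2 ->
  wedge Om u x (args k.+2 s) = 2^-1 * \sum_(i < k.+2) (-1) ^+ i *
    \sum_(j < k.+1) (-1) ^+ j * ((Om_at x s`_i (delete s i)`_j)%:C%C * u x (args k (delete (delete s i) j))).
Proof.
move=> au sk; rewrite (@wedge2E R V k Om u (fun x a b => (Om_at x a b)%:C%C)) //.
congr (_ * _); apply: eq_bigr => i _; congr (_ * _).
rewrite (args_lift i sk); have sr : size (delete s i) = k.+1.
  by rewrite /delete size_cat size_take size_drop sk ltn_ord; move: (ltn_ord i); lia.
by apply: eq_bigr => j _; rewrite (args_lift j sr).
Qed.

Lemma sign2 : (-1 : C) ^+ 2 = 1. Proof. by rewrite sqrrN expr1n. Qed.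
Lemma sign3 : (-1 : C) ^+ 3 = -1. Proof. by rewrite exprS sign2 mulr1. Qed.
Lemma sign4 : (-1 : C) ^+ 4 = 1. Proof. by rewrite exprS sign3 mulN1r opprK. Qed.
Lemma sign5 : (-1 : C) ^+ 5 = -1. Proof. by rewrite exprS sign4 mulr1. Qed.
Lemma sign6 : (-1 : C) ^+ 6 = 1. Proof. by rewrite exprS sign5 mulN1r opprK. Qed.

(** A power of a two-form is a multiple of its Pfaffian: [form_exp3] is [Omega^3]
    as [3!] times the Pfaffian of [Omega], expanded along the first argument. *)
Section Pfaffian.
Variable x : V.
Let w (a b : V) : C := (Om_at x a b)%:C%C.

Let wC a b : w b a = - w a b.
Proof. by rewrite /w Om_at_antisym rmorphN. Qed.

Definition pfaffian4 (a b c d : V) : C := w a b * w c d - w a c * w b d + w a d * w b c.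

Let signs := (bump01, bump012, bump0123, (erefl : bump 0 3 = 4%N),
  (erefl : bump 0 4 = 5%N), (expr0 (-1 : C)), (expr1 (-1 : C)), sign2, sign3, sign4, sign5).

Lemma form_exp1 a b : form_exp Om 1 x (args 2 [:: a; b]) = w a b.
Proof.
apply: (etrans (@Om_wedge_args 0 _ [:: a; b] x (@unit_form_alt R V) erefl)).
rewrite !big_ord_recl !big_ord0 /delete /= /unit_form -!/(w _ _) (wC a b).
by rewrite !signs; field.
Qed.

Lemma Om_wedge4 (u : dform V 2) a b c d : alt_form u ->
  wedge Om u x (args 4 [:: a; b; c; d]) =
  w a b * u x (args 2 [:: c; d]) - w a c * u x (args 2 [:: b; d]) + w a d * u x (args 2 [:: b; c])
   + w b c * u x (args 2 [:: a; d]) - w b d * u x (args 2 [:: a; c]) + w c d * u x (args 2 [:: a; b]).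
Proof.
move=> au; apply: (etrans (@Om_wedge_args 2 u [:: a; b; c; d] x au erefl)).
rewrite !big_ord_recl !big_ord0 /delete /= -!/(w _ _).
rewrite (wC a b).
rewrite (wC a c).
rewrite (wC a d).
rewrite (wC b c).
rewrite (wC b d).
rewrite (wC c d).
move: (w a b) (u x (args 2 [:: c; d])) => w01 u01.
move: (w a c) (u x (args 2 [:: b; d])) => w02 u02.
move: (w a d) (u x (args 2 [:: b; c])) => w03 u03.
move: (w b c) (u x (args 2 [:: a; d])) => w12 u12.
move: (w b d) (u x (args 2 [:: a; c])) => w13 u13.
move: (w c d) (u x (args 2 [:: a; b])) => w23 u23.
rewrite !signs.
by field.
Qed.

Lemma form_exp2 a b c d : form_exp Om 2 x (args 4 [:: a; b; c; d]) = 2 * pfaffian4 a b c d.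
Proof.
apply: (etrans (Om_wedge4 _ _ _ _ (@form_exp_alt R V Om 1))).
by rewrite !form_exp1 /pfaffian4; ring.
Qed.

Lemma Om_wedge6 (u : dform V 4) a b c d e f : alt_form u ->
  wedge Om u x (args 6 [:: a; b; c; d; e; f]) =
  w a b * u x (args 4 [:: c; d; e; f]) - w a c * u x (args 4 [:: b; d; e; f]) + w a d * u x (args 4 [:: b; c; e; f])
   - w a e * u x (args 4 [:: b; c; d; f]) + w a f * u x (args 4 [:: b; c; d; e]) + w b c * u x (args 4 [:: a; d; e; f])
   - w b d * u x (args 4 [:: a; c; e; f]) + w b e * u x (args 4 [:: a; c; d; f]) - w b f * u x (args 4 [:: a; c; d; e])
   + w c d * u x (args 4 [:: a; b; e; f]) - w c e * u x (args 4 [:: a; b; d; f]) + w c f * u x (args 4 [:: a; b; d; e])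
   + w d e * u x (args 4 [:: a; b; c; f]) - w d f * u x (args 4 [:: a; b; c; e]) + w e f * u x (args 4 [:: a; b; c; d]).
Proof.
move=> au; apply: (etrans (@Om_wedge_args 4 u [:: a; b; c; d; e; f] x au erefl)).
rewrite !big_ord_recl !big_ord0 /delete /= -!/(w _ _).
rewrite (wC a b).
rewrite (wC a c).
rewrite (wC a d).
rewrite (wC a e).
rewrite (wC a f).
rewrite (wC b c).
rewrite (wC b d).
rewrite (wC b e).
rewrite (wC b f).
rewrite (wC c d).
rewrite (wC c e).
rewrite (wC c f).
rewrite (wC d e).
rewrite (wC d f).
rewrite (wC e f).
move: (w a b) (u x (args 4 [:: c; d; e; f])) => w01 u01.
move: (w a c) (u x (args 4 [:: b; d; e; f])) => w02 u02.
move: (w a d) (u x (args 4 [:: b; c; e; f])) => w03 u03.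
move: (w a e) (u x (args 4 [:: b; c; d; f])) => w04 u04.
move: (w a f) (u x (args 4 [:: b; c; d; e])) => w05 u05.
move: (w b c) (u x (args 4 [:: a; d; e; f])) => w12 u12.
move: (w b d) (u x (args 4 [:: a; c; e; f])) => w13 u13.
move: (w b e) (u x (args 4 [:: a; c; d; f])) => w14 u14.
move: (w b f) (u x (args 4 [:: a; c; d; e])) => w15 u15.
move: (w c d) (u x (args 4 [:: a; b; e; f])) => w23 u23.
move: (w c e) (u x (args 4 [:: a; b; d; f])) => w24 u24.
move: (w c f) (u x (args 4 [:: a; b; d; e])) => w25 u25.
move: (w d e) (u x (args 4 [:: a; b; c; f])) => w34 u34.
move: (w d f) (u x (args 4 [:: a; b; c; e])) => w35 u35.
move: (w e f) (u x (args 4 [:: a; b; c; d])) => w45 u45.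
rewrite !signs.
by field.
Qed.

Lemma form_exp3 a b c d e f : form_exp Om 3 x (args 6 [:: a; b; c; d; e; f]) =
  6 * (w a b * pfaffian4 c d e f - w a c * pfaffian4 b d e f + w a d * pfaffian4 b c e f
       - w a e * pfaffian4 b c d f + w a f * pfaffian4 b c d e).
Proof.
apply: (etrans (Om_wedge6 _ _ _ _ _ _ (@form_exp_alt R V Om 2))).
rewrite !form_exp2 /pfaffian4.
move: (w a b) (w a c) (w a d) (w a e) (w a f) => ab ac ad ae af.
move: (w b c) (w b d) (w b e) (w b f) => bc bd be bf.
move: (w c d) (w c e) (w c f) (w d e) (w d f) (w e f) => cd ce cf de df ef.
by ring.
Qed.

End Pfaffian.

(** [Omega^3] restricted to the complex span of [a = X_1], [b = X_2], [c = Z_1] is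
    [3!] times the determinant of the Hermitian Gram matrix (Wirtinger).  With
    [g x u v] and [g x u (J x v)] as real and imaginary parts of its entries,
    [gram2] and [gram3] are its leading minors. *)
Section Wirtinger.
Variable x : V.
Let a := ltrans x (bas 2).
Let b := ltrans x (bas 4).
Let c := bas 7 : V.
Let Ja : J x a = ltrans x (bas 3). Proof. by rewrite cplx_ltrans frame_cplx_bas2. Qed.
Let Jb : J x b = ltrans x (bas 5). Proof. by rewrite cplx_ltrans frame_cplx_bas4. Qed.
Let Jc : J x c = JZ1.
Proof. by rewrite /c -{1}(ltrans_bas7 x) cplx_ltrans frame_cplx_bas7 ltrans_JZ1. Qed.
Let p := g x a a.
Let q := g x b b.
Let r := g x c c.
Let al1 := g x a b.
Let al2 := g x a (J x b).
Let be1 := g x a c.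
Let be2 := g x a (J x c).
Let ga1 := g x b c.
Let ga2 := g x b (J x c).

Let gDl u v z : g x (u + v) z = g x u z + g x v z.
Proof. by rewrite !(g_sym _ _ z) gDr. Qed.
Let gZr k u v : g x u (k *: v) = k * g x u v.
Proof. by have := g_linearr x u k v 0; rewrite !addr0 g0r addr0. Qed.
Let gZl k u v : g x (k *: u) v = k * g x u v.
Proof. by rewrite !(g_sym _ _ v) gZr. Qed.
Let gJJ u : g x (J x u) u = 0.
Proof. by have := gJl x u u; rewrite g_sym => /eqP; rewrite -addr_eq0 -mulr2n mulrn_eq0 => /eqP. Qed.

Definition gram2 : R := p * q - al1 ^+ 2 - al2 ^+ 2.
Definition gram3 : R := p * q * r +
  2 * ((al1 * ga1 - al2 * ga2) * be1 + (al1 * ga2 + al2 * ga1) * be2) -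
  p * (ga1 ^+ 2 + ga2 ^+ 2) - q * (be1 ^+ 2 + be2 ^+ 2) - r * (al1 ^+ 2 + al2 ^+ 2).

Let comb k1 k2 k3 k4 k5 : V :=
  ltrans x (k1 *: bas 2 + k2 *: bas 3 + k3 *: bas 4 + k4 *: bas 5 + k5 *: bas 7).

Let combE k1 k2 k3 k4 k5 : comb k1 k2 k3 k4 k5 =
  k1 *: a + k2 *: J x a + k3 *: b + k4 *: J x b + k5 *: c.
Proof.
have lD u v : ltrans x (u + v) = ltrans x u + ltrans x v by exact: linearD.
have lZ k u : ltrans x (k *: u) = k *: ltrans x u.
  exact: (linearZ_LR (ltrans x)).
by rewrite Ja Jb /comb !lD !lZ ltrans_bas7.
Qed.

Let comb_norm k1 k2 k3 k4 k5 : g x (comb k1 k2 k3 k4 k5) (comb k1 k2 k3 k4 k5) =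
  (k1 ^+ 2 + k2 ^+ 2) * p + (k3 ^+ 2 + k4 ^+ 2) * q + k5 ^+ 2 * r +
  2 * ((k1 * k3 + k2 * k4) * al1 + (k1 * k4 - k2 * k3) * al2 +
       k5 * (k1 * be1 - k2 * be2 + k3 * ga1 - k4 * ga2)).
Proof.
rewrite !combE !gDl !gDr !gZl !gZr !g_cplx !gJJ.
rewrite (g_sym x a (J x a)) (g_sym x b (J x b)) !gJJ.
rewrite (g_sym x b a) (g_sym x (J x b) a) (g_sym x b (J x a)).
rewrite (g_sym x c (J x a)) (g_sym x c (J x b)) (g_sym x c a) (g_sym x c b).
rewrite !(gJl x a) !(gJl x b).
rewrite -/p -/q -/r -/al1 -/al2 -/be1 -/be2 -/ga1 -/ga2.
ring.
Qed.

Let comb_gt0 k1 k2 k3 k4 k5 n : (n < 8)%N ->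
  crd n (k1 *: bas 2 + k2 *: bas 3 + k3 *: bas 4 + k4 *: bas 5 + k5 *: bas 7) != 0 ->
  0 < g x (comb k1 k2 k3 k4 k5) (comb k1 k2 k3 k4 k5).
Proof.
move=> n8 kn; apply: g_gt0; apply: contra_neq kn => /(congr1 (ltrans (- x))).
by rewrite /comb ltransK linear0 => ->; rewrite crd0.
Qed.

Lemma gram1_gt0 : 0 < p.
Proof.
have := @comb_gt0 1 0 0 0 0 2 isT; rewrite comb_norm !crdE !crd_bas //= => H.
suff : p = (1 ^+ 2 + 0 ^+ 2) * p + (0 ^+ 2 + 0 ^+ 2) * q + 0 ^+ 2 * r +
  2 * ((1 * 0 + 0 * 0) * al1 + (1 * 0 - 0 * 0) * al2 +
       0 * (1 * be1 - 0 * be2 + 0 * ga1 - 0 * ga2)).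
  by move=> ->; apply: H; rewrite mulr1 !mulr0 !addr0 oner_eq0.
by ring.
Qed.

(** Gram-Schmidt cleared of denominators: the squared norm of [p b] minus its
    component along the complex line of [a] is [p * gram2]. *)
Lemma gram2_gt0 : 0 < gram2.
Proof.
have p0 := gram1_gt0.
rewrite -(pmulr_rgt0 _ p0); have := @comb_gt0 (- al1) al2 p 0 0 4 isT.
rewrite comb_norm !crdE !crd_bas //= !(mulr0, add0r, addr0, mulr1) gt_eqF // => /(_ isT).
by congr (_ < _); rewrite /gram2; ring.
Qed.

(** Likewise for the part of [gram2 *: c] orthogonal to the complex span of [a] and
    [b], whose coefficients are given by Cramer's rule. *)
Lemma gram3_gt0 : 0 < gram3.
Proof.
have d0 := gram2_gt0; rewrite -(pmulr_rgt0 _ d0).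
have := @comb_gt0 (- (q * be1 - (al1 * ga1 - al2 * ga2))) (q * be2 - (al1 * ga2 + al2 * ga1))
  (- (p * ga1 - (al1 * be1 + al2 * be2))) (p * ga2 + (al2 * be1 - al1 * be2)) gram2 7 isT.
rewrite comb_norm !crdE !crd_bas //= !(mulr0, add0r, addr0, mulr1) gt_eqF // => /(_ isT).
by congr (_ < _); rewrite /gram2 /gram3; ring.
Qed.

(** [Z_0 = J Z_1 - Z_1], where [Z_1] does not contribute since it already occurs
    among the arguments. *)
Lemma form_exp3_gram : complex.Re (on_frame K (form_exp Om 3)
  [:: bas 6; bas 2; bas 3; bas 4; bas 5; bas 7] x) = - (6 * gram3).
Proof.
apply: (etrans (congr1 (@complex.Re R) (form_exp3 x (ltrans x (bas 6))
  (ltrans x (bas 2)) (ltrans x (bas 3)) (ltrans x (bas 4)) (ltrans x (bas 5))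
  (ltrans x (bas 7))))).
have six : (6 : C) = (6%:R)%:C%C by rewrite rmorph_nat.
rewrite /pfaffian4 six -!(rmorphM, rmorphB, rmorphD) /=.
have -> : ltrans x (bas 6) = J x c - c.
  rewrite Jc /JZ1 -[LHS]addr0 -(subrr (bas 7)) addrA; congr (_ + _ - _).
  by apply: ltrans_central; rewrite crd_bas.
rewrite ltrans_bas7 -Ja -Jb -/a -/b -/c.
have Om_atBl u v z : Om_at x (u - v) z = Om_at x u z - Om_at x v z.
  by have := Om_at_linearl x z (-1) v u; rewrite scaleN1r mulN1r addrC => ->; rewrite addrC.
have oJ u : Om_at x (J x c) u = - g x u c by rewrite /Om_at cplxK g_sym gNr.
have oc u : Om_at x c u = g x u (J x c) by rewrite /Om_at g_sym.
have oaJ u v : Om_at x u (J x v) = g x u v by rewrite /Om_at g_cplx.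
have oab u v : Om_at x u v = - g x u (J x v) by rewrite /Om_at gJl.
rewrite !Om_atBl !oJ !oc !oaJ !oab !(gJl x a) !(gJl x b) !cplxK !gNr.
rewrite (g_sym x c (J x c)) gJJ.
rewrite -/p -/q -/r -/al1 -/al2 -/be1 -/be2 -/ga1 -/ga2 /gram3.
ring.
Qed.

End Wirtinger.

(** Of the three brackets only [[X_0, Y_0] = Z_0] contributes: the other two would
    repeat [Z_1] among the arguments. *)
Lemma ext_d_frame0123457 (w : dform V 6) x : smooth_form w -> mlin_form w -> alt_form w ->
  on_frame K (ext_d w) [:: bas 0; bas 1; bas 2; bas 3; bas 4; bas 5; bas 7] x =
  cderive (ltrans x (bas 0)) (on_frame K w [:: bas 1; bas 2; bas 3; bas 4; bas 5; bas 7]) x -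
  cderive (ltrans x (bas 1)) (on_frame K w [:: bas 0; bas 2; bas 3; bas 4; bas 5; bas 7]) x +
  cderive (ltrans x (bas 2)) (on_frame K w [:: bas 0; bas 1; bas 3; bas 4; bas 5; bas 7]) x -
  cderive (ltrans x (bas 3)) (on_frame K w [:: bas 0; bas 1; bas 2; bas 4; bas 5; bas 7]) x +
  cderive (ltrans x (bas 4)) (on_frame K w [:: bas 0; bas 1; bas 2; bas 3; bas 5; bas 7]) x -
  cderive (ltrans x (bas 5)) (on_frame K w [:: bas 0; bas 1; bas 2; bas 3; bas 4; bas 7]) x +
  cderive (ltrans x (bas 7)) (on_frame K w [:: bas 0; bas 1; bas 2; bas 3; bas 4; bas 5]) x -
  on_frame K w [:: bas 6; bas 2; bas 3; bas 4; bas 5; bas 7] x.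
Proof.
move=> sw lw aw; rewrite (ext_d_frame_bracket _ sw lw) //.
rewrite !big_ord_recl !big_ord0 /delete /=.
rewrite shear_bas01 shear_bas23 shear_bas45 !shear_bas0 //.
have z j s : (j < 6)%N -> s`_j = 0 -> on_frame K w s x = 0.
  by move=> j6 sj; apply: (on_frame_eq0 _ lw j6 sj).
rewrite !(z 0%N [:: 0; _; _; _; _; _]) // !(z 1%N [:: _; 0; _; _; _; _]) //.
rewrite !(z 2%N [:: _; _; 0; _; _; _]) // !(z 3%N [:: _; _; _; 0; _; _]) //.
rewrite !(z 4%N [:: _; _; _; _; 0; _]) // !(z 5%N [:: _; _; _; _; _; 0]) //.
have z7 s (i j : 'I_6) : i != j -> s`_i = s`_j -> on_frame K w s x = 0.
  move=> ij sij; rewrite on_frameE; apply: (alternates_eq0 (aw x) ij).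
  by rewrite /args sij.
rewrite (z7 [:: _; _; bas 7; _; _; bas 7] (Ordinal (isT : 2 < 6)%N) (Ordinal (isT : 5 < 6)%N)) //.
rewrite (z7 [:: _; _; _; _; bas 7; bas 7] (Ordinal (isT : 4 < 6)%N) (Ordinal (isT : 5 < 6)%N)) //.
rewrite bump01 bump012 bump0123 (_ : bump 0 3 = 4)%N // (_ : bump 0 4 = 5)%N //.
rewrite (_ : bump 0 5 = 6)%N // expr0 expr1 sign2 sign3 sign4 sign5 sign6.
repeat match goal with |- context [cderive ?h ?f ?y] =>
  let d := fresh "d" in move: (cderive h f y) => d end.
by move: (on_frame K w _ x) => d7; ring.
Qed.

(** The bracket term [- Omega^3 (Z_0, X_1, Y_1, X_2, Y_2, Z_1)] is positive by
    [gram3_gt0], but all other terms of [d (Omega^3)] form a divergence. *)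
Theorem no_balanced : cocompact K Gam -> ~ balanced 4 J g.
Proof.
move=> cG bal.
have sw : smooth_form (form_exp Om 3) by apply: smooth_form_exp; exact: Om_smooth.
have lw : mlin_form (form_exp Om 3) by apply: form_exp_mlin; exact: Om_mlin.
have aw : alt_form (form_exp Om 3) by exact: form_exp_alt.
have iw : form_invariant K Gam (form_exp Om 3).
  by apply: form_exp_invariant; exact: Om_invariant.
have pos y : complex.Re (on_frame K (form_exp Om 3)
    [:: bas 6; bas 2; bas 3; bas 4; bas 5; bas 7] y) < 0.
  by rewrite form_exp3_gram oppr_lt0 mulr_gt0 ?gram3_gt0.
have dw : ext_d (form_exp Om 3) = fun _ _ => 0.
  by apply/funext => y; apply/funext => v; exact: bal.
move: (form_exp Om 3) sw lw aw iw pos dw => w sw lw aw iw pos dw {bal}.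
have [B [BE sB gB divB]] : exists B : seq V -> V -> R^o,
    [/\ forall s y, complex.Re (on_frame K w s y) = B s y,
       forall s, smooth_on setT (B s), forall s, gamma_invariant K Gam (B s) &
       forall x, 'D_(frame K 0 x) (B [:: bas 1; bas 2; bas 3; bas 4; bas 5; bas 7]) x -
  'D_(frame K 1 x) (B [:: bas 0; bas 2; bas 3; bas 4; bas 5; bas 7]) x +
  'D_(frame K 2 x) (B [:: bas 0; bas 1; bas 3; bas 4; bas 5; bas 7]) x -
  'D_(frame K 3 x) (B [:: bas 0; bas 1; bas 2; bas 4; bas 5; bas 7]) x +
  'D_(frame K 4 x) (B [:: bas 0; bas 1; bas 2; bas 3; bas 5; bas 7]) x -
  'D_(frame K 5 x) (B [:: bas 0; bas 1; bas 2; bas 3; bas 4; bas 7]) x +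
  'D_(frame K 7 x) (B [:: bas 0; bas 1; bas 2; bas 3; bas 4; bas 5]) x =
  B [:: bas 6; bas 2; bas 3; bas 4; bas 5; bas 7] x].
  exists (fun s y => complex.Re (on_frame K w s y)); split=> //.
  - by move=> s; exact: (on_frame_smooth K s sw lw).1.
  - by move=> s a y Ga; rewrite (on_frame_invariant _ _ iw Ga).
  - move=> x; have := ext_d_frame0123457 x sw lw aw.
    rewrite dw => /esym/eqP; rewrite subr_eq0 => /eqP.
    have ReE (a b c d e f h z : C) : a - b + c - d + e - f + h = z ->
        complex.Re a - complex.Re b + complex.Re c - complex.Re d + complex.Re e -
        complex.Re f + complex.Re h = complex.Re z.
      by case: a b c d e f h z => [? ?] [? ?] [? ?] [? ?] [? ?] [? ?] [? ?] [? ?] [].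
    exact: ReE.
pose f (n : nat) : V -> R^o := match n with
  | 0 => - B [:: bas 1; bas 2; bas 3; bas 4; bas 5; bas 7]
  | 1 => B [:: bas 0; bas 2; bas 3; bas 4; bas 5; bas 7]
  | 2 => - B [:: bas 0; bas 1; bas 3; bas 4; bas 5; bas 7]
  | 3 => B [:: bas 0; bas 1; bas 2; bas 4; bas 5; bas 7]
  | 4 => - B [:: bas 0; bas 1; bas 2; bas 3; bas 5; bas 7]
  | 5 => B [:: bas 0; bas 1; bas 2; bas 3; bas 4; bas 7]
  | 6 => cst 0
  | _ => - B [:: bas 0; bas 1; bas 2; bas 3; bas 4; bas 5] end.
pose u := - B [:: bas 6; bas 2; bas 3; bas 4; bas 5; bas 7].
have sf n : smooth_on setT (f n).
  by do 7?[case: n => [|n]] => /=; try exact: smoothN (sB _); try exact: smooth_cst; exact: sB.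
have gN s : gamma_invariant K Gam (- B s).
  by move=> a y Ga; rewrite /GRing.opp /= gB.
have gf n : gamma_invariant K Gam (f n).
  by do 7?[case: n => [|n]] => //=; exact: gN.
apply: (frame_divergence cG (fun n _ => sf n) (fun n _ => gf n)
  (smooth_cont (smoothN (sB _))) (gN _)) => x; last first.
  rewrite /GRing.opp /= oppr_gt0 -BE; exact: pos.
rewrite !big_ord_recl big_ord0 /= derive_cst.
have dN v s : 'D_v (- B s) x = - 'D_v (B s) x.
  by rewrite deriveN //; apply: smooth_derivable.
rewrite !dN /u.
rewrite (_ : bump 0 3 = 4)%N // (_ : bump 0 4 = 5)%N // (_ : bump 0 5 = 6)%N //.
rewrite (_ : bump 0 6 = 7)%N // (_ : bump 0 0 = 1)%N // (_ : bump 0 1 = 2)%N // (_ : bump 0 2 = 3)%N //.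
have -> : (- B [:: bas 6; bas 2; bas 3; bas 4; bas 5; bas 7]) x =
  - B [:: bas 6; bas 2; bas 3; bas 4; bas 5; bas 7] x by [].
rewrite -divB.
repeat match goal with |- context [derive ?h ?y ?v] =>
  let d := fresh "d" in move: (derive h y v : R) => d end.
ring.
Qed.

End HermitianMetric.

(** * Holomorphic coordinates *)

Section Chart.
Variables (R : realType) (V : normedModType R) (K : coord_system V).
Local Notation C := R[i].
Local Notation crd := (crd K).
Local Notation cplx := (cplx K).

(** Chosen such that its differential is [x_j dy_j], the non-closed part of the
    central coframe, up to a term of type (1,0). *)
Definition chart_potential j (y : V) : C := 2^-1 * ((crd j.*2 y)%:C%C * (crd j.*2.+1 y)%:C%C) +
  'i%C / 4 * ((crd j.*2 y)%:C%C * (crd j.*2 y)%:C%C +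
              (crd j.*2.+1 y)%:C%C * (crd j.*2.+1 y)%:C%C).

Definition chart (j : 'I_4) (y : V) : C :=
  if (j < 3)%N then (crd j.*2 y)%:C%C + 'i%C * (crd j.*2.+1 y)%:C%C
  else ('i%C - 1) * ((crd 6 y)%:C%C + (-1) * chart_potential 0 y) +
       ((crd 7 y)%:C%C + (-1) * (chart_potential 1 y + chart_potential 2 y)).

Let sX n : csmooth (fun y => (crd n y)%:C%C).
Proof. by apply: csmoothR; exact: smooth_crd. Qed.

Let dX n x v : cderive v (fun y => (crd n y)%:C%C) x = (crd n v)%:C%C.
Proof. by rewrite (cderiveR v (crd n)) derive_crd. Qed.

Lemma smooth_chart_potential j : csmooth (chart_potential j).
Proof.
apply: csmoothD; first by apply: csmoothZ; apply: csmoothM; exact: sX.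
by apply: csmoothZ; apply: csmoothD; apply: csmoothM; exact: sX.
Qed.

Lemma smooth_chart j : csmooth (chart j).
Proof.
have sphi := smooth_chart_potential.
rewrite /chart; case: (j < 3)%N; first by apply: csmoothD; [|apply: csmoothZ]; exact: sX.
apply: csmoothD; last by apply: csmoothD; [exact: sX|apply: csmoothZ; exact: csmoothD].
by apply: csmoothZ; apply: csmoothD; [exact: sX|exact: csmoothZ].
Qed.

Lemma derive_chart_potential j x v : cderive v (chart_potential j) x =
  (crd j.*2 x)%:C%C * (crd j.*2.+1 v)%:C%C +
  'i%C / 2 * zeta K false j x x * zeta K true j x v.
Proof.
have sM n m : csmooth (fun y => (crd n y)%:C%C * (crd m y)%:C%C) by exact: csmoothM.
rewrite cderiveD; [|exact: csmoothZ|by apply: csmoothZ; exact: csmoothD].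
rewrite !cderiveZ //; last exact: csmoothD.
rewrite cderiveD // !cderiveM // !dX /zeta /dcrd /conj_sign /=.
have i2 : 'i%C * 'i%C = -1 :> C by rewrite -expr2 sqr_i.
move: ('i%C : C) i2 => I I2.
move: (_ %:C%C) (_ %:C%C) (_ %:C%C) (_ %:C%C) => a b c d.
by field: I2.
Qed.

(** The terms in [zeta K true j x v] are complex linear in [v], so that the last
    coordinate is holomorphic because [vert_form K true] has type (1,0). *)
Lemma derive_chart j x v : cderive v (chart j) x =
  if (j < 3)%N then zeta K true j x v else
  vert_form K true x v - 'i%C / 2 * (('i%C - 1) * zeta K false 0 x x * zeta K true 0 x v +
    zeta K false 1 x x * zeta K true 1 x v + zeta K false 2 x x * zeta K true 2 x v).
Proof.
have sphi := smooth_chart_potential; have dphi := derive_chart_potential.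
move: sphi dphi; rewrite /chart; move: chart_potential => phi sphi dphi; have sZ c k : csmooth (fun y => c * phi k y).
  exact: csmoothZ.
case: (j < 3)%N.
  by rewrite cderiveD ?cderiveZ ?dX //; exact: csmoothZ.
have s1 : csmooth (fun y => (crd 6 y)%:C%C + -1 * phi 0 y) by exact: csmoothD.
have s2 : csmooth (fun y => phi 1 y + phi 2 y) by exact: csmoothD.
have s3 : csmooth (fun y => (crd 7 y)%:C%C + -1 * (phi 1 y + phi 2 y)).
  by apply: csmoothD; [exact: sX|exact: csmoothZ].
have s4 : csmooth (fun y => -1 * (phi 1 y + phi 2 y)) by exact: csmoothZ.
rewrite cderiveD //; last exact: csmoothZ.
rewrite !(cderiveD, cderiveZ) //.
rewrite !dphi !dX.
rewrite /vert_form coframe6 coframe7 /conj_sign /= !(rmorphB, rmorphD, rmorphM) /=.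
by ring.
Qed.

Lemma derive_chart_cplx j x v : cderive (cplx x v) (chart j) x = 'i%C * cderive v (chart j) x.
Proof.
rewrite !derive_chart; case: ifP => j3; first by rewrite zeta_cplx.
rewrite vert_form_cplx !zeta_cplx // /conj_sign /=.
by ring.
Qed.

Lemma chart_injective x v : (forall j, cderive v (chart j) x = 0) -> v = 0.
Proof.
move=> z; have reim (a b : R) : a%:C%C + 'i%C * b%:C%C = 0 -> a = 0 /\ b = 0.
  move=> /eqP; rewrite eq_complex /= !(mul0r, mul1r, mulr0, addr0, add0r, subr0, oppr0).
  by move=> /andP[/eqP ? /eqP ?].
have z3 (j : nat) : (j < 3)%N -> zeta K true j x v = 0.
  by move=> j3; have := z (Ordinal (ltnW j3 : (j < 4)%N)); rewrite derive_chart /= j3.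
have c6 n : (n < 6)%N -> crd n v = 0.
  move=> n6; have n3 : (n./2 < 3)%N by rewrite ltn_half_double.
  have [e o] := reim _ _ (z3 _ n3); rewrite -(odd_double_half n).
  by case: (odd n).
have := z ord_max; rewrite derive_chart /= !z3 // !mulr0 !addr0 mulr0 subr0.
move=> /reim[]; rewrite coframe6 coframe7 (c6 1%N) // (c6 3%N) // (c6 5%N) // !mulr0 !addr0 !subr0 => c76 c6'.
apply: (crd_ext (K := K)) => n n8; rewrite crd0.
case: (ltnP n 6) => [|n6]; first exact: c6.
have /orP[/eqP->|/eqP->] : (n == 6)%N || (n == 7)%N by move: n6 n8; lia.
  exact: c6'.
by move: c76; rewrite c6' subr0.
Qed.

End Chart.

(** * The product of Heisenberg groups *)

Section Coordinates.
Variable R : realType.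
Local Notation G := (H3xH5 R).

(** The matrix entries, in the order used by [coord_system]. *)
Definition entry (n : nat) (p : G) : R^o :=
  match n with
  | 0 => p.1.1.1 0 0 | 1 => p.1.1.2 0 0
  | 2 => p.2.1.1 0 0 | 3 => p.2.1.2 0 0
  | 4 => p.2.1.1 0 1 | 5 => p.2.1.2 0 1
  | 6 => p.1.2 | _ => p.2.2
  end.

Lemma entry_is_linear n : linear (entry n : G -> R^o).
Proof.
by move=> c a b; do 7?[case: n => [|n]] => //=; rewrite !mxE.
Qed.

HB.instance Definition _ n :=
  GRing.isLinear.Build R G R^o _ (entry n) (entry_is_linear n).

Lemma entry_cont n : continuous (entry n).
Proof.
have c1 : continuous (fun p : G => p.1 : heis R 1) by move=> p; apply: cvg_fst.
have c2 : continuous (fun p : G => p.2 : heis R 2) by move=> p; apply: cvg_snd.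
have d m : continuous (fun p : heis R m => p.1 : 'rV[R]_m * 'rV[R]_m).
  by move=> p; apply: (@cvg_fst ('rV[R]_m * 'rV[R]_m)%type R^o).
have dz m : continuous (fun p : heis R m => p.2 : R^o).
  by move=> p; apply: (@cvg_snd ('rV[R]_m * 'rV[R]_m)%type R^o).
have f1 m : continuous (fun p : 'rV[R]_m * 'rV[R]_m => p.1) by move=> p; apply: cvg_fst.
have f2 m : continuous (fun p : 'rV[R]_m * 'rV[R]_m => p.2) by move=> p; apply: cvg_snd.
have e m (j : 'I_m) : continuous (fun p : 'rV[R]_m => p 0 j : R^o).
  exact: coord_continuous.
do 7?[case: n => [|n]] => /=; move=> p.
- exact: continuous_comp (continuous_comp (continuous_comp (@c1 p) (@d _ _)) (@f1 _ _)) (@e _ _ _).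
- exact: continuous_comp (continuous_comp (continuous_comp (@c1 p) (@d _ _)) (@f2 _ _)) (@e _ _ _).
- exact: continuous_comp (continuous_comp (continuous_comp (@c2 p) (@d _ _)) (@f1 _ _)) (@e _ _ _).
- exact: continuous_comp (continuous_comp (continuous_comp (@c2 p) (@d _ _)) (@f2 _ _)) (@e _ _ _).
- exact: continuous_comp (continuous_comp (continuous_comp (@c2 p) (@d _ _)) (@f1 _ _)) (@e _ _ _).
- exact: continuous_comp (continuous_comp (continuous_comp (@c2 p) (@d _ _)) (@f2 _ _)) (@e _ _ _).
- exact: continuous_comp (@c1 p) (@dz _ _).
- exact: continuous_comp (@c2 p) (@dz _ _).
Qed.

Definition of_entries (f : nat -> R) : G :=
  ((const_mx (f 0%N), const_mx (f 1%N), f 6%N),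
   (\row_(j < 2) f (2 + j.*2)%N, \row_(j < 2) f (3 + j.*2)%N, f 7%N)).

Lemma entry_of_entries f n : (n < 8)%N -> entry n (of_entries f) = f n.
Proof. by do 8?[case: n => [|n]] => //= _; rewrite !mxE. Qed.

Lemma entry_ext p q : (forall n, (n < 8)%N -> entry n p = entry n q) -> p = q.
Proof.
case: p q => [[[a b] c] [[d e] f]] [[[a' b'] c'] [[d' e'] f']] H.
have o1 (j : 'I_1) : j = 0 by apply: ord_inj; case: j => -[].
have o2 (j : 'I_2) : j = 0 \/ j = 1.
  by case: j => -[|[|//]] ?; [left|right]; apply: ord_inj.
congr (_, _, _, (_, _, _)).
- by apply/rowP => j; rewrite (o1 j); exact: (H 0%N).
- by apply/rowP => j; rewrite (o1 j); exact: (H 1%N).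
- exact: (H 6%N).
- by apply/rowP => j; case: (o2 j) => ->; [exact: (H 2%N)|exact: (H 4%N)].
- by apply/rowP => j; case: (o2 j) => ->; [exact: (H 3%N)|exact: (H 5%N)].
- exact: (H 7%N).
Qed.

Definition unit_entry n : G := of_entries (fun m => (m == n)%:R).

Lemma entry_unit n m : (n < 8)%N -> entry n (unit_entry m) = (n == m)%:R.
Proof. by move=> n8; rewrite entry_of_entries. Qed.

Lemma entryZ n c p : entry n (c *: p) = c * entry n p.
Proof. exact: (linearZ_LR (entry n)). Qed.

Lemma entryK (v : G) : v = \sum_(b < 8) entry b v *: unit_entry b.
Proof.
apply: entry_ext => n n8; rewrite raddf_sum /=.
rewrite (bigD1 (Ordinal n8)) //= big1 ?addr0 => [|j jn]; rewrite entryZ entry_unit //.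
  by rewrite eqxx; rewrite mulr1.
by rewrite -(inj_eq val_inj) /= eq_sym in jn; rewrite (negbTE jn); rewrite mulr0.
Qed.

Definition heis_coord : coord_system G := CoordSystem entry_cont entry_unit entryK.

Lemma entry_mul n a b : (n < 8)%N ->
  entry n (a * b)%g = entry n a + entry n b + cocycle heis_coord a b n.
Proof.
do 8?[case: n => [|n]] => //= _; rewrite ?addr0 ?mxE //.
  by rewrite big_ord1 !mxE.
rewrite big_ord_recl big_ord1 !mxE.
by congr (_ + (_ + _ * _)); congr (_ _ _); apply: ord_inj.
Qed.

Lemma mulg_gmul (a x : G) : (a * x)%g = gmul heis_coord a x.
Proof.
apply: entry_ext => n n8; rewrite entry_mul // /gmul.
apply: (etrans _ (esym (crdD heis_coord n _ _))).
rewrite crd_ltrans //; move: (cocycle _ _ _ _) => c.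
by rewrite -addrA addrC.
Qed.

Lemma dtransE (a x v : G) : dtrans a x v = ltrans heis_coord a v.
Proof.
rewrite /dtrans -(derive_gmul heis_coord a x v).
by congr ('D_v _ x); apply/funext => y; exact: mulg_gmul.
Qed.

End Coordinates.

(** * Compact quotients *)

Section Quotient.
Local Open Scope quotient_scope.
Variables (R : realType) (Gam : subgroup (H3xH5 R)).
Local Notation G := (H3xH5 R).
Local Notation K := (heis_coord R).
Local Notation Q := (quotient_topology (left_quotient Gam)).

(** An invariant continuous function descends to the compact quotient. *)
Lemma lattice_cocompact : is_lattice Gam -> cocompact K (subgroup_set Gam).
Proof.
move=> [_ cQ] f cf gf.
have fE (x y : G) : \pi_Q x == \pi_Q y :> Q -> f x == f y.
  move=> /eqP /eqmodP /asboolP [a Ga ->].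
  by rewrite mulg_gmul gf.
have cfr : continuous (f \o repr : Q -> R^o).
  exact: (@repr_comp_continuous G (left_quotient Gam) R^o f cf fE).
have Q0 : [set: Q] !=set0 by exists (\pi_Q (1%g : G)).
have [c _ cmin] := @compact_EVT_min Q R (f \o repr) setT Q0 cQ
  (continuous_subspaceT cfr).
exists (repr c) => x.
have -> : f x = (f \o repr) (\pi_Q x : Q).
  by apply/eqP; apply: fE; rewrite reprK.
by apply: cmin; rewrite in_setT.
Qed.

Lemma hermitian_metric_coord g : hermitian_metric Gam (cplx K) g ->
  [/\ forall x u, linear (g x u : G -> R^o), forall x u v, g x u v = g x v u,
      forall x v, v != 0 -> 0 < g x v v,
      forall u v, smooth_on setT (fun x => g x u v : R^o) &
      (forall a x u v, subgroup_set Gam a ->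
        g (gmul K a x) (ltrans K a u) (ltrans K a v) = g x u v) /\
      forall x u v, g x (cplx K x u) (cplx K x v) = g x u v].
Proof.
move=> [[glin gsym] gpos gsm ginv gJ]; split=> //; split=> // a x u v Ga.
by rewrite -mulg_gmul -!(dtransE a x) ginv.
Qed.

Lemma cplx_complex_structure : complex_structure Gam (cplx K).
Proof.
split.
- exact: cplx_linear.
- exact: smooth_cplx.
- exact: cplxK.
- by move=> a x v _; rewrite mulg_gmul !dtransE cplx_gmul.
move=> x; exists setT; first by split; [exact: openT|].
exists (chart K); split.
- exact: smooth_chart.
- by move=> y v j _; exact: derive_chart_cplx.
- by move=> y v _; exact: chart_injective.
Qed.

Lemma metric_left_invariant : left_invariant (metric K).
Proof. by move=> a x v w _; rewrite mulg_gmul !dtransE metric_gmul. Qed.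

Lemma metric_hermitian : hermitian_metric Gam (cplx K) (metric K).
Proof.
split.
- by split=> [x v c u w|x v w]; [exact: metric_linear|exact: metricC].
- exact: metric_gt0.
- exact: smooth_metric.
- by move=> a x v w _; exact: metric_left_invariant.
- exact: metric_cplx.
Qed.

End Quotient.

Theorem corollary4p11 (R : realType) (Gam : subgroup (H3xH5 R)) :
  is_lattice Gam ->
  exists J : H3xH5 R -> H3xH5 R -> H3xH5 R,
    [/\ complex_structure Gam J,
        ~ (exists g, hermitian_metric Gam J g /\ SKT J g),
        ~ (exists g, hermitian_metric Gam J g /\ balanced 4 J g) &
        forall k : nat, (k = 1 \/ k = 2)%N ->
          exists g, [/\ hermitian_metric Gam J g, left_invariant g
                      & gauduchon 4 k J g]].
Proof.
move=> /lattice_cocompact cG; exists (cplx (heis_coord R)); split.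
- exact: cplx_complex_structure.
- move=> [g [/hermitian_metric_coord[glin gsym gpos gsm [ginv gJ]]]].
  exact: (no_SKT glin gsym gpos gsm ginv gJ cG).
- move=> [g [/hermitian_metric_coord[glin gsym gpos gsm [ginv gJ]]]].
  exact: (no_balanced glin gsym gpos gsm ginv gJ cG).
move=> k k12; exists (metric (heis_coord R)); split.
- exact: metric_hermitian.
- exact: metric_left_invariant.
- by case: k12 => ->; [exact: metric_gauduchon1|exact: metric_gauduchon2].
Qed.
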